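(* Let $N\ge1$, $0<\gamma<1$, $q=N/\gamma$ and $1\le p<\infty$. Put $r=\max\{p,q\}$, $r'=r/(r-1)$ and $k=\lceil p/r'\rceil$ (the least integer equal to or larger than $p/r'$). There exists a constant $\alpha>0$ (independent of $\phi$) such that, for every $\phi\in L^p(\mathbb{R}^N)$ with $(-\Delta)^{\gamma/2}\phi\in L^q(\mathbb{R}^N)$ and $\|\phi\|_p+\|(-\Delta)^{\gamma/2}\phi\|_q\le1$, $$\int_{\mathbb{R}^N}\left(e^{\alpha|\phi|^{r'}}-\sum_{j=0}^{k-1}\frac{(\alpha|\phi|^{r'})^j}{j!}\right)dx\le1.$$
   Context: $(-\Delta)^{\gamma/2}$ is the operator with Fourier symbol $|\xi|^\gamma$. *)

(* Defs.v *)
From HB Require Import structures.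
From mathcomp Require Import all_boot all_order all_algebra.
From mathcomp Require Import all_classical all_reals all_analysis.
From mathcomp Require Import complex.

Set Implicit Arguments.
Unset Strict Implicit.
Unset Printing Implicit Defensive.

Import Order.TTheory GRing.Theory Num.Theory.
Import numFieldNormedType.Exports.

Local Open Scope classical_set_scope.
Local Open Scope ring_scope.

(* R^n is the type of row vectors 'rV[R]_n, with its library topology and with
   the Borel sigma-algebra, presented as the one generated by the coordinates.
   Every Lebesgue measurable function has a Borel representative, so Borel
   functions suffice for the spaces L^p. *)
Section borel_rV.
Context (R : realType) (n : nat).

Definition rV_coord (i : 'I_n) (x : 'rV[R]_n) : measurableTypeR R := x ord0 i.

Let rV_set0 : g_sigma_preimage rV_coord set0.
Proof. exact: sigma_algebra0. Qed.

Let rV_setC A : g_sigma_preimage rV_coord A -> g_sigma_preimage rV_coord (~` A).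
Proof. exact: sigma_algebraC. Qed.

Let rV_bigcup (F : (set 'rV[R]_n)^nat) :
  (forall i, g_sigma_preimage rV_coord (F i)) ->
  g_sigma_preimage rV_coord (\bigcup_i (F i)).
Proof. exact: sigma_algebra_bigcup. Qed.

HB.instance Definition _ := @isMeasurable.Build default_measure_display
  'rV[R]_n (g_sigma_preimage rV_coord) rV_set0 rV_setC rV_bigcup.

Lemma measurable_rV_coord (i : 'I_n) : measurable_fun [set: 'rV[R]_n] (rV_coord i).
Proof.
move=> _ Y mY; rewrite setTI; apply: sub_sigma_algebra => /=.
rewrite -bigcup_seq/=; exists i => /=; first by rewrite mem_index_enum.
by exists Y => //; rewrite setTI.
Qed.

Lemma measurable_fun_rV d (T : measurableType d) (f : T -> 'rV[R]_n) :
  (forall i, measurable_fun [set: T] (rV_coord i \o f)) ->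
  measurable_fun [set: T] f.
Proof.
move=> mf; suff h : g_sigma_preimage (fun i => rV_coord i \o f) `<=` measurable.
  move=> _ Y mY; apply: h; rewrite g_sigma_preimage_comp.
  by exists Y.
apply: smallest_sub; first exact: sigma_algebra_measurable.
move=> A; rewrite -bigcup_seq/= => -[i _ [B mB <-]].
exact: mf.
Qed.

End borel_rV.

Section lebesgue_rV.
Context (R : realType).

Definition cons_rV n (t : measurableTypeR R * 'rV[R]_n) : 'rV[R]_n.+1 :=
  row_mx (t.1 : R)%:M t.2.

Definition uncons_rV n (x : 'rV[R]_n.+1) : measurableTypeR R * 'rV[R]_n :=
  (x ord0 ord0, \row_i x ord0 (lift ord0 i)).

Lemma cons_rV0 n t : @cons_rV n t ord0 ord0 = t.1.
Proof.
rewrite /cons_rV.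
rewrite (_ : ord0 = lshift n (ord0 : 'I_1)); last exact/val_inj.
by rewrite (row_mxEl (t.1 : R)%:M t.2) mxE mulr1n.
Qed.

Lemma cons_rVS n t i : @cons_rV n t ord0 (lift ord0 i) = t.2 ord0 i.
Proof.
rewrite /cons_rV.
rewrite (_ : lift ord0 i = rshift 1 i); last exact/val_inj.
by rewrite (row_mxEr (t.1 : R)%:M t.2).
Qed.

Lemma cons_rVK n : cancel (@cons_rV n) (@uncons_rV n).
Proof.
move=> [a x]; congr pair; first exact: cons_rV0.
by apply/rowP => i; rewrite mxE cons_rVS.
Qed.

Lemma measurable_cons_rV n : measurable_fun setT (@cons_rV n).
Proof.
apply: measurable_fun_rV => i.
case: (unliftP ord0 i) => [j|] ->.
  rewrite (_ : _ \o _ = rV_coord j \o snd).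
    by apply: measurableT_comp => //; exact: measurable_rV_coord.
  by apply/funext => t; exact: cons_rVS.
rewrite (_ : _ \o _ = fst)//.
by apply/funext => t; exact: cons_rV0.
Qed.

Lemma measurable_uncons_rV n : measurable_fun setT (@uncons_rV n).
Proof.
apply: measurable_fun_pair; first exact: (@measurable_rV_coord R n.+1 ord0).
apply: measurable_fun_rV => i.
rewrite (_ : _ \o _ = @rV_coord R n.+1 (lift ord0 i)).
  exact: measurable_rV_coord.
by apply/funext => x; rewrite /rV_coord /= mxE.
Qed.

(* The product of the Lebesgue measure on R and of m, carried to R^(n+1). *)
Section step.
Context n (m : {sigma_finite_measure set 'rV[R]_n -> \bar R}).

Definition lebesgue_cons : set 'rV[R]_n.+1 -> \bar R :=
  pushforward (lebesgue_measure \x m)%E (@cons_rV n).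

Let pushm : {measure set 'rV[R]_n.+1 -> \bar R} :=
  measure_function_pushforward__canonical__measure_function_Measure
    [the {measure set _ -> \bar R} of (lebesgue_measure \x m)%E]
    (@measurable_cons_rV n).

HB.instance Definition _ := isMeasure.Build _ _ _ lebesgue_cons
  (@measure0 _ _ _ pushm) (@measure_ge0 _ _ _ pushm)
  (@measure_semi_sigma_additive _ _ _ pushm).

Let lebesgue_cons_sigma_finite : sigma_finite setT lebesgue_cons.
Proof.
(* The library instance is shadowed by the one for products of subprobabilities. *)
have [F FT Foo] : sigma_finite setT (lebesgue_measure \x m)%E.
  have /sigma_finiteP[F [TF ndF Foo]] := sigma_finiteT (@lebesgue_measure R).
  have /sigma_finiteP[G [TG ndG Goo]] := sigma_finiteT m.
  exists (fun k => F k `*` G k).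
    rewrite -setXTT TF TG predeqE => -[x y]; split.
      move=> [/= [i _ Fix] [k _ Gky]]; exists (maxn i k) => //; split.
      - by move: x Fix; exact/subsetPset/ndF/leq_maxl.
      - by move: y Gky; exact/subsetPset/ndG/leq_maxr.
    by move=> [i _ []/= ? ?]; split; exists i.
  move=> k; have [? ?] := Foo k; have [? ?] := Goo k.
  split; first exact: measurableX.
  by rewrite product_measure1E// lte_mul_pinfty// ge0_fin_numE.
exists (fun k => @uncons_rV n @^-1` F k).
  by rewrite -preimage_bigcup -FT preimage_setT.
move=> k; have [mF Fk] := Foo k; split.
  by rewrite -[X in measurable X]setTI; exact: measurable_uncons_rV.
rewrite /lebesgue_cons /pushforward -comp_preimage.
rewrite (_ : _ \o _ = id) ?preimage_id//.
by apply/funext => t; exact: cons_rVK.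
Qed.

HB.instance Definition _ := Measure_isSigmaFinite.Build _ _ _
  lebesgue_cons lebesgue_cons_sigma_finite.
End step.

Fixpoint lebesgue_rV n : {sigma_finite_measure set 'rV[R]_n -> \bar R} :=
  match n with
  | 0 => \d_(0 : 'rV[R]_0)
  | n'.+1 => lebesgue_cons (lebesgue_rV n')
  end.

End lebesgue_rV.
Arguments lebesgue_rV {R} n.


Section complex_functions.
Context (R : realType) (n : nat).
Implicit Types (f g : 'rV[R]_n -> R[i]) (x y xi : 'rV[R]_n).

(* `|z| would have type R[i]; this is the modulus as an element of R. *)
Definition modulus (z : R[i]) : R := Normc.normc z.

Definition cexp_i (t : R) : R[i] := Complex (cos t) (sin t).

Definition dotp x y : R := \sum_(i < n) x ord0 i * y ord0 i.

(* The norm `|x| of the library on 'rV[R]_n is the sup norm. *)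
Definition enorm x : R := Num.sqrt (dotp x x).

Definition cmeasurable f : Prop :=
  measurable_fun [set: 'rV[R]_n] (fun x => complex.Re (f x)) /\
  measurable_fun [set: 'rV[R]_n] (fun x => complex.Im (f x)).

(* Meaningful for f in L^1 only: Rintegral is 0 when an integral diverges. *)
Definition cintegral f : R[i] :=
  Complex (Rintegral (lebesgue_rV n) setT (fun x => complex.Re (f x)))
          (Rintegral (lebesgue_rV n) setT (fun x => complex.Im (f x))).

Definition cLnorm (p : R) f : \bar R :=
  Lnorm (lebesgue_rV n) p%:E (fun x => (modulus (f x))%:E).

Definition inLp (p : R) f : Prop := cmeasurable f /\ (cLnorm p f < +oo)%E.

Definition partials (s : seq 'I_n) (u : 'rV[R]_n -> R) : 'rV[R]_n -> R :=
  foldr (fun i v => 'D_(delta_mx ord0 i) v) u s.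

Definition rschwartz (u : 'rV[R]_n -> R) : Prop :=
  forall s : seq 'I_n,
    (forall x, differentiable (partials s u) x) /\
    (forall k : nat, exists M : R,
        forall x, `|x| ^+ k * `|partials s u x| <= M).

Definition schwartz f : Prop :=
  rschwartz (fun x => complex.Re (f x)) /\
  rschwartz (fun x => complex.Im (f x)).

(* With this normalization - Delta has symbol |xi|^2. *)
Definition fourier f xi : R[i] :=
  cintegral (fun x => cexp_i (- dotp x xi) * f x).

Definition inv_fourier g x : R[i] :=
  real_complex R ((2 * pi) ^- n) *
  cintegral (fun xi => cexp_i (dotp x xi) * g xi).

(* (- Delta)^(s/2) on Schwartz functions: the multiplier |xi|^s. *)
Definition fraclap_schwartz (s : R) f : 'rV[R]_n -> R[i] :=
  inv_fourier (fun xi => real_complex R (enorm xi `^ s) * fourier f xi).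

(* "(- Delta)^(s/2) f = g" by duality. The symbol |xi|^s is even, so that the
   operator is its own transpose for the bilinear pairing. It maps Schwartz
   functions to bounded integrable ones (not to Schwartz ones, as |xi|^s is not
   smooth at 0), hence for f and g in Lebesgue spaces both integrals converge. *)
Definition is_fraclap (s : R) f g : Prop :=
  forall psi : 'rV[R]_n -> R[i], schwartz psi ->
    cintegral (fun x => f x * fraclap_schwartz s psi x) =
    cintegral (fun x => g x * psi x).

End complex_functions.

(* Main.v *)
Require Import Defs.
From HB Require Import structures.
From mathcomp Require Import all_boot all_order all_algebra.
From mathcomp Require Import all_classical all_reals all_analysis.
From mathcomp Require Import complex.
From mathcomp Require Import measurable_realfun ring lra zify.

Set Implicit Arguments.
Unset Strict Implicit.
Unset Printing Implicit Defensive.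

Import Order.TTheory GRing.Theory Num.Theory.
Import numFieldNormedType.Exports.

Local Open Scope classical_set_scope.
Local Open Scope ring_scope.

(** For a Gaussian mixture [psi] (heat kernels of times [s + t], [t <= 1], weighted by
    [t^(gamma/2 - 1)]), [(- Delta)^(gamma/2) psi] is a multiple of the heat kernel of time
    [s] minus a bounded integrable function. Testing the duality against [psi] centered at
    [x] bounds the heat regularizations of [phi] at [x], uniformly in [s], by a constant plus
    the convolution of [|g|] with the kernel [|z|^(gamma - N) e^(-|z|^2/16)]; as [s -> 0] the
    bound passes to [phi] almost everywhere. Young's inequality then bounds the moments of
    that convolution by [(C j)^j], so that the exponential series converges where [|phi|] is
    large, while [|phi|^p] controls the integrand where [|phi|] is bounded. *)

(** The duality only accepts Schwartz test functions, and the Riesz kernel is singular at 0 and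
    decays slowly. Cutting the times at 1 gives it Gaussian decay, and the shift by [s] makes it
    smooth. The price is a remainder whose multiplier is an upper incomplete Gamma function of
    |xi|^2; this is again the Laplace transform of a positive weight, supported on times above 1.
    The remainder is therefore another mixture of heat kernels, bounded and integrable uniformly in
    [s], and all Fourier analysis reduces to the transform of one Gaussian and to Fubini. The limit
    s -> 0 does not go through Lebesgue points: heat leaks out of a bounded Borel set by an amount
    that tends to 0, which a Dynkin argument derives from the case of open sets. The growth (C j)^j
    comes from the Young exponent q' j / (j + 1), which tends to the exponent q' at which the kernel
    stops being integrable: the integral of the corresponding power of the kernel is of order j.
    Since (C j)^j / j! is at most geometric, a small [alpha] makes the series converge. *)

Ltac compute_derive := apply: trigger_derive; rewrite /GRing.scale/=.

Lemma is_derive_continuous (R : realType) (f : R -> R) (x l : R) :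
  is_derive x 1 f l -> {for x, continuous f}.
Proof. by move=> [df _]; exact/differentiable_continuous/derivable1_diffP. Qed.

(** * Differentiation under the integral sign, Tonelli and Fubini *)

Section integral_tools.
Context d (T : measurableType d) (R : realType) (mu : {measure set T -> \bar R}).

Lemma integrable_le (f g : T -> R) : measurable_fun setT f ->
  (forall x, `|f x| <= g x) -> mu.-integrable setT (fun x => (g x)%:E) ->
  mu.-integrable setT (fun x => (f x)%:E).
Proof.
move=> mf fg; apply: le_integrable => //; first exact/measurable_EFinP.
by move=> x _; rewrite lee_fin (le_trans (fg x))// ler_norm.
Qed.

Lemma is_derive_under_integral (f f' : R -> T -> R) (G : T -> R) (a u v : R) :
  u < a < v ->
  (forall x, mu.-integrable setT (fun y => (f x y)%:E)) ->
  (forall x y, u < x < v -> is_derive x (1 : R) (f ^~ y) (f' x y)) ->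
  mu.-integrable setT (fun y => (G y)%:E) ->
  (forall x y, u < x < v -> `|f' x y| <= G y) ->
  is_derive a (1 : R) (fun x => \int[mu]_y f x y) (\int[mu]_y f' a y).
Proof.
move=> auv intf df intG G_ub.
have G0 y : 0 <= G y by rewrite (le_trans _ (G_ub a y auv)).
have pE x y : u < x < v -> partial1of2 f x y = f' x y.
  by move=> xuv; rewrite partial1of2E; have [] := df x y xuv.
have Ia : `]u, v[%classic a by rewrite /= in_itv.
have df1 x y : `]u, v[%classic x -> [set: T] y -> derivable (f ^~ y) x 1.
  by rewrite /= in_itv /= => xuv _; have [] := df x y xuv.
have Gub x y : `]u, v[%classic x -> [set: T] y -> `|partial1of2 f x y| <= G y.
  by rewrite /= in_itv /= => xuv _; rewrite pE// G_ub.
have := derivable_under_integral measurableT Ia (fun x _ => intf x) df1 G0 intG Gub.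
have := differentiation_under_integral measurableT Ia (fun x _ => intf x) df1 G0 intG Gub.
move=> dE dv; apply: DeriveDef => //; rewrite -derive1E dE.
by apply: eq_Rintegral => y _; rewrite pE.
Qed.

Lemma mul_ge0_integral (f : T -> \bar R) (k : R) : measurable_fun setT f ->
  (forall x, 0 <= f x)%E -> 0 <= k ->
  (k%:E * \int[mu]_x f x = \int[mu]_x (k%:E * f x))%E.
Proof. by move=> mf f0 k0; rewrite ge0_integralZl. Qed.

End integral_tools.

Lemma tonelli d1 d2 (T1 : measurableType d1) (T2 : measurableType d2) (R : realType)
    (m1 : {sigma_finite_measure set T1 -> \bar R})
    (m2 : {sigma_finite_measure set T2 -> \bar R}) (f : T1 -> T2 -> \bar R) :
  measurable_fun setT (fun z : T1 * T2 => f z.1 z.2) -> (forall x y, 0 <= f x y)%E ->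
  (\int[m1]_x \int[m2]_y f x y = \int[m2]_y \int[m1]_x f x y)%E.
Proof.
move=> mf f0.
exact: (@fubini_tonelli _ _ _ _ _ m1 m2 (fun z => f z.1 z.2) mf (fun z => f0 z.1 z.2)).
Qed.

(** Every section, not merely almost every one, is integrable: the real-valued inner integrals then
    agree pointwise with the extended ones, and no value is lost to [fine]. *)
Lemma fubini_swap d1 d2 (T1 : measurableType d1) (T2 : measurableType d2) (R : realType)
    (m1 : {sigma_finite_measure set T1 -> \bar R})
    (m2 : {sigma_finite_measure set T2 -> \bar R}) (f : T1 -> T2 -> R) :
  measurable_fun setT (fun z : T1 * T2 => f z.1 z.2) ->
  (\int[m1]_x \int[m2]_y `|f x y|%:E < +oo)%E ->
  (forall x, m2.-integrable setT (fun y => (f x y)%:E)) ->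
  (forall y, m1.-integrable setT (fun x => (f x y)%:E)) ->
  \int[m1]_x \int[m2]_y f x y = \int[m2]_y \int[m1]_x f x y.
Proof.
move=> mf intf i2 i1.
have mfE : measurable_fun setT (fun z : T1 * T2 => (f z.1 z.2)%:E) by exact/measurable_EFinP.
have int : (m1 \x m2)%E.-integrable setT (fun z : T1 * T2 => (f z.1 z.2)%:E).
  by apply/(integrable12ltyP _ _ mfE).
rewrite /Rintegral; have /(congr1 fine) /= := Fubini int.
under eq_integral => x _ do rewrite -(fineK (integrable_fin_num measurableT (i2 x))).
under [in RHS]eq_integral => y _ do rewrite -(fineK (integrable_fin_num measurableT (i1 y))).
by [].
Qed.

(** * Affine changes of variables on the line *)

Section line.
Context {R : realType}.
Local Notation mu := lebesgue_measure.
Local Notation lineR := (measurableTypeR R).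
Implicit Types (b c d e x t lam : R).

Lemma measurable_affine c d :
  measurable_fun [set: lineR] (fun x => c * x + d : lineR).
Proof. by apply: measurable_funD => //; exact: measurable_funM. Qed.

Definition scaled_pushforward c (c0 : 0 <= c) d : {measure set (lineR) -> \bar R} :=
  [the {measure set (lineR) -> \bar R} of
    mscale (NngNum c0)
      (measure_function_pushforward__canonical__measure_function_Measure
        [the {measure set (lineR) -> \bar R} of mu] (measurable_affine c d))].

(** Both measures agree on half-open intervals, so uniqueness of Lebesgue measure applies. Changes
    of variables for nonnegative functions follow from this. *)
Lemma lebesgue_measure_affine c (c0 : 0 <= c) d A : 0 < c -> measurable A ->
  mu A = scaled_pushforward c0 d A.
Proof.
move=> cp mA; apply: lebesgue_measure_unique => //= _ [[a b]] _ <-.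
rewrite /scaled_pushforward /= /mscale /= /pushforward.
rewrite (_ : _ @^-1` _ = `]((a - d) / c), ((b - d) / c)]%classic); last first.
  apply/seteqP; split => x /=; rewrite !in_itv/= ltr_pdivrMr// ler_pdivlMr//; nra.
rewrite !lebesgue_measure_itv/= !lte_fin ltr_pM2r ?invr_gt0//.
rewrite ltrD2r; case: ifPn => // ab; last by rewrite mule0.
rewrite -!EFinD -EFinM; congr EFin; field.
by rewrite gt_eqF.
Qed.

Lemma ge0_integral_affine c d (f : lineR -> \bar R) : 0 < c ->
  measurable_fun setT f -> (forall x, 0 <= f x)%E ->
  (\int[mu]_x f x = c%:E * \int[mu]_x f (c * x + d)%R)%E.
Proof.
move=> cp mf f0.
rewrite (@eq_measure_integral _ _ _ setT (scaled_pushforward (ltW cp) d) mu); last first.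
  by move=> A mA _; exact: lebesgue_measure_affine.
rewrite ge0_integral_mscale//=; congr (_ * _)%E.
by rewrite (@ge0_integral_pushforward _ _ _ _ _ _ (measurable_affine c d))//.
Qed.

Lemma ge0_integral_scale t (f : lineR -> R) (A B : set (lineR)) :
  0 < t -> measurable A -> measurable B -> (forall x, A (t * x) <-> B x) ->
  measurable_fun setT f -> (forall x, 0 <= f x) ->
  (\int[mu]_(x in A) (f x)%:E = \int[mu]_(x in B) (t * f (t * x)%R)%:E)%E.
Proof.
move=> t0 mA mB AB mf f0; rewrite [LHS]integral_mkcond; set g := _ \_ A.
have mg : measurable_fun setT g.
  by apply/(measurable_restrict _ mA measurableT); rewrite setTI; apply/measurable_EFinP; exact: measurable_funTS.
have g0 x : (0 <= g x)%E by rewrite /g patchE; case: ifPn => // _; rewrite lee_fin.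
rewrite [LHS](@ge0_integral_affine t 0 g t0 mg g0) mul_ge0_integral; [|exact: (measurableT_comp mg (measurable_affine t 0))|by []|exact: ltW].
rewrite [RHS]integral_mkcond; apply: eq_integral => x _; rewrite /g !patchE addr0.
have -> : (t * x \in A) = (x \in B) by apply/idP/idP; rewrite !inE => /AB.
by case: ifP; rewrite ?mule0.
Qed.

Lemma mulr_powRM t x e : 0 < t -> 0 <= x -> t * (t * x) `^ (e - 1) = t `^ e * x `^ (e - 1).
Proof.
move=> t0 x0; rewrite powRM ?(ltW t0)// mulrA -{1}(powRr1 (ltW t0)) -powRD ?subrKC//.
by rewrite (gt_eqF t0) implybT.
Qed.

(** * Gaussians on the line and their cosine transform *)

Definition gauss1 c b x : R := expR (- (c * (x - b) ^+ 2)).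

Lemma measurable_gauss1 c b : measurable_fun [set: R] (gauss1 c b).
Proof.
apply: measurableT_comp => //; apply: measurableT_comp => //.
apply: measurable_funM => //; apply: measurable_funX.
exact: measurable_funB.
Qed.

Lemma integral_gauss1 c b : 0 < c ->
  (\int[mu]_x (gauss1 c b x)%:E = (Num.sqrt (pi / c))%:E)%E.
Proof.
move=> c0; have sc0 : 0 < Num.sqrt c by rewrite sqrtr_gt0.
rewrite (@ge0_integral_affine (Num.sqrt c)^-1 b)//; first last.
- by move=> x; rewrite lee_fin expR_ge0.
- by apply/measurable_EFinP; exact: measurable_gauss1.
- by rewrite invr_gt0.
rewrite (eq_integral (fun x : lineR => (gauss_fun x)%:E)); last first.
  move=> x _; rewrite /gauss1 /gauss_fun addrK exprMn exprVn sqr_sqrtr ?ltW//.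
  by rewrite mulrA divff ?mul1r// gt_eqF.
by rewrite integralT_gauss -EFinM -sqrtrV ?(ltW c0)// -sqrtrM ?invr_ge0 ?ltW// mulrC.
Qed.

Lemma integrable_gauss1 c b : 0 < c ->
  mu.-integrable [set: lineR] (fun x => (gauss1 c b x)%:E).
Proof.
move=> c0; apply/integrableP; split; first by apply/measurable_EFinP; exact: measurable_gauss1.
under eq_integral do rewrite gee0_abs ?lee_fin ?expR_ge0//.
by rewrite integral_gauss1// ltry.
Qed.

(** Half of the Gaussian exponent absorbs the linear factor, through 1 + v <= e^v and |u| <= 1 +
    u^2. *)
Lemma normM_gauss1_le c b x : 0 < c ->
  `|x - b| * gauss1 c b x <= (1 + 2 / c) * gauss1 (c / 2) b x.
Proof.
move=> c0; rewrite /gauss1; set u := x - b.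
have -> : - (c * u ^+ 2) = - (c / 2 * u ^+ 2) - (c / 2 * u ^+ 2) by field.
rewrite expRD mulrA ler_pM2r ?expR_gt0// expRN ler_pdivrMr ?expR_gt0//.
apply: (@le_trans _ _ ((1 + 2 / c) * (1 + c / 2 * u ^+ 2))); last first.
  by rewrite ler_pM2l ?expR_ge1Dx// addr_gt0// divr_gt0.
have -> : (1 + 2 / c) * (1 + c / 2 * u ^+ 2) = 1 + 2 / c + (c / 2) * u ^+ 2 + u ^+ 2.
  by field; rewrite gt_eqF.
have : `|u| <= 1 + u ^+ 2 by rewrite -(real_normK (num_real u)); nra.
have : 0 <= 2 / c by rewrite divr_ge0// ltW.
have : 0 <= c / 2 * u ^+ 2 by rewrite mulr_ge0 ?sqr_ge0// divr_ge0// ltW.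
by lra.
Qed.

Lemma integrable_gauss1_dom c b (h : R -> R) : 0 < c ->
  measurable_fun [set: lineR] h ->
  (forall x, `|h x| <= (1 + `|x - b|) * gauss1 c b x) ->
  mu.-integrable [set: lineR] (fun x => (h x)%:E).
Proof.
move=> c0 mh hle.
apply: (@le_integrable _ _ _ _ _ _ _
  (fun x : lineR => (gauss1 c b x + (1 + 2 / c) * gauss1 (c / 2) b x)%:E)) => //.
- exact/measurable_EFinP.
- move=> x _; rewrite lee_fin (le_trans (hle x))// mulrDl mul1r.
  rewrite [leRHS]ger0_norm; last first.
    by rewrite addr_ge0 ?expR_ge0// mulr_ge0 ?expR_ge0// addr_ge0// divr_ge0// ltW.
  by rewrite lerD2l normM_gauss1_le.
- under [X in _.-integrable _ X]eq_fun do rewrite EFinD EFinM.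
  apply: integrableD => //; first exact: integrable_gauss1.
  by apply: integrableZl => //; apply: integrable_gauss1; rewrite divr_gt0.
Qed.

(** The inequality (|x - b| - 1)^2 >= 0 linearizes the exponent, so that along the integers the
    Gaussian is dominated by a geometric sequence of ratio e^(-2 c). *)
Lemma gauss1_cvg0 c b (F : R -> R) : 0 < c -> (forall x, `|F x| <= gauss1 c b x) ->
  (F (n%:R) @[n --> \oo] --> (0 : R)) /\ (F (- n%:R) @[n --> \oo] --> (0 : R)).
Proof.
move=> c0 Fle.
have key (s : R) : `|s| = 1 -> F (s * n%:R) @[n --> \oo] --> (0 : R).
  move=> s1; apply/norm_cvg0P.
  apply: (@squeeze_cvgr _ _ _ _ (fun=> 0) (geometric (expR (c * (2 * `|b| + 1))) (expR (- (2 * c))))).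
  - apply: nearW => n /=; rewrite normr_ge0/= (le_trans (Fle _))// -expRM_natl -expRD ler_expR.
    have nE : n%:R = `|s * n%:R| :> R by rewrite normrM s1 mul1r normr_nat.
    rewrite [X in _ + X * _]nE; move: (s * _) => x.
    have : `|x| <= `|x - b| + `|b| by rewrite -{1}(subrK b x) ler_normD.
    have -> : (x - b) ^+ 2 = `|x - b| ^+ 2 by rewrite real_normK// num_real.
    move: `|x - b| => u; have : 0 <= (u - 1) ^+ 2 by exact: sqr_ge0.
    by move=> h1 h2; nra.
  - exact: cvg_cst.
  - apply: cvg_geometric; rewrite ger0_norm ?expR_ge0//.
    by rewrite -expR0 ltr_expR oppr_lt0 mulr_gt0.
split; first by have := key 1 (normr1 _); under eq_fun do rewrite mul1r.
by have := key (-1) (normrN1 _); under eq_fun do rewrite mulN1r.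
Qed.

(** The fundamental theorem of calculus on [-(n+1), n+1], never a degenerate interval, followed by
    dominated convergence. It serves as integration by parts without boundary terms. *)
Lemma Rintegral_derive0 c b (F f : R -> R) : 0 < c ->
  (forall x, is_derive x (1 : R) F (f x)) -> continuous f ->
  mu.-integrable [set: lineR] (fun x => (f x)%:E) ->
  (forall x, `|F x| <= gauss1 c b x) ->
  \int[mu]_x f x = 0.
Proof.
move=> c0 dF cf intf Fle; have [Fy FNy] := gauss1_cvg0 c0 Fle.
pose f_ n := fun x : lineR => ((f x)%:E * (\1_`[- n%:R, n%:R] x)%:E)%E.
have mf : measurable_fun [set: lineR] (fun x => (f x)%:E).
  by have /integrableP[] := intf.
have cF : continuous F.
  by move=> x; exact: is_derive_continuous (dF x).
have int_f_ n : (\int[mu]_x f_ n.+1 x = (F n.+1%:R - F (- n.+1%:R))%:E)%E.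
  rewrite EFinB -(@continuous_FTC2 _ f F); first last.
  - by move=> x _; rewrite derive1E; have [] := dF x.
  - split; first by move=> x _; have [] := dF x.
      exact: cvg_at_right_filter (cF _).
    exact: cvg_at_left_filter (cF _).
  - exact: continuous_subspaceT.
  - by rewrite (@lt_trans _ _ 0)// oppr_lt0.
  rewrite [RHS]integral_mkcond; apply: eq_integral => x _.
  by rewrite /f_ epatch_indic.
have [|||||_ _] := @dominated_convergence _ _ _ mu setT measurableT (fun n => f_ n.+1)
  (fun x => (f x)%:E) (fun x => (`|f x|)%:E).
- move=> n; apply: emeasurable_funM => //; apply/measurable_EFinP.
  exact: measurable_indic.
- exact: mf.
- apply/aeW => x _; apply: cvg_near_cst; near=> n; rewrite /f_ indicE mem_set ?mule1//=.
  rewrite in_itv/= -ler_norml.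
  have : (Num.bound `|x| <= n.+1)%N by rewrite leqW//; near: n; exact: nbhs_infty_ge.
  rewrite -(ler_nat R); apply: le_trans; apply/ltW/archi_boundP.
  by [].
- exact: integrable_abse intf.
- apply/aeW => x n _; rewrite /f_ abseM abse_EFin.
  rewrite -[leRHS]mule1; apply: lee_pmul => //.
  by rewrite indicE lee_fin; case: (_ \in _); rewrite ?normr1 ?normr0.
rewrite [X in X @ _ --> _](_ : _ = fun n : nat => (F n.+1%:R - F (- n.+1%:R))%:E); last first.
  by apply/funext => n; exact: int_f_.
move=> h; have h0 : ((F n.+1%:R - F (- n.+1%:R))%:E @[n --> \oo] --> (0 : R)%:E)%E.
  apply: cvg_EFin; first exact: nearW.
  rewrite -[X in _ --> X](subr0 0).
  apply: (cvgB (f := fun n => F n.+1%:R) (g := fun n => F (- n.+1%:R))).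
    by rewrite (cvg_shiftS (fun n => F n%:R)).
  by rewrite (cvg_shiftS (fun n => F (- n%:R))).
by rewrite /Rintegral (cvg_unique _ h h0).
Unshelve. all: by end_near. Qed.

Lemma is_derive_gauss1 c b x : is_derive x (1 : R) (gauss1 c b) (- (2 * c * (x - b)) * gauss1 c b x).
Proof.
rewrite /gauss1; have h : is_derive x (1 : R) (fun x => - (c * (x - b) ^+ 2)) (- (2 * c * (x - b))).
  by compute_derive; ring.
compute_derive; ring.
Qed.

Lemma is_derive_sin_affine xi b dl x :
  is_derive x (1 : R) (fun x => sin (xi * (x - b) + dl)) (xi * cos (xi * (x - b) + dl)).
Proof.
have h : is_derive x (1 : R) (fun x => xi * (x - b) + dl) xi.
  by compute_derive; ring.
by compute_derive; ring.
Qed.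

Lemma is_derive_cos_affine xi b dl x :
  is_derive x (1 : R) (fun x => cos (xi * (x - b) + dl)) (- xi * sin (xi * (x - b) + dl)).
Proof.
have h : is_derive x (1 : R) (fun x => xi * (x - b) + dl) xi.
  by compute_derive; ring.
by compute_derive; ring.
Qed.

Lemma is_derive_cos_freq u dl x :
  is_derive x (1 : R) (fun x => cos (x * u + dl)) (- u * sin (x * u + dl)).
Proof.
have h : is_derive x (1 : R) (fun x => x * u + dl) u.
  by compute_derive; ring.
by compute_derive; ring.
Qed.

Lemma normMsin_le u t : `|- u * sin t| <= 1 + `|u|.
Proof. by rewrite normrM normrN (le_trans (ler_piMr (normr_ge0 u) (sin_max t)))// lerDr. Qed.

(** The phase [dl] treats cosine and sine transforms at once, and absorbs the other coordinates in
    the induction on the dimension. *)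
Definition cosgauss c b dl (xi x : R) : R := cos (xi * (x - b) + dl) * gauss1 c b x.

Lemma integrable_cosgauss c b dl xi : 0 < c ->
  mu.-integrable [set: lineR] (fun x => (cosgauss c b dl xi x)%:E).
Proof.
move=> c0; apply: (@integrable_le _ _ _ _ _ (gauss1 c b : lineR -> R)); last exact: integrable_gauss1.
  apply: measurable_funM; last exact: measurable_gauss1.
  apply: measurableT_comp; first by apply: continuous_measurable_fun; exact: continuous_cos.
  by apply: measurable_funD => //; apply: measurable_funM => //; exact: measurable_funB.
move=> x; rewrite normrM (ger0_norm (expR_ge0 _)) ler_piMl ?expR_ge0// cos_max//.
Qed.

(** As a function of the frequency, the transform solves F' = - (xi / (2 c)) F, and its value at 0
    is a Gaussian integral. *)
Lemma Rintegral_cosgauss c b dl xi : 0 < c ->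
  \int[mu]_x cosgauss c b dl xi x
  = cos dl * Num.sqrt (pi / c) * expR (- (xi ^+ 2 / (4 * c))).
Proof.
move=> c0.
pose F xi := \int[mu]_x cosgauss c b dl xi x.
pose G xi := \int[mu]_x (- (x - b) * sin (xi * (x - b) + dl) * gauss1 c b x).
have dF y : is_derive y (1 : R) F (G y).
  apply: (@is_derive_under_integral _ _ _ mu _ (fun xi x => - (x - b) * sin (xi * (x - b) + dl) * gauss1 c b x)
     (fun x => (1 + `|x - b|) * gauss1 c b x) y (y - 1) (y + 1)).
  - by rewrite ltrBlDr ltrDl ltr01.
  - by move=> x; exact: integrable_cosgauss.
  - move=> x z _; rewrite /cosgauss; have h := is_derive_cos_freq (z - b) dl x.
    by compute_derive; ring.
  - apply: (@integrable_gauss1_dom c b) => //.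
      apply: measurable_funM; last exact: measurable_gauss1.
      by apply: measurable_funD => //; apply: measurableT_comp => //; exact: measurable_funB.
    by move=> x; rewrite ger0_norm// mulr_ge0 ?expR_ge0// addr_ge0.
  - move=> x z _; rewrite normrM (ger0_norm (expR_ge0 _)) ler_pM2r ?expR_gt0//.
    exact: normMsin_le.
(* Integration by parts: the derivative in x of sin(y (x - b) + dl) times the Gaussian has integral
   0, and it is a combination of the integrands of [F] and [G]. *)
have GE y : G y = - (y / (2 * c)) * F y.
  have iG : mu.-integrable [set: lineR]
      (fun x => (- (x - b) * sin (y * (x - b) + dl) * gauss1 c b x)%:E).
    apply: (@integrable_gauss1_dom c b) => //.
      apply: measurable_funM; last exact: measurable_gauss1.
      apply: measurable_funM; first by apply: measurableT_comp => //; exact: measurable_funB.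
      apply: measurableT_comp; first by apply: continuous_measurable_fun; exact: continuous_sin.
      by apply: measurable_funD => //; apply: measurable_funM => //; exact: measurable_funB.
    move=> x; rewrite normrM (ger0_norm (expR_ge0 _)) ler_pM2r ?expR_gt0//.
    exact: normMsin_le.
  have iF := integrable_cosgauss b dl y c0.
  have : \int[mu]_x (y * cosgauss c b dl y x +
      2 * c * (- (x - b) * sin (y * (x - b) + dl) * gauss1 c b x)) = 0.
    apply: (@Rintegral_derive0 c b (fun x => sin (y * (x - b) + dl) * gauss1 c b x)) => //.
    + move=> x; have h1 := is_derive_sin_affine y b dl x; have h2 := is_derive_gauss1 c b x.
      by compute_derive; rewrite /cosgauss; ring.
    + move=> x; apply/differentiable_continuous/derivable1_diffP.
      have h1 := is_derive_sin_affine y b dl x; have h2 := is_derive_gauss1 c b x.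
      have h3 := is_derive_cos_affine y b dl x.
      by rewrite /cosgauss; apply: ex_derive.
    + under eq_fun do rewrite EFinD !(EFinM _ (cosgauss _ _ _ _ _)) (EFinM (2 * c)).
      by apply: integrableD => //; apply: integrableZl.
    + move=> x; rewrite normrM (ger0_norm (expR_ge0 _)) ler_piMl ?expR_ge0//.
      exact: sin_max.
  rewrite RintegralD//; last 2 first.
  - exact: (integrableZl measurableT y iF).
  - exact: (integrableZl measurableT (2 * c) iG).
  rewrite !RintegralZl// -/(F y) -/(G y) => /eqP.
  rewrite addrC addr_eq0 => /eqP GF.
  have c20 : 2 * c != 0 by rewrite mulf_neq0// gt_eqF.
  by apply: (mulfI c20); rewrite GF; field; rewrite gt_eqF.
have F0 : F 0 = cos dl * Num.sqrt (pi / c).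
  rewrite /F /cosgauss; under eq_Rintegral do rewrite mul0r add0r.
  rewrite RintegralZl//; last exact: integrable_gauss1.
  by rewrite /Rintegral integral_gauss1.
(* Integrating factor of the differential equation. *)
have cst x y : F x * expR (x ^+ 2 / (4 * c)) = F y * expR (y ^+ 2 / (4 * c)).
  apply: (@is_derive_0_is_cst _ (fun x => F x * expR (x ^+ 2 / (4 * c)))) => z.
  have h : is_derive z (1 : R) (fun x => expR (x ^+ 2 / (4 * c))) (z / (2 * c) * expR (z ^+ 2 / (4 * c))).
    have h1 : is_derive z (1 : R) (fun x => x ^+ 2 / (4 * c)) (z / (2 * c)).
      by compute_derive; field; rewrite gt_eqF.
    by compute_derive; ring.
  have dFz := dF z.
  by compute_derive; rewrite GE; field; rewrite gt_eqF.
have := cst xi 0; rewrite expr0n/= mul0r expR0 mulr1 F0 => <-.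
by rewrite -mulrA -expRD addrN expR0 mulr1.
Qed.

(** * Integrals of powers near 0 and near infinity *)

Lemma cvg_powRN e : 0 < e -> x `^ (- e) @[x --> +oo] --> (0 : R).
Proof.
move=> e0; apply/cvgrPdist_le => /= eps eps0; near=> x.
have x1 : 1 <= x by near: x; apply: nbhs_pinfty_ge.
rewrite sub0r normrN ger0_norm ?powR_ge0//.
have : eps^-1 `^ e^-1 <= x by near: x; apply: nbhs_pinfty_ge.
move=> h; rewrite powRN -(invrK eps) lef_pV2 ?posrE ?invr_gt0 ?powR_gt0// ?(lt_le_trans ltr01)//.
rewrite (@le_trans _ _ ((eps^-1 `^ e^-1) `^ e))//.
  by rewrite -powRrM mulVf ?gt_eqF// powRr1// invr_ge0 ltW.
by rewrite ge0_ler_powR// ?nnegrE ?powR_ge0 ?ltW// (lt_le_trans ltr01).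
Unshelve. all: by end_near. Qed.

Lemma integral_powR1y e : 0 < e ->
  (\int[mu]_(x in `]1%R, +oo[) (x `^ (- e - 1))%:E = (e^-1)%:E)%E.
Proof.
move=> e0.
have d x : 0 < x -> is_derive x (1 : R) (fun x => - e^-1 * x `^ (- e)) (x `^ (- e - 1)).
  move=> x0.
  have h := is_derive1_powR (- e) x0.
  compute_derive; field.
  by rewrite gt_eqF.
rewrite integral_itv_obnd_cbnd; last first.
  apply/measurable_EFinP; apply: measurable_funTS; exact: measurable_powR.
rewrite (@ge0_continuous_FTC2y _ _ (fun x => - e^-1 * x `^ (- e)) 1 0).
- by rewrite powR1 mulr1 sub0e -EFinN opprK.
- by move=> x _; rewrite powR_ge0.
- apply: continuous_in_subspaceT => x; rewrite inE/= in_itv/= andbT => x1.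
  exact: is_derive_continuous (is_derive1_powR (- e - 1) (lt_le_trans ltr01 x1)).
- by rewrite -[X in _ --> X](mulr0 (- e^-1)); apply: cvgMr; exact: cvg_powRN.
- by move=> x x1; have [] := d x (lt_trans ltr01 x1).
- exact: cvg_at_right_filter (is_derive_continuous (d _ ltr01)).
- move=> x; rewrite in_itv/= andbT => x1; rewrite derive1E.
  by have [_ ->] := d x (lt_trans ltr01 x1).
Qed.

(** The interval is exhausted by [1/(n+2), 1], away from the singularity, where the antiderivative
    x^e / e bounds all the integrals by 1/e. *)
Lemma integral_powR01 e : 0 < e -> (\int[mu]_(x in `]0%R, 1%R]) (x `^ (e - 1))%:E < +oo)%E.
Proof.
move=> e0; pose F n : set lineR := `[n.+2%:R^-1, 1%R]%classic.
have d x : 0 < x -> is_derive x (1 : R) (fun x => e^-1 * x `^ e) (x `^ (e - 1)).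
  move=> x0; have h := is_derive1_powR e x0.
  by compute_derive; field; rewrite gt_eqF.
have I_ n : (\int[mu]_(t in F n) (t `^ (e - 1))%:E <= (e^-1)%:E)%E.
  have n1 : n.+2%:R^-1 < 1 :> R by rewrite invf_lt1// ltr1n.
  have n0 : 0 < n.+2%:R^-1 :> R by rewrite invr_gt0.
  rewrite (@continuous_FTC2 _ _ (fun x => e^-1 * x `^ e))//.
  - by rewrite powR1 mulr1 -EFinB lee_fin gerBl mulr_ge0 ?invr_ge0 ?powR_ge0// ltW.
  - apply: continuous_in_subspaceT => x; rewrite inE/= in_itv/= => /andP[x1 _].
    exact: is_derive_continuous (is_derive1_powR (e - 1) (lt_le_trans n0 x1)).
  - split.
    + by move=> x; rewrite in_itv/= => /andP[x1 _]; have [] := d x (lt_trans n0 x1).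
    + exact: cvg_at_right_filter (is_derive_continuous (d _ n0)).
    + exact: cvg_at_left_filter (is_derive_continuous (d _ ltr01)).
  - move=> x; rewrite in_itv/= => /andP[x1 _]; rewrite derive1E.
    by have [_ ->] := d x (lt_trans n0 x1).
have -> : `]0%R, 1%R]%classic = \bigcup_n F n.
  apply/seteqP; split=> [x|x [n _]]; rewrite /F/= !in_itv/= => /andP[x0 x1]; last first.
    by rewrite x1 (lt_le_trans _ x0)// invr_gt0.
  exists (Num.bound x^-1) => //=; rewrite in_itv/= x1 andbT invf_ple ?posrE//.
  rewrite (le_trans (ltW (archi_boundP _)))// ?invr_ge0 1?ltW// ltr_nat.
  by rewrite ltnS leqnSn.
apply: (@le_lt_trans _ _ (e^-1)%:E); last exact: ltry.
have ndF : nondecreasing_seq F.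
  move=> n m nm; rewrite subsetEset => x; rewrite /F/= !in_itv/= => /andP[h ->].
  by rewrite (le_trans _ h)// lef_pV2 ?posrE// ler_nat.
have mF n : measurable (F n) by exact: measurable_itv.
have f0 n (x : lineR) : F n x -> (0 <= (x `^ (e - 1))%:E)%E by rewrite lee_fin powR_ge0.
have mf n : measurable_fun (F n) (fun x : lineR => (x `^ (e - 1))%:E).
  by apply/measurable_EFinP; apply: measurable_funTS; exact: measurable_powR.
have := ge0_nondecreasing_set_cvg_integral ndF mF mf f0 (mu := mu).
move/cvg_lim => <-//; apply: lime_le; last exact: nearW.
apply: ereal_nondecreasing_is_cvgn.
exact: ge0_nondecreasing_set_nondecreasing_integral.
Qed.

(** * The Gamma function and the two complementary weights in the time variable *)

Definition gamma_fun e (t : R) : R := \1_(`]0%R, +oo[) t * (t `^ (e - 1) * expR (- t)).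

(** Euler's Gamma function, with a finite integral for 0 < e <= 1, the only range in which it is
    used. *)
Definition Gam e : R := fine (\int[mu]_t (gamma_fun e t)%:E)%E.

Definition low_weight e (t : R) : R := \1_(`]0%R, 1%R]) t * t `^ (e - 1).

(** The weight whose Laplace transform is the upper incomplete Gamma function, up to the factor
    Gamma(1 - e). In the integral of m^(e-1) e^(-m) over m > lam, write m^(e-1) as 1/Gamma(1 - e)
    times the integral of u^(-e) e^(-m u) over u > 0, put t = 1 + u, and integrate in m first: this
    leaves (t - 1)^(-e) t^(-1) e^(-t lam). *)
Definition high_weight e (t : R) : R := \1_(`]1%R, +oo[) t * ((t - 1) `^ (- e) * t `^ (- 1)).

Lemma measurable_gamma_fun e : measurable_fun [set: lineR] (gamma_fun e).
Proof.
apply: measurable_funM; first exact: measurable_indic.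
apply: measurable_funM; first exact: measurable_powR.
by apply: measurableT_comp => //; exact: measurable_funN.
Qed.

Lemma measurable_low_weight e : measurable_fun [set: lineR] (low_weight e).
Proof.
apply: measurable_funM; first exact: measurable_indic.
exact: measurable_powR.
Qed.

Lemma measurable_high_weight e : measurable_fun [set: lineR] (high_weight e).
Proof.
apply: measurable_funM; first exact: measurable_indic.
apply: measurable_funM.
  apply: (measurableT_comp (measurable_powR (- e))); exact: measurable_funB.
exact: measurable_powR.
Qed.

Lemma gamma_fun_ge0 e t : 0 <= gamma_fun e t.
Proof. by rewrite !mulr_ge0// ?powR_ge0 ?expR_ge0. Qed.

Lemma low_weight_ge0 e t : 0 <= low_weight e t.
Proof. by rewrite mulr_ge0// powR_ge0. Qed.

Lemma high_weight_ge0 e t : 0 <= high_weight e t.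
Proof. by rewrite !mulr_ge0// powR_ge0. Qed.

Lemma integrable_low_weight e : 0 < e ->
  mu.-integrable [set: lineR] (fun t => (low_weight e t)%:E).
Proof.
move=> e0; apply/integrableP; split.
  by apply/measurable_EFinP; exact: measurable_low_weight.
apply: le_lt_trans (integral_powR01 e0).
rewrite [leRHS]integral_mkcond le_eqVlt; apply/orP; left; apply/eqP.
apply: eq_integral => t _; rewrite gee0_abs ?lee_fin ?low_weight_ge0//.
by rewrite epatch_indic/= muleC -EFinM.
Qed.

Lemma Gam_lty e : 0 < e -> e <= 1 -> (\int[mu]_t (gamma_fun e t)%:E < +oo)%E.
Proof.
move=> e0 e1.
(* The majorant is t^(e-1) on ]0, 1] and 4 / t^2 beyond 1: there t^(e-1) <= 1 because e <= 1, and
   e^(t/2) >= t/2 gives e^(-t) <= 4 / t^2. *)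
pose h (t : lineR) := ((low_weight e t)%:E + 4%:E * ((\1_`]1%R, +oo[ t)%:E * (t `^ (- 1 - 1))%:E))%E.
have mind : measurable_fun [set: lineR] (fun t => ((\1_`]1%R, +oo[ t)%:E * (t `^ (- 1 - 1))%:E)%E).
  apply: emeasurable_funM; apply/measurable_EFinP; first exact: measurable_indic.
  exact: measurable_powR.
have ml : measurable_fun [set: lineR] (fun t => (low_weight e t)%:E).
  by apply/measurable_EFinP; exact: measurable_low_weight.
apply: (@le_lt_trans _ _ (\int[mu]_t h t)%E).
  apply: ge0_le_integral => //.
  - by move=> t _; rewrite lee_fin gamma_fun_ge0.
  - by apply/measurable_EFinP; exact: measurable_gamma_fun.
  - by apply: emeasurable_funD => //; exact: measurable_funeM.
  move=> t _; rewrite /h -!EFinM -EFinD lee_fin /gamma_fun /low_weight !indicE !mem_setE !in_itv/= !andbT.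
  have [t0/=|t0/=] := ltP 0 t; last first.
    rewrite !mul0r add0r mulr_ge0// mulr_ge0 ?powR_ge0//.
  have [t1/=|t1/=] := leP t 1.
    rewrite !mul1r -[leLHS]addr0 lerD ?mulr_ge0 ?powR_ge0//.
    by rewrite ler_piMr ?powR_ge0// -expR0 ler_expR oppr_le0 ltW.
  rewrite !mul1r mul0r add0r.
  apply: (@le_trans _ _ (1 * expR (- t))).
    rewrite ler_wpM2r ?expR_ge0// -[leRHS](powRr0 t) ler_powR ?(ltW t1)// subr_le0//.
  rewrite mul1r (_ : -1 - 1 = - 2%:R :> R); last by rewrite opprD.
  rewrite powRN powR_mulrn ?(ltW t0)// expRN.
  rewrite ler_pdivlMr ?exprn_gt0// mulrC ler_pdivrMr ?expR_gt0//.
  have -> : t = t / 2 + t / 2 by field.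
  rewrite expRD -expr2.
  have h1 := expR_ge1Dx (t / 2).
  have : 0 <= expR (t / 2) by exact: expR_ge0.
  by nra.
rewrite ge0_integralD//; last 3 first.
- by move=> t _; rewrite lee_fin low_weight_ge0.
- by move=> t _; rewrite mule_ge0// mule_ge0// lee_fin powR_ge0.
- exact: measurable_funeM.
rewrite ge0_integralZl//; last by move=> t _; rewrite mule_ge0// lee_fin powR_ge0.
apply: lte_add_pinfty.
  by have /(integrable_lty measurableT) := integrable_low_weight e0.
rewrite (_ : (\int[mu]_t _)%E = \int[mu]_(t in `]1%R, +oo[) (t `^ (- 1 - 1))%:E)%E; last first.
  by rewrite [RHS]integral_mkcond; apply: eq_integral => x _; rewrite epatch_indic/= muleC.
by rewrite integral_powR1y// -EFinM ltry.
Qed.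

Lemma GamE e : 0 < e -> e <= 1 -> (\int[mu]_t (gamma_fun e t)%:E = (Gam e)%:E)%E.
Proof.
move=> e0 e1; rewrite fineK// ge0_fin_numE ?Gam_lty//.
by apply: integral_ge0 => t _; rewrite lee_fin gamma_fun_ge0.
Qed.

Lemma Gam_gt0 e : 0 < e -> e <= 1 -> 0 < Gam e.
Proof.
move=> e0 e1; rewrite -lte_fin -GamE//.
apply: (@lt_le_trans _ _ (\int[mu]_(t in `[1%R, 2%R]) (2 `^ (e - 1) * expR (- 2))%:E)%E).
  rewrite integral_cst//= lebesgue_measure_itv/= lte_fin ltr1n -EFinB -EFinM lte_fin.
  by rewrite mulr_gt0 ?mulr_gt0 ?powR_gt0 ?expR_gt0// subr_gt0 ltr1n.
apply: (@le_trans _ _ (\int[mu]_(t in `[1%R, 2%R]) (gamma_fun e t)%:E)%E).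
  apply: ge0_le_integral => //.
  - by apply/measurable_EFinP; apply: measurable_funTS; exact: measurable_gamma_fun.
  move=> t /=; rewrite in_itv/= => /andP[t1 t2].
  rewrite lee_fin /gamma_fun indicE mem_setE in_itv/= andbT (lt_le_trans ltr01 t1)/= mul1r.
  rewrite ler_pM ?powR_ge0 ?expR_ge0//; last by rewrite ler_expR lerN2.
  rewrite -(opprB 1 e) !powRN lef_pV2 ?posrE ?powR_gt0 ?(lt_le_trans ltr01 t1)//.
  apply: ge0_ler_powR; rewrite ?nnegrE ?subr_ge0//; exact: le_trans ler01 t1.
apply: ge0_subset_integral => //; last by move=> t _; rewrite lee_fin gamma_fun_ge0.
by apply/measurable_EFinP; exact: measurable_gamma_fun.
Qed.

(** Substituting t -> lam t turns the truncated power weight into the lower incomplete Gamma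
    function. *)
Lemma powR_low_weight e lam : 0 < e -> 0 < lam ->
  ((lam `^ e)%:E * \int[mu]_t (low_weight e t * expR (- (t * lam)))%:E
   = \int[mu]_(t in `]0%R, lam]) (gamma_fun e t)%:E)%E.
Proof.
move=> e0 l0; rewrite (@ge0_integral_scale lam (gamma_fun e) _ `]0%R, 1%R]%classic l0)//; first last.
- exact: gamma_fun_ge0.
- exact: measurable_gamma_fun.
- by move=> x /=; rewrite !in_itv/= pmulr_rgt0// -[X in _ <= X]mulr1 ler_pM2l.
rewrite mul_ge0_integral; first last.
- exact: powR_ge0.
- by move=> t; rewrite lee_fin mulr_ge0 ?low_weight_ge0 ?expR_ge0.
- apply/measurable_EFinP; apply: measurable_funM; first exact: measurable_low_weight.
  by apply: measurableT_comp => //; apply: measurable_funN; exact: measurable_funM.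
rewrite [RHS]integral_mkcond; apply: eq_integral => t _.
rewrite epatch_indic/= /low_weight /gamma_fun !indicE !mem_setE !in_itv/= andbT pmulr_rgt0//.
case: (ltP 0 t) => t0 /=; last by rewrite !mul0r mule0 mulr0 mul0e.
case: (leP t 1) => t1 /=; last by rewrite !mul0r !mule0.
by rewrite !mul1r mule1 -EFinM !mulrA mulr_powRM ?(ltW t0)// (mulrC t).
Qed.

Lemma integral_expRy t lam : 0 < t -> 
  (\int[mu]_(m in `]lam, +oo[) (expR (- (t * m)))%:E = (expR (- (t * lam)) * t `^ (-1))%:E)%E.
Proof.
move=> t0.
have d x : is_derive x (1 : R) (fun m => - t^-1 * expR (- (t * m))) (expR (- (t * x))).
  have h : is_derive x (1 : R) (fun m => - (t * m)) (- t).
    by compute_derive; ring.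
  by compute_derive; field; rewrite gt_eqF.
rewrite integral_itv_obnd_cbnd; last first.
  apply/measurable_EFinP; apply: measurable_funTS; apply: measurableT_comp => //.
  by apply: measurable_funN; exact: measurable_funM.
rewrite (@ge0_continuous_FTC2y _ _ (fun m => - t^-1 * expR (- (t * m))) lam 0).
- rewrite powR_inv1 ?ltW// sub0e -EFinN; congr EFin; ring.
- by move=> x _; rewrite expR_ge0.
- apply: continuous_subspaceT => x; apply: continuous_comp; last exact: continuous_expR.
  by apply: cvgN; apply: cvgMr; exact: cvg_id.
- rewrite -[X in _ --> X](mulr0 (- t^-1)); apply: cvgMr.
  apply: (cvg_comp (fun m => t * m) (fun x => expR (- x))); last exact: cvgr_expR.
  exact: gt0_cvgMry.
- by move=> x _; have [] := d x.
- exact: cvg_at_right_filter (is_derive_continuous (d _)).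
- by move=> x _; rewrite derive1E; have [_ ->] := d x.
Qed.

Lemma measurable_expRNM t :
  measurable_fun [set: lineR] (fun x => expR (- (t * x))).
Proof. by apply: measurableT_comp => //; apply: measurable_funN; exact: measurable_funM. Qed.

(** The substitution t = 1 + u / lam produces Gamma(1 - e) and leaves the factor lam^(e-1)
    e^(-lam). *)
Lemma integral_shift_gamma e lam : 0 < e -> e < 1 -> 0 < lam ->
  (\int[mu]_t (\1_(`]1%R, +oo[) t * ((t - 1) `^ (- e) * expR (- (t * lam))))%:E
   = (Gam (1 - e))%:E * (gamma_fun e lam)%:E)%E.
Proof.
move=> e0 e1 l0; have li : 0 < lam^-1 by rewrite invr_gt0.
rewrite (@ge0_integral_affine lam^-1 1)//; first last.
- by move=> t; rewrite lee_fin !mulr_ge0 ?powR_ge0 ?expR_ge0.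
- apply/measurable_EFinP; apply: measurable_funM; first exact: measurable_indic.
  apply: measurable_funM.
    by apply: (measurableT_comp (measurable_powR (- e))); exact: measurable_funB.
  by apply: measurableT_comp => //; apply: measurable_funN; exact: measurable_funM.
rewrite -GamE ?subr_gt0//; last by rewrite gerBl ltW.
rewrite -ge0_integralZl//; first last.
- by rewrite lee_fin ltW.
- by move=> t _; rewrite lee_fin !mulr_ge0 ?powR_ge0 ?expR_ge0.
- apply/measurable_EFinP; apply: (measurableT_comp (f := fun t : lineR => \1_`]1, +oo[ t * ((t - 1) `^ (- e) * expR (- (t * lam))))).
    apply: measurable_funM; first exact: measurable_indic.
    apply: measurable_funM.
      by apply: (measurableT_comp (measurable_powR (- e))); exact: measurable_funB.
    by apply: measurableT_comp => //; apply: measurable_funN; exact: measurable_funM.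
  exact: measurable_affine.
rewrite -ge0_integralZr; first last.
- by rewrite lee_fin gamma_fun_ge0.
- by move=> t _; rewrite lee_fin gamma_fun_ge0.
- by apply/measurable_EFinP; exact: measurable_gamma_fun.
- exact: measurableT.
apply: eq_integral => t _; rewrite addrK /gamma_fun !indicE !mem_setE !in_itv/= !andbT.
rewrite l0 ltrDr pmulr_rgt0// mul1r.
case: (ltP 0 t) => t0/=; last by rewrite !mul0r mule0 mul0e.
rewrite !mul1r -!EFinM; congr EFin.
rewrite powRM ?(ltW t0) ?(ltW li)// addrAC subrr sub0r.
have -> : (lam^-1 * t + 1) * lam = t + lam by rewrite mulrDl mul1r mulrAC mulVf ?gt_eqF ?mul1r.
rewrite opprD expRD.
have -> : lam^-1 `^ (- e) = lam * lam `^ (e - 1).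
  rewrite -(powR_inv1 (ltW l0)) -powRrM mulN1r opprK.
  by rewrite -{2}(powRr1 (ltW l0)) -powRD ?subrK 1?addrC ?subrK// (gt_eqF l0) implybT.
move: (_ `^ _) (t `^ _) (expR _) (expR _) => A B C D.
by rewrite -!mulrA mulKf ?gt_eqF// (mulrCA A B) (mulrCA A D).
Qed.

(** The factor e^(-t lam) / t is the integral of e^(-t m) over m > lam; after Tonelli the inner
    integral in t is [integral_shift_gamma]. *)
Lemma integral_high_weight e lam : 0 < e -> e < 1 -> 0 <= lam ->
  (\int[mu]_t (high_weight e t * expR (- (t * lam)))%:E
   = (Gam (1 - e))%:E * \int[mu]_(m in `]lam, +oo[) (gamma_fun e m)%:E)%E.
Proof.
move=> e0 e1 l0.
pose k (z : lineR * lineR) : \bar R :=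
  (\1_(`]1%R, +oo[) z.1 * ((z.1 - 1) `^ (- e) * (\1_(`]lam, +oo[) z.2 * expR (- (z.1 * z.2)))))%:E.
have mk : measurable_fun setT k.
  apply/measurable_EFinP; apply: measurable_funM.
    by apply: (measurableT_comp (f := \1_`]1%R, +oo[ : lineR -> R)) => //; exact: measurable_indic.
  apply: measurable_funM.
    apply: (measurableT_comp (measurable_powR (- e))).
    by apply: measurable_funB => //; exact: measurable_fst.
  apply: measurable_funM.
    apply: (measurableT_comp (f := \1_`]lam, +oo[ : lineR -> R)); first exact: measurable_indic.
    exact: measurable_snd.
  apply: measurableT_comp => //; apply: measurable_funN; apply: measurable_funM.
    exact: measurable_fst.
  exact: measurable_snd.
have k0 z : (0 <= k z)%E.
  by rewrite lee_fin !mulr_ge0 ?powR_ge0 ?expR_ge0.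
transitivity (\int[mu]_x \int[mu]_y k (x, y))%E.
  apply: eq_integral => t _; rewrite /k /=.
  transitivity ((\1_`]1%R, +oo[ t * (t - 1) `^ (- e))%:E * \int[mu]_(m in `]lam, +oo[) (expR (- (t * m)))%:E)%E.
    rewrite /high_weight indicE mem_setE in_itv/= andbT.
    case: (ltP 1 t) => t1/=; last by rewrite !mul0r mul0e.
    rewrite (integral_expRy _ (lt_trans ltr01 t1)) -EFinM !mul1r -!mulrA; congr EFin; congr (_ * _); exact: mulrC.
  rewrite [X in (_ * X)%E]integral_mkcond.
  rewrite mul_ge0_integral; first last.
  - by rewrite mulr_ge0 ?powR_ge0.
  - by move=> x; rewrite patchE; case: ifPn => // _; rewrite lee_fin expR_ge0.
  - apply/(measurable_restrict _ (measurable_itv _) measurableT).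
    rewrite setTI; apply/measurable_EFinP; apply: measurable_funTS.
    exact: measurable_expRNM.
  by apply: eq_integral => m _; rewrite epatch_indic/= -!EFinM -!mulrA; congr EFin; do 2 congr (_ * _); exact: mulrC.
rewrite tonelli; [|exact: mk|by move=> x y; exact: k0].
rewrite [X in (_ * X)%E]integral_mkcond.
rewrite mul_ge0_integral; first last.
- by rewrite ltW// Gam_gt0// ?subr_gt0// gerBl ltW.
- by move=> x; rewrite patchE; case: ifPn => // _; rewrite lee_fin gamma_fun_ge0.
- apply/(measurable_restrict _ (measurable_itv _) measurableT).
  by rewrite setTI; apply/measurable_EFinP; apply: measurable_funTS; exact: measurable_gamma_fun.
apply: eq_integral => m _; rewrite epatch_indic/= /k/=.
have iE : \1_(`]lam, +oo[) m = (lam < m)%R%:R :> R by rewrite indicE mem_setE in_itv/= andbT.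
rewrite !iE.
case: (ltP lam m) => lm/=; last first.
  by rewrite mule0 mule0 integral0_eq// => x _; rewrite mul0r !mulr0.
rewrite mule1 -(integral_shift_gamma e0 e1 (le_lt_trans l0 lm)).
by apply: eq_integral => t _; rewrite mul1r.
Qed.

(* The Laplace transform of the truncated power weight differs from that of the full
   one by a completely monotone remainder. *)
Lemma weights_identity e lam : 0 < e -> e < 1 -> 0 <= lam ->
  ((lam `^ e)%:E * \int[mu]_t (low_weight e t * expR (- (t * lam)))%:E
   + ((Gam (1 - e))^-1)%:E * \int[mu]_t (high_weight e t * expR (- (t * lam)))%:E
   = (Gam e)%:E)%E.
Proof.
move=> e0 e1 l0; have G0 : 0 < Gam (1 - e) by rewrite Gam_gt0 ?subr_gt0// gerBl ltW.
rewrite integral_high_weight// muleA -EFinM mulVf ?gt_eqF// mul1e -GamE//; last exact: ltW.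
have [->|ln0] := eqVneq lam 0.
  rewrite powR0 ?gt_eqF// mul0e add0e [LHS]integral_mkcond.
  apply: eq_integral => t _; rewrite epatch_indic/= /gamma_fun !indicE.
  by case: (_ \in _); rewrite ?mul0r ?mul0e// mule1.
have lp : 0 < lam by rewrite lt_neqAle eq_sym ln0.
rewrite powR_low_weight//.
have mg : measurable_fun [set: lineR] (fun x => (gamma_fun e x)%:E).
  by apply/measurable_EFinP; exact: measurable_gamma_fun.
rewrite -ge0_integral_setU//.
- rewrite [LHS]integral_mkcond; apply: eq_integral => t _.
  rewrite epatch_indic/= /gamma_fun !indicE in_setU !mem_setE !in_itv/= !andbT.
  case: (ltP 0 t) => t0/=; last by rewrite !mul0r mul0e.
  by case: (leP t lam) => _/=; rewrite mule1.
- exact: measurable_funTS.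
- by move=> t _; rewrite lee_fin gamma_fun_ge0.
- apply/disj_setPS => t [/=]; rewrite !in_itv/= andbT => /andP[_ h1] h2.
  by move: (lt_le_trans h2 h1); rewrite ltxx.
Qed.

(** Finiteness is read off [weights_identity] at lam = 0, whose right-hand side is finite. *)
Lemma integrable_high_weight e : 0 < e -> e < 1 ->
  mu.-integrable [set: lineR] (fun t => (high_weight e t)%:E).
Proof.
move=> e0 e1; apply/integrableP; split.
  by apply/measurable_EFinP; exact: measurable_high_weight.
under eq_integral do rewrite gee0_abs ?lee_fin ?high_weight_ge0//.
have G0 : 0 < Gam (1 - e) by rewrite Gam_gt0 ?subr_gt0// gerBl ltW.
have := weights_identity e0 e1 (lexx 0).
rewrite powR0 ?gt_eqF// mul0e add0e.
rewrite (_ : (\int[mu]_t (high_weight e t * _)%:E)%E = \int[mu]_t (high_weight e t)%:E)%E; last first.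
  by apply: eq_integral => t _; rewrite mulr0 oppr0 expR0 mulr1.
case: (\int[mu]_t _)%E => [r _||]; rewrite ?ltry// gt0_muley ?lte_fin ?invr_gt0//.
Qed.

Lemma integral_powR0c e t : 0 < t ->
  (\int[mu]_(x in `]0%R, t]) (x `^ (e - 1))%:E =
   (t `^ e)%:E * \int[mu]_x (low_weight e x)%:E)%E.
Proof.
move=> t0; rewrite (@ge0_integral_scale t (@powR R ^~ (e - 1)) _ `]0%R, 1%R]%classic t0)//; first last.
- by move=> x; exact: powR_ge0.
- by move=> x /=; rewrite !in_itv/= pmulr_rgt0// -[X in _ <= X]mulr1 ler_pM2l.
rewrite [RHS]mul_ge0_integral ?powR_ge0//; first last.
- by move=> x; rewrite lee_fin low_weight_ge0.
- by apply/measurable_EFinP; exact: measurable_low_weight.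
rewrite [LHS]integral_mkcond; apply: eq_integral => x _.
rewrite epatch_indic/= /low_weight !indicE !mem_setE !in_itv/=.
case: (ltP 0 x) => x0 /=; last by rewrite !mul0r !mule0.
case: (leP x 1) => x1 /=; last by rewrite !mul0r !mule0.
by rewrite !mul1r mule1 -EFinM mulr_powRM ?(ltW x0).
Qed.

Lemma integral_powRcy e t : 0 < e -> 0 < t ->
  (\int[mu]_(x in `]t, +oo[) (x `^ (- e - 1))%:E = (t `^ (- e) / e)%:E)%E.
Proof.
move=> e0 t0; rewrite (@ge0_integral_scale t (@powR R ^~ (- e - 1)) _ `]1%R, +oo[%classic t0)//; first last.
- by move=> x; exact: powR_ge0.
- by move=> x /=; rewrite !in_itv/= !andbT -[X in X < _]mulr1 ltr_pM2l.
rewrite EFinM -(integral_powR1y e0) -ge0_integralZl; first last.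
- by rewrite lee_fin powR_ge0.
- by move=> x _; rewrite lee_fin powR_ge0.
- by apply/measurable_EFinP; apply: measurable_funTS; exact: measurable_powR.
- exact: measurable_itv.
apply: eq_integral => x; rewrite inE/= in_itv/= andbT => x1.
by rewrite mulr_powRM// ltW// (lt_trans ltr01).
Qed.

End line.

(** * Measurability of partial integrals *)

Section measurable_sections.
Context d1 d2 (T1 : measurableType d1) (T2 : measurableType d2) (R : realType).

Lemma measurable_integral_l (m1 : {sigma_finite_measure set T1 -> \bar R}) (f : T1 -> T2 -> \bar R) :
  measurable_fun setT (fun z : T1 * T2 => f z.1 z.2) -> (forall x y, 0 <= f x y)%E ->
  measurable_fun setT (fun y => \int[m1]_x f x y)%E.
Proof.
move=> mf f0.
exact: (@measurable_fun_fubini_tonelli_G _ _ _ _ _ m1 (fun z => f z.1 z.2) mf (fun z => f0 z.1 z.2)).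
Qed.

Lemma measurable_integral_r (m2 : {sigma_finite_measure set T2 -> \bar R}) (f : T1 -> T2 -> \bar R) :
  measurable_fun setT (fun z : T1 * T2 => f z.1 z.2) -> (forall x y, 0 <= f x y)%E ->
  measurable_fun setT (fun x => \int[m2]_y f x y)%E.
Proof.
move=> mf f0.
exact: (@measurable_fun_fubini_tonelli_F _ _ _ _ _ m2 (fun z => f z.1 z.2) mf (fun z => f0 z.1 z.2)).
Qed.

End measurable_sections.

(** * Measurability and Euclidean geometry in coordinates *)

Section space.
Context {R : realType}.
Local Notation lineR := (measurableTypeR R).

Lemma measurable_inv : measurable_fun [set: lineR] (fun x : lineR => x^-1 : R).
Proof.
(* Writing 1/x as x times (x^2)^(-1) reduces to the real power of a nonnegative number; the
   convention 0^-1 = 0 is respected. *)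
rewrite (_ : (fun _ => _) = fun x : R => x * (x ^+ 2) `^ (- 1)); last first.
  apply/funext => x; rewrite powR_inv1 ?sqr_ge0// expr2 invfM.
  have [->|x0] := eqVneq x 0; first by rewrite invr0 mul0r.
  by rewrite mulrA divff// mul1r.
apply: measurable_funM => //; apply: (measurableT_comp (measurable_powR (- 1))).
exact: measurable_funX.
Qed.

Lemma measurable_sqrtr : measurable_fun [set: lineR] (@Num.sqrt R : lineR -> R).
Proof. by apply: continuous_measurable_fun; exact: sqrt_continuous. Qed.

Local Notation mu := lebesgue_measure.

Section vectors.
Context (n : nat).
Implicit Types x y z : 'rV[R]_n.

Lemma measurable_dotp (y : 'rV[R]_n) : measurable_fun [set: 'rV[R]_n] (fun x => dotp x y).
Proof.
apply: measurable_sum => i; apply: measurable_funM => //.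
exact: (@measurable_rV_coord R n i).
Qed.

Lemma measurable_rV_comb d (T : measurableType d) (f g : T -> 'rV[R]_n) (a b : R) :
  measurable_fun setT f -> measurable_fun setT g ->
  measurable_fun setT (fun t => a *: f t + b *: g t).
Proof.
move=> mf mg; apply: measurable_fun_rV => i.
rewrite (_ : _ \o _ = fun t => a * rV_coord i (f t) + b * rV_coord i (g t)); last first.
  by apply/funext => t; rewrite /rV_coord /= !mxE.
apply: measurable_funD; apply: measurable_funM => //.
  by apply: (measurableT_comp (@measurable_rV_coord R n i)).
by apply: (measurableT_comp (@measurable_rV_coord R n i)).
Qed.

Lemma measurable_rV_sub d (T : measurableType d) (f g : T -> 'rV[R]_n) :
  measurable_fun setT f -> measurable_fun setT g ->
  measurable_fun setT (fun t => f t - g t).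
Proof.
move=> mf mg; rewrite (_ : (fun _ => _) = fun t => 1 *: f t + (-1) *: g t).
  exact: measurable_rV_comb.
by apply/funext => t; rewrite scale1r scaleN1r.
Qed.

Definition sqn x : R := dotp x x.

Lemma sqn_ge0 x : 0 <= sqn x.
Proof. by apply: sumr_ge0 => i _; rewrite -expr2 sqr_ge0. Qed.

Lemma measurable_sqn : measurable_fun [set: 'rV[R]_n] sqn.
Proof.
apply: measurable_sum => i.
by apply: measurable_funM; exact: (@measurable_rV_coord R n i).
Qed.

Lemma sqnB x y : sqn (x - y) = sqn (y - x).
Proof. by rewrite -opprB /sqn /dotp; apply: eq_bigr => i _; rewrite !mxE mulrNN. Qed.

Lemma enorm_powR x (s : R) : 0 < s -> enorm x `^ s = sqn x `^ (s / 2).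
Proof.
move=> s0; rewrite /enorm -powR12_sqrt ?sqn_ge0// -powRrM; congr (_ `^ _).
by rewrite mulrC.
Qed.

End vectors.

(** * Splitting off the first coordinate *)

Lemma dotp_cons n (a b : R) (x y : 'rV[R]_n) :
  dotp (cons_rV (a : lineR, x)) (cons_rV (b : lineR, y)) = a * b + dotp x y.
Proof.
rewrite /dotp big_ord_recl !cons_rV0; congr (_ + _).
by apply: eq_bigr => i _; rewrite !cons_rVS.
Qed.

Lemma cons_uncons n (x : 'rV[R]_n.+1) : cons_rV (uncons_rV x) = x.
Proof.
apply/rowP => i; case: (unliftP ord0 i) => [j|] ->; last by rewrite cons_rV0.
by rewrite cons_rVS mxE.
Qed.

Lemma cons_rVB n (a b : R) (x y : 'rV[R]_n) :
  cons_rV (a : lineR, x) - cons_rV (b : lineR, y) =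
  cons_rV (a - b : lineR, x - y).
Proof.
apply/rowP => i; rewrite [LHS]mxE [X in _ + X]mxE.
case: (unliftP ord0 i) => [j|] ->; last by rewrite !cons_rV0.
by rewrite !cons_rVS !mxE.
Qed.

Lemma ge0_integral_rVS n (f : 'rV[R]_n.+1 -> \bar R) : measurable_fun setT f ->
  (forall x, 0 <= f x)%E ->
  (\int[lebesgue_rV n.+1]_x f x =
   \int[mu]_a \int[lebesgue_rV n]_y f (cons_rV (a, y)))%E.
Proof.
move=> mf f0.
rewrite /= /lebesgue_cons.
rewrite (ge0_integral_pushforward (@measurable_cons_rV R n))//= preimage_setT.
rewrite (@fubini_tonelli1 _ _ _ _ _ mu (lebesgue_rV n) (f \o @cons_rV R n))//.
- by apply: measurableT_comp => //; exact: measurable_cons_rV.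
- by move=> z; exact: f0.
Qed.

Lemma integrable_rVS n (f : 'rV[R]_n.+1 -> R) :
  (lebesgue_rV n.+1).-integrable setT (fun x => (f x)%:E) ->
  (mu \x lebesgue_rV n)%E.-integrable setT (fun z => (f (cons_rV z))%:E).
Proof.
move=> /integrableP[mf intf]; apply/integrableP; split.
  by apply: (measurableT_comp mf); exact: measurable_cons_rV.
move: intf; rewrite /= /lebesgue_cons.
rewrite (ge0_integral_pushforward (@measurable_cons_rV R n))//= ?preimage_setT//.
exact: (measurableT_comp (f := abse) _ mf).
Qed.

Lemma Rintegral_rVS n (f : 'rV[R]_n.+1 -> R) :
  (lebesgue_rV n.+1).-integrable setT (fun x => (f x)%:E) ->
  (forall a, (lebesgue_rV n).-integrable setT (fun y => (f (cons_rV (a, y)))%:E)) ->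
  \int[lebesgue_rV n.+1]_x f x = \int[mu]_a \int[lebesgue_rV n]_y f (cons_rV (a, y)).
Proof.
move=> intf inta; have int2 := integrable_rVS intf.
rewrite /Rintegral; congr fine.
transitivity (\int[mu \x lebesgue_rV n]_z (f (cons_rV z))%:E)%E.
  rewrite /= /lebesgue_cons (integral_pushforward (@measurable_cons_rV R n))//=.
  exact: measurable_int intf.
rewrite -integral12_prod_meas1//; apply: eq_integral => a _.
by rewrite /fubini_F fineK// integrable_fin_num.
Qed.

(** * Gaussians in n variables and their cosine transform *)

Definition gaussN n (c : R) (x y : 'rV[R]_n) : R := expR (- (c * sqn (y - x))).

Lemma gaussN_ge0 n c (x y : 'rV[R]_n) : 0 <= gaussN c x y. Proof. exact: expR_ge0. Qed.

Lemma gaussNC n c (x y : 'rV[R]_n) : gaussN c x y = gaussN c y x.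
Proof. by rewrite /gaussN sqnB. Qed.

Lemma measurable_gaussN_comp n d (T : measurableType d) (c : T -> R) (f g : T -> 'rV[R]_n) :
  measurable_fun setT c -> measurable_fun setT f -> measurable_fun setT g ->
  measurable_fun setT (fun t => gaussN (c t) (f t) (g t)).
Proof.
move=> mc mf mg; apply: measurableT_comp => //; apply: measurableT_comp => //.
apply: measurable_funM => //; apply: (measurableT_comp (@measurable_sqn n)).
exact: measurable_rV_sub.
Qed.

Lemma measurable_gaussN n c (x : 'rV[R]_n) : measurable_fun setT (gaussN c x).
Proof. exact: measurable_gaussN_comp. Qed.

Lemma emeasurable_gaussN n c (x : 'rV[R]_n) :
  measurable_fun setT (fun y => (gaussN c x y)%:E).
Proof. by apply/measurable_EFinP; exact: measurable_gaussN. Qed.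

Lemma gaussN_cons n c (a b : R) (x y : 'rV[R]_n) :
  gaussN c (cons_rV (a : lineR, x)) (cons_rV (b : lineR, y)) =
  gauss1 c a b * gaussN c x y.
Proof.
by rewrite /gaussN cons_rVB /sqn dotp_cons mulrDr opprD expRD -expr2.
Qed.

Lemma integral_rV0 (f : 'rV[R]_0 -> \bar R) :
  (\int[lebesgue_rV 0]_x f x = f (0%R : 'rV[R]_0))%E.
Proof.
rewrite (_ : f = cst (f 0)); last by apply/funext => x; congr f; apply/rowP => -[].
by rewrite integral_cst//= diracT mule1.
Qed.

Lemma integral_gaussN n c (x : 'rV[R]_n) : 0 < c ->
  (\int[lebesgue_rV n]_y (gaussN c x y)%:E = (Num.sqrt (pi / c) ^+ n)%:E)%E.
Proof.
move=> c0; elim: n x => [x|n IH x].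
  by rewrite integral_rV0 /gaussN /sqn /dotp big_ord0 mulr0 oppr0 expR0.
rewrite ge0_integral_rVS; last 2 first.
- exact: emeasurable_gaussN.
- by move=> y; rewrite lee_fin gaussN_ge0.
rewrite -(cons_uncons x); case: (uncons_rV x) => x0 x'.
transitivity (\int[mu]_a ((Num.sqrt (pi / c) ^+ n)%:E * (gauss1 c x0 a)%:E))%E.
  apply: eq_integral => a _; rewrite -(IH x') muleC mul_ge0_integral.
  - by apply: eq_integral => y _; rewrite gaussN_cons.
  - exact: emeasurable_gaussN.
  - by move=> y; rewrite lee_fin gaussN_ge0.
  - exact: expR_ge0.
rewrite -mul_ge0_integral; last 3 first.
- by apply/measurable_EFinP; exact: measurable_gauss1.
- by move=> y; rewrite lee_fin expR_ge0.
- by rewrite exprn_ge0// sqrtr_ge0.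
by rewrite integral_gauss1// exprSr.
Qed.

Lemma integrable_gaussN n c (x : 'rV[R]_n) : 0 < c ->
  (lebesgue_rV n).-integrable setT (fun y => (gaussN c x y)%:E).
Proof.
move=> c0; apply/integrableP; split; first exact: emeasurable_gaussN.
under eq_integral do rewrite gee0_abs ?lee_fin ?gaussN_ge0//.
by rewrite integral_gaussN// ltry.
Qed.

Lemma measurable_cosN n (xi : 'rV[R]_n) dl :
  measurable_fun [set: 'rV[R]_n] (fun y => cos (dotp y xi + dl)).
Proof.
apply: measurableT_comp; first by apply: continuous_measurable_fun; exact: continuous_cos.
apply: measurable_funD => //; exact: measurable_dotp.
Qed.

Lemma integrable_cosgaussN n c (x xi : 'rV[R]_n) dl : 0 < c ->
  (lebesgue_rV n).-integrable setT (fun y => (cos (dotp y xi + dl) * gaussN c x y)%:E).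
Proof.
move=> c0; apply: (@integrable_le _ _ _ _ _ (gaussN c x)); last exact: integrable_gaussN.
  by apply: measurable_funM; [exact: measurable_cosN|exact: measurable_gaussN].
by move=> y; rewrite normrM (ger0_norm (gaussN_ge0 _ _ _)) ler_piMl ?gaussN_ge0// cos_max.
Qed.

(** The cosine of a sum does not factor, but a fixed first coordinate only shifts the phase seen by
    the remaining ones; the induction therefore runs over all [dl]. *)
Lemma Rintegral_cosgaussN n c (x xi : 'rV[R]_n) dl : 0 < c ->
  \int[lebesgue_rV n]_y (cos (dotp y xi + dl) * gaussN c x y) =
  cos (dotp x xi + dl) * Num.sqrt (pi / c) ^+ n * expR (- (sqn xi / (4 * c))).
Proof.
move=> c0; elim: n x xi dl => [x xi dl|n IH x xi dl].
  rewrite /Rintegral integral_rV0 /gaussN /sqn /dotp !big_ord0.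
  by rewrite mulr0 mul0r oppr0 expR0 !mulr1.
rewrite Rintegral_rVS; last 2 first.
- exact: integrable_cosgaussN.
- move=> a; rewrite -(cons_uncons x) -(cons_uncons xi).
  move: (uncons_rV x) (uncons_rV xi) => [x0 x'] [xi0 xi'].
  apply: eq_integrable (integrableZl measurableT (gauss1 c x0 a) (integrable_cosgaussN x' xi' (a * xi0 + dl) c0)) => //.
  by move=> y _; rewrite -EFinM gaussN_cons dotp_cons mulrCA addrA (addrC (dotp _ _)).
rewrite -(cons_uncons x) -(cons_uncons xi).
move: (uncons_rV x) (uncons_rV xi) => [x0 x'] [xi0 xi'].
transitivity (\int[mu]_a ((Num.sqrt (pi / c) ^+ n * expR (- (sqn xi' / (4 * c)))) *
   cosgauss c x0 (x0 * xi0 + dotp x' xi' + dl) xi0 a)).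
  apply: eq_Rintegral => a _.
  transitivity (\int[lebesgue_rV n]_y (gauss1 c x0 a * (cos (dotp y xi' + (a * xi0 + dl)) * gaussN c x' y))).
    by apply: eq_Rintegral => y _; rewrite gaussN_cons dotp_cons mulrCA !addrA (addrC (dotp _ _)).
  rewrite RintegralZl//; last exact: integrable_cosgaussN.
  rewrite IH /cosgauss.
  have -> : xi0 * (a - x0) + (x0 * xi0 + dotp x' xi' + dl) = dotp x' xi' + (a * xi0 + dl) by ring.
  by move: (gauss1 _ _ _) (cos _) (_ ^+ _) (expR _) => A B C D; ring.
rewrite RintegralZl//; last exact: integrable_cosgauss.
rewrite Rintegral_cosgauss// dotp_cons.
have -> : sqn (cons_rV (xi0, xi')) = xi0 ^+ 2 + sqn xi' by rewrite /sqn dotp_cons.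
rewrite [_ ^+ n.+1]exprSr (_ : - ((xi0 ^+ 2 + sqn xi') / (4 * c)) = - (xi0 ^+ 2 / (4 * c)) + - (sqn xi' / (4 * c))).
  by rewrite expRD; ring.
by rewrite mulrDl opprD.
Qed.

(** * Cosine transform of a superposition of Gaussians with weight [w], amplitude [A] and rate
    [c] *)

Section mixtures.
Variables (n : nat) (w A c : R -> R) (M : R).
Hypotheses (mw : measurable_fun [set: lineR] w)
  (mA : measurable_fun [set: lineR] A)
  (mc : measurable_fun [set: lineR] c).
Hypotheses (w_ge0 : forall t, 0 <= w t) (w_eq0 : forall t, t <= 0 -> w t = 0).
Hypothesis intw : mu.-integrable [set: lineR] (fun t => (w t)%:E).
Hypotheses (c_gt0 : forall t, 0 < t -> 0 < c t)
  (A_ge0 : forall t, 0 < t -> 0 <= A t) (A_le : forall t, 0 < t -> A t <= M)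
  (Ac_le : forall t, 0 < t -> A t * Num.sqrt (pi / c t) ^+ n <= M).

Let wA_ge0 t : 0 <= w t * A t.
Proof.
have [t0|t0] := leP t 0; first by rewrite w_eq0// mul0r.
by rewrite mulr_ge0// A_ge0.
Qed.

Let wA_le t : w t * A t <= M * w t.
Proof.
have [t0|t0] := leP t 0; first by rewrite w_eq0// mul0r mulr0.
by rewrite mulrC ler_wpM2r// A_le.
Qed.

Lemma gaussN_le1 (t : R) (x y : 'rV[R]_n) : 0 < t -> gaussN (c t) x y <= 1.
Proof.
by move=> t0; rewrite /gaussN -expR0 ler_expR oppr_le0 mulr_ge0 ?sqn_ge0// ltW// c_gt0.
Qed.

Lemma wA_gaussN_le t (x y : 'rV[R]_n) : w t * A t * gaussN (c t) x y <= M * w t.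
Proof.
have [t0|t0] := leP t 0; first by rewrite w_eq0// !mul0r mulr0.
by rewrite (le_trans _ (wA_le t))// ler_piMr// gaussN_le1.
Qed.

Lemma integrable_mixture (x y : 'rV[R]_n) :
  mu.-integrable [set: lineR] (fun t => (w t * A t * gaussN (c t) x y)%:E).
Proof.
apply: (@integrable_le _ _ _ _ _ (fun t : lineR => M * w t)).
- apply: measurable_funM; first exact: measurable_funM.
  by apply: measurable_gaussN_comp.
- by move=> t; rewrite ger0_norm ?wA_gaussN_le// mulr_ge0// gaussN_ge0.
- exact: (integrableZl measurableT M intw).
Qed.

(** Serves in both directions of the Fourier transform: with normalized heat kernels it transforms a
    mixture, and with unit amplitudes and rates s + t it transforms a Laplace transform back. *)
Lemma mixture_swap (x xi : 'rV[R]_n) dl :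
  \int[lebesgue_rV n]_y (cos (dotp y xi + dl) * \int[mu]_t (w t * A t * gaussN (c t) x y)) =
  cos (dotp x xi + dl) *
  \int[mu]_t (w t * (A t * Num.sqrt (pi / c t) ^+ n) * expR (- (sqn xi / (4 * c t)))).
Proof.
have mcos : measurable_fun [set: 'rV[R]_n] (fun y => cos (dotp y xi + dl)) by exact: measurable_cosN.
have mf : measurable_fun setT (fun z : 'rV[R]_n * lineR =>
    cos (dotp z.1 xi + dl) * (w z.2 * A z.2 * gaussN (c z.2) x z.1)).
  apply: measurable_funM; first by apply: (measurableT_comp mcos).
  apply: measurable_funM.
    by apply: measurable_funM; [apply: (measurableT_comp mw)|apply: (measurableT_comp mA)].
  by apply: measurable_gaussN_comp => //; exact: (measurableT_comp mc).
have inty y : mu.-integrable setT (fun t => (cos (dotp y xi + dl) * (w t * A t * gaussN (c t) x y))%:E).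
  exact: (integrableZl measurableT (cos (dotp y xi + dl)) (integrable_mixture x y)).
have intt t : (lebesgue_rV n).-integrable setT
    (fun y => (cos (dotp y xi + dl) * (w t * A t * gaussN (c t) x y))%:E).
  have [t0|t0] := leP t 0.
    by under eq_fun do rewrite w_eq0// !mul0r mulr0; exact: integrable0.
  apply: eq_integrable (integrableZl measurableT (w t * A t) (integrable_cosgaussN x xi dl (c_gt0 t0))) => //.
  by move=> y _; rewrite -EFinM mulrCA.
transitivity (\int[lebesgue_rV n]_y \int[mu]_t (cos (dotp y xi + dl) * (w t * A t * gaussN (c t) x y))).
  apply: eq_Rintegral => y _; rewrite RintegralZl//; exact: integrable_mixture.
(* Absolute integrability: at a fixed time the integral in y is at most w(t) times the amplitude
   times the Gaussian mass, which [Ac_le] bounds by M w(t). *)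
rewrite fubini_swap//; last first.
  rewrite tonelli; last 2 first.
  - by apply/measurable_EFinP; apply: measurableT_comp.
  - by move=> y t; rewrite lee_fin.
  apply: (@le_lt_trans _ _ (\int[mu]_t (M * w t)%:E)%E); last first.
    exact: integrable_lty (integrableZl measurableT M intw).
  apply: ge0_le_integral => //.
  - by move=> t _; apply: integral_ge0 => y _; rewrite lee_fin.
  - apply: (@measurable_integral_l _ _ _ _ _ _ (fun (y : 'rV[R]_n) (t : lineR) =>
      `|cos (dotp y xi + dl) * (w t * A t * gaussN (c t) x y)|%:E)).
      by apply/measurable_EFinP; apply: measurableT_comp.
    by move=> y t; rewrite lee_fin.
  - by apply/measurable_EFinP; exact: measurable_funM.
  move=> t _; have [t0|t0] := leP t 0.
    rewrite w_eq0// mulr0 integral0_eq// => y _.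
    by rewrite !mul0r mulr0 normr0.
  apply: (@le_trans _ _ (\int[lebesgue_rV n]_y (w t * A t * gaussN (c t) x y)%:E)%E).
    apply: ge0_le_integral => //.
    + by apply/measurable_EFinP; apply: measurableT_comp => //; apply/measurable_EFinP; exact: measurable_int (intt t).
    + by apply/measurable_EFinP; apply: measurable_funM => //; exact: measurable_gaussN.
    move=> y _; rewrite lee_fin normrM (ger0_norm (mulr_ge0 (wA_ge0 t) (gaussN_ge0 _ _ _))).
    by rewrite ler_piMl ?cos_max// mulr_ge0 ?gaussN_ge0.
  rewrite -(@mul_ge0_integral _ _ _ (lebesgue_rV n) (fun y => (gaussN (c t) x y)%:E)) //.
  - by rewrite integral_gaussN ?c_gt0// -EFinM lee_fin -mulrA (mulrC M) ler_wpM2l// Ac_le.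
  - exact: emeasurable_gaussN.
  - by move=> y; rewrite lee_fin gaussN_ge0.
transitivity (\int[mu]_t (cos (dotp x xi + dl) * (w t * (A t * Num.sqrt (pi / c t) ^+ n) * expR (- (sqn xi / (4 * c t)))))).
  apply: eq_Rintegral => t _.
  have [t0|t0] := leP t 0.
    rewrite w_eq0// !mul0r mulr0.
    transitivity (\int[lebesgue_rV n]_y (0 : R)); last by rewrite Rintegral_cst// mul0r.
    by apply: eq_Rintegral => y _; rewrite !mul0r mulr0.
  under eq_Rintegral do rewrite mulrCA.
  rewrite RintegralZl//; last exact: integrable_cosgaussN (c_gt0 t0).
  rewrite Rintegral_cosgaussN ?c_gt0//.
  by move: (w t) (A t) (cos _) (_ ^+ _) (expR _) => a b e d f; ring.
rewrite RintegralZl//.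
apply: (@integrable_le _ _ _ _ _ (fun t : lineR => M * w t)).
- apply: measurable_funM.
    apply: measurable_funM => //; apply: measurable_funM => //.
    apply: measurable_funX; apply: (measurableT_comp measurable_sqrtr).
    by apply: measurable_funM => //; apply: (measurableT_comp measurable_inv).
  apply: measurableT_comp => //; apply: measurable_funN; apply: measurable_funM => //.
  by apply: (measurableT_comp measurable_inv); exact: measurable_funM.
- move=> t; have [t0|t0] := leP t 0; first by rewrite w_eq0// !mul0r mulr0 normr0.
  rewrite ger0_norm ?mulr_ge0 ?expR_ge0 ?exprn_ge0 ?sqrtr_ge0 ?A_ge0//.
  rewrite (mulrC M) -mulrA ler_wpM2l// (le_trans _ (Ac_le t0))// ler_piMr//.
    by rewrite ?mulr_ge0 ?expR_ge0 ?exprn_ge0 ?sqrtr_ge0 ?A_ge0.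
  by rewrite -expR0 ler_expR oppr_le0 divr_ge0 ?sqn_ge0// mulr_ge0// ltW// c_gt0.
- exact: (integrableZl measurableT M intw).
Qed.

End mixtures.

(** * The heat kernel and its mixtures *)

Lemma sqrt_pi_div t : 0 < t -> Num.sqrt (pi / t) = 2 * pi * (Num.sqrt (4 * pi * t))^-1 :> R.
Proof.
move=> t0; have pi0 : 0 < pi :> R by exact: pi_gt0.
have s0 : 0 < Num.sqrt (4 * pi * t) by rewrite sqrtr_gt0 !mulr_gt0.
apply: (mulIf (lt0r_neq0 s0)); rewrite mulfVK ?gt_eqF//.
rewrite -sqrtrM ?divr_ge0 ?ltW//.
have -> : pi / t * (4 * pi * t) = (2 * pi) ^+ 2 by field; rewrite gt_eqF.
by rewrite sqrtr_sqr ger0_norm// mulr_ge0 ?ltW.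
Qed.

(** The number (4 pi t)^(-n/2), maximum of the heat kernel of time t. *)
Definition peak n t : R := (Num.sqrt (4 * pi * t))^-1 ^+ n.

Definition heat n t (x y : 'rV[R]_n) : R := peak n t * gaussN (4 * t)^-1 x y.

Lemma sqrt_4pi_gt0 (t : R) : 0 < t -> 0 < Num.sqrt (4 * pi * t).
Proof. by move=> t0; rewrite sqrtr_gt0 !mulr_gt0// pi_gt0. Qed.

Lemma peak_ge0 n t : 0 <= peak n t.
Proof. by rewrite exprn_ge0// invr_ge0 sqrtr_ge0. Qed.

Lemma peak_anti n t u : 0 < t -> t <= u -> peak n u <= peak n t.
Proof.
move=> t0 tu; have u0 := lt_le_trans t0 tu.
rewrite /peak lerXn2r ?nnegrE ?invr_ge0 ?sqrtr_ge0//.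
rewrite lef_pV2 ?posrE ?sqrt_4pi_gt0// ler_wsqrtr// ler_pM2l//.
by rewrite mulr_gt0// pi_gt0.
Qed.

Lemma measurable_peak n : measurable_fun [set: lineR] (peak n : lineR -> R).
Proof.
apply: measurable_funX; apply: (measurableT_comp measurable_inv).
by apply: (measurableT_comp measurable_sqrtr); exact: measurable_funM.
Qed.

Lemma peakM_gauss n t : 0 < t -> peak n t * Num.sqrt (pi / (4 * t)^-1) ^+ n = 1.
Proof.
move=> t0; rewrite invrK (mulrC pi) (mulrAC 4) /peak exprVn mulVf//.
by rewrite gt_eqF// exprn_gt0// sqrt_4pi_gt0.
Qed.

Lemma heat_ge0 n t (x y : 'rV[R]_n) : 0 <= heat t x y.
Proof. by rewrite mulr_ge0 ?peak_ge0 ?gaussN_ge0. Qed.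

Lemma heatC n t (x y : 'rV[R]_n) : heat t x y = heat t y x.
Proof. by rewrite /heat gaussNC. Qed.

Lemma heat_le n t (x y : 'rV[R]_n) : 0 <= t -> heat t x y <= peak n t.
Proof.
move=> t0; rewrite ler_piMr ?peak_ge0//.
by rewrite /gaussN -expR0 ler_expR oppr_le0 mulr_ge0 ?sqn_ge0// invr_ge0 mulr_ge0.
Qed.

Lemma measurable_heat_comp n d (T : measurableType d) (t : T -> R) (f g : T -> 'rV[R]_n) :
  measurable_fun setT t -> measurable_fun setT f -> measurable_fun setT g ->
  measurable_fun setT (fun u => heat (t u) (f u) (g u)).
Proof.
move=> mt mf mg; apply: measurable_funM; first exact: (measurableT_comp (measurable_peak n)).
apply: measurable_gaussN_comp => //; apply: (measurableT_comp measurable_inv).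
exact: measurable_funM.
Qed.

Lemma measurable_heat n t (x : 'rV[R]_n) : measurable_fun setT (heat t x).
Proof. exact: measurable_heat_comp. Qed.

Lemma integral_heat n t (x : 'rV[R]_n) : 0 < t ->
  (\int[lebesgue_rV n]_y (heat t x y)%:E = 1)%E.
Proof.
move=> t0; rewrite -(peakM_gauss n t0) EFinM -(@integral_gaussN n _ x); last first.
  by rewrite invr_gt0 mulr_gt0.
rewrite mul_ge0_integral//.
- exact: emeasurable_gaussN.
- by move=> y; rewrite lee_fin gaussN_ge0.
- exact: peak_ge0.
Qed.

(** For s > 0 all times stay above s, which keeps the mixture bounded; at s = 0 the weight
    [low_weight (gamma / 2)] would give a truncated Riesz kernel, up to a constant. *)
Definition mix n (w : R -> R) s (x y : 'rV[R]_n) : R := \int[mu]_t (w t * heat (s + t) x y).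

Section mix.
Variables (n : nat) (w : R -> R) (s : R).
Hypotheses (mw : measurable_fun [set: lineR] w) (w_ge0 : forall t, 0 <= w t)
  (w_eq0 : forall t, t <= 0 -> w t = 0)
  (intw : mu.-integrable [set: lineR] (fun t => (w t)%:E)) (s0 : 0 < s).

Let sD t : 0 < t -> 0 < s + t. Proof. exact: addr_gt0. Qed.

Let mixE (x y : 'rV[R]_n) :
  mix w s x y = \int[mu]_t (w t * peak n (s + t) * gaussN (4 * (s + t))^-1 x y).
Proof. by apply: eq_Rintegral => t _; rewrite mulrA. Qed.

Lemma mix_ge0 (x y : 'rV[R]_n) : 0 <= mix w s x y.
Proof. by apply: Rintegral_ge0 => t _; rewrite mulr_ge0// heat_ge0. Qed.

Lemma integrable_mix (x y : 'rV[R]_n) :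
  mu.-integrable [set: lineR] (fun t => (w t * heat (s + t) x y)%:E).
Proof.
apply: (@integrable_le _ _ _ _ _ (fun t : lineR => peak n s * w t)).
- apply: measurable_funM => //; apply: measurable_heat_comp => //.
  exact: measurable_funD.
- move=> t; rewrite ger0_norm; last by rewrite mulr_ge0// heat_ge0.
  rewrite [leRHS]mulrC.
  have [t0|t0] := leP t 0; first by rewrite w_eq0// !mul0r.
  rewrite ler_wpM2l// (@le_trans _ _ (peak n (s + t)))//.
    by rewrite heat_le// ltW// sD.
  by rewrite peak_anti// lerDl ltW.
- exact: (integrableZl measurableT (peak n s) intw).
Qed.

Lemma EFin_mix (x y : 'rV[R]_n) :
  ((mix w s x y)%:E = \int[mu]_t (w t * heat (s + t) x y)%:E)%E.
Proof. by rewrite fineK// integrable_fin_num// integrable_mix. Qed.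

Lemma measurable_mix : measurable_fun setT (fun z : 'rV[R]_n * 'rV[R]_n => mix w s z.1 z.2).
Proof.
apply/measurable_EFinP; rewrite [X in measurable_fun _ X](_ : _ =
    fun z => \int[mu]_t (w t * heat (s + t) z.1 z.2)%:E)%E; last first.
  by apply/funext => z /=; rewrite EFin_mix.
apply: (measurable_integral_r (T1 := ('rV[R]_n * 'rV[R]_n)%type) (T2 := lineR) lebesgue_measure).
  apply/measurable_EFinP; apply: measurable_funM; first exact: (measurableT_comp mw).
  apply: measurable_heat_comp; first exact: measurable_funD.
  - exact: (measurableT_comp (f := fst)).
  - exact: (measurableT_comp (f := snd)).
by move=> z t; rewrite lee_fin mulr_ge0// heat_ge0.
Qed.

Lemma cos_mix (x xi : 'rV[R]_n) dl :
  \int[lebesgue_rV n]_y (cos (dotp y xi + dl) * mix w s x y) =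
  cos (dotp x xi + dl) * \int[mu]_t (w t * expR (- ((s + t) * sqn xi))).
Proof.
under eq_Rintegral do rewrite mixE.
rewrite (@mixture_swap n w (fun t => peak n (s + t)) (fun t => (4 * (s + t))^-1) (Num.max 1 (peak n s)))//.
- congr (_ * _); apply: eq_Rintegral => t _; have [t0|t0] := leP t 0.
    by rewrite w_eq0// !mul0r.
  rewrite peakM_gauss ?sD// mulr1; congr (_ * expR (- _)).
  by field; rewrite gt_eqF// sD.
- by apply: (measurableT_comp (measurable_peak n)); exact: measurable_funD.
- apply: (measurableT_comp measurable_inv); apply: measurable_funM => //; exact: measurable_funD.
- by move=> t t0; rewrite invr_gt0 mulr_gt0// sD.
- by move=> t t0; rewrite peak_ge0.
- by move=> t t0; rewrite le_max (@peak_anti _ s (s + t)) ?orbT// lerDl ltW.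
- by move=> t t0; rewrite peakM_gauss ?sD// le_max lexx.
Qed.

(** Fourier inversion for mixtures, by a second Gaussian transform in xi rather than by a general
    inversion theorem. *)
Lemma cos_laplace (z : 'rV[R]_n) dl :
  \int[lebesgue_rV n]_xi (cos (dotp xi z + dl) * \int[mu]_t (w t * expR (- ((s + t) * sqn xi)))) =
  cos dl * (2 * pi) ^+ n * mix w s 0 z.
Proof.
transitivity (\int[lebesgue_rV n]_xi (cos (dotp xi z + dl) * \int[mu]_t (w t * 1 * gaussN (s + t) 0 xi))).
  apply: eq_Rintegral => xi _; congr (_ * _); apply: eq_Rintegral => t _.
  by rewrite /gaussN subr0 mulr1.
rewrite (@mixture_swap n w (fun t => 1) (fun t => s + t) (Num.max 1 ((2 * pi) ^+ n * peak n s)))//.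
- rewrite (_ : dotp 0 z = 0) ?add0r; last by rewrite /dotp big1// => i _; rewrite mxE mul0r.
  rewrite -mulrA; congr (_ * _); rewrite /mix -RintegralZl//; last exact: integrable_mix.
  apply: eq_Rintegral => t _; have [t0|t0] := leP t 0; first by rewrite w_eq0// !mul0r mulr0.
  rewrite mul1r sqrt_pi_div ?sD// exprMn /heat /gaussN subr0 /peak.
  by rewrite (mulrC (sqn z)); ring.
- exact: measurable_funD.
- by move=> t t0; rewrite le_max lexx.
- move=> t t0; rewrite mul1r sqrt_pi_div ?sD// exprMn le_max; apply/orP; right.
  rewrite ler_wpM2l ?exprn_ge0 ?mulr_ge0 ?pi_ge0//.
  by apply: peak_anti => //; rewrite lerDl ltW.
Qed.

End mix.

End space.

(** * The fractional Laplacian of a Gaussian mixture *)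

Section fraclap.
Context {R : realType} (n : nat).
Local Notation Rn := 'rV[R]_n.
Local Notation leb := (lebesgue_rV n).
Local Notation mu := lebesgue_measure.
Local Notation lineR := (measurableTypeR R).
Implicit Types x y z xi : Rn.

Lemma dotpC x y : dotp x y = dotp y x.
Proof. by apply: eq_bigr => i _; rewrite mulrC. Qed.

Lemma dotpBl x y z : dotp (x - y) z = dotp x z - dotp y z.
Proof. by rewrite /dotp -sumrB; apply: eq_bigr => i _; rewrite !mxE mulrBl. Qed.

Lemma dotpNr x y : dotp x (- y) = - dotp x y.
Proof. by rewrite /dotp -sumrN; apply: eq_bigr => i _; rewrite !mxE mulrN. Qed.

Lemma sqnN x : sqn (- x) = sqn x.
Proof. by apply: eq_bigr => i _; rewrite !mxE mulrNN. Qed.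

Lemma heat_shift t x y : heat t x y = heat t 0 (y - x).
Proof. by rewrite /heat /gaussN subr0. Qed.

Lemma mix_shift w s x y : mix w s x y = mix w s 0 (y - x).
Proof. by rewrite /mix; apply: eq_Rintegral => t _; rewrite heat_shift. Qed.

Lemma Re_mul_real (z : R[i]) (c : R) : complex.Re (z * real_complex R c) = complex.Re z * c.
Proof. by case: z => a b /=; rewrite mulr0 subr0. Qed.

Lemma Im_mul_real (z : R[i]) (c : R) : complex.Im (z * real_complex R c) = complex.Im z * c.
Proof. by case: z => a b /=; rewrite mulr0 add0r. Qed.

Lemma complexP (z z' : R[i]) :
  complex.Re z = complex.Re z' -> complex.Im z = complex.Im z' -> z = z'.
Proof. by case: z => a b; case: z' => a' b' /= -> ->. Qed.

Lemma cexp_iD a b : cexp_i (a + b) = cexp_i a * cexp_i b :> R[i].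
Proof.
apply: complexP => /=; first by rewrite cosD.
by rewrite sinD mulrC addrC (mulrC (cos a)) (mulrC (sin b)) addrC.
Qed.

Definition laplace (w : R -> R) s (lam : R) : R := \int[mu]_t (w t * expR (- ((s + t) * lam))).

(** The phase 0 gives the real part, and the phase -pi/2 the imaginary part, which vanishes because
    the cosine of the phase does. *)
Lemma inv_fourier_real (M : Rn -> R) (m : R) x z :
  (forall dl, \int[leb]_xi (cos (dotp xi (z - x) + dl) * M xi) =
    cos dl * (2 * pi) ^+ n * m) ->
  inv_fourier (fun xi => cexp_i (- dotp x xi) * real_complex R (M xi)) z = real_complex R m.
Proof.
move=> h.
have E xi : cexp_i (dotp z xi) * (cexp_i (- dotp x xi) * real_complex R (M xi)) =
    cexp_i (dotp xi (z - x)) * real_complex R (M xi).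
  by rewrite mulrA -cexp_iD (dotpC xi) dotpBl.
have p0 : (2 * pi) ^+ n != 0 :> R by rewrite expf_neq0// mulf_neq0// gt_eqF// pi_gt0.
rewrite /inv_fourier.
have -> : cintegral (fun xi => cexp_i (dotp z xi) * (cexp_i (- dotp x xi) * real_complex R (M xi))) =
    real_complex R ((2 * pi) ^+ n * m).
  rewrite /cintegral (_ : real_complex R _ = Complex ((2 * pi) ^+ n * m) 0)//; congr Complex.
    have := h 0; rewrite cos0 mul1r => <-; apply: eq_Rintegral => xi _.
    by rewrite E Re_mul_real addr0.
  have := h (- (pi / 2)); rewrite cosN cos_pihalf !mul0r => <-.
  by apply: eq_Rintegral => xi _; rewrite E Im_mul_real cosBpihalf.
by rewrite -rmorphM /= mulKf.
Qed.

Section weight.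
Variables (w : R -> R) (s : R).
Hypotheses (mw : measurable_fun [set: lineR] w) (w_ge0 : forall t, 0 <= w t)
  (w_eq0 : forall t, t <= 0 -> w t = 0)
  (intw : mu.-integrable [set: lineR] (fun t => (w t)%:E)) (s0 : 0 < s).

Lemma fourier_mix x xi : fourier (fun y => real_complex R (mix w s x y)) xi =
  cexp_i (- dotp x xi) * real_complex R (laplace w s (sqn xi)).
Proof.
have h dl : \int[leb]_y (cos (dotp y (- xi) + dl) * mix w s x y) =
    cos (dotp x (- xi) + dl) * laplace w s (sqn xi).
  by rewrite (cos_mix mw w_ge0 w_eq0 intw s0 x (- xi) dl) sqnN.
rewrite /fourier /cintegral; apply: complexP => /=.
  rewrite mulr0 subr0 -dotpNr -[X in cos X]addr0 -h.
  by apply: eq_Rintegral => y _; rewrite mulr0 subr0 addr0 dotpNr.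
rewrite mulr0 add0r -dotpNr -cosBpihalf -h.
by apply: eq_Rintegral => y _; rewrite mulr0 add0r cosBpihalf dotpNr.
Qed.

End weight.

Section weight_laplace.
Variables (w : R -> R) (s : R).
Hypotheses (mw : measurable_fun [set: lineR] w) (w_ge0 : forall t, 0 <= w t)
  (w_eq0 : forall t, t <= 0 -> w t = 0)
  (intw : mu.-integrable [set: lineR] (fun t => (w t)%:E)) (s0 : 0 <= s).

Lemma integrable_laplace lam : 0 <= lam ->
  mu.-integrable [set: lineR] (fun t => (w t * expR (- ((s + t) * lam)))%:E).
Proof.
move=> l0; apply: (@integrable_le _ _ _ _ _ (w : lineR -> R)) => //.
  apply: measurable_funM => //; apply: measurableT_comp => //; apply: measurable_funN.
  by apply: measurable_funM => //; exact: measurable_funD.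
move=> t; have [t0|t0] := leP t 0; first by rewrite w_eq0// mul0r normr0.
rewrite ger0_norm; last by rewrite mulr_ge0// expR_ge0.
rewrite ler_piMr// -expR0 ler_expR oppr_le0 mulr_ge0//.
by rewrite addr_ge0// ltW.
Qed.

Lemma measurable_laplace_sqn : measurable_fun setT (fun xi : Rn => laplace w s (sqn xi)).
Proof.
apply/measurable_EFinP; rewrite [X in measurable_fun _ X](_ : _ =
    fun xi => \int[mu]_t (w t * expR (- ((s + t) * sqn xi)))%:E)%E; last first.
  by apply/funext => xi /=; rewrite fineK// integrable_fin_num// integrable_laplace// sqn_ge0.
apply: (measurable_integral_r (T1 := Rn) (T2 := lineR) lebesgue_measure).
  apply/measurable_EFinP; apply: measurable_funM; first exact: (measurableT_comp mw).
  apply: measurableT_comp => //; apply: measurable_funN; apply: measurable_funM.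
    exact: measurable_funD.
  exact: (measurableT_comp (@measurable_sqn R n)).
by move=> z t; rewrite lee_fin mulr_ge0// expR_ge0.
Qed.

End weight_laplace.

Lemma laplaceE (w : R -> R) s lam : measurable_fun [set: lineR] w ->
  (forall t, 0 <= w t) -> (forall t, t <= 0 -> w t = 0) ->
  mu.-integrable [set: lineR] (fun t => (w t)%:E) -> 0 <= lam ->
  laplace w s lam = expR (- (s * lam)) * laplace w 0 lam.
Proof.
move=> mw w0 wn iw l0; rewrite /laplace -RintegralZl//; last exact: integrable_laplace.
by apply: eq_Rintegral => t _; rewrite add0r mulrCA -expRD mulrDl opprD.
Qed.

Lemma laplace_le (w : R -> R) s lam : measurable_fun [set: lineR] w ->
  (forall t, 0 <= w t) -> (forall t, t <= 0 -> w t = 0) ->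
  mu.-integrable [set: lineR] (fun t => (w t)%:E) -> 0 <= lam ->
  `|laplace w s lam| <= laplace w 0 0 * expR (- (s * lam)).
Proof.
move=> mw w0 wn iw l0; rewrite laplaceE// normrM (ger0_norm (expR_ge0 _)) mulrC.
rewrite ler_wpM2r ?expR_ge0// ger0_norm; last first.
  by apply: Rintegral_ge0 => t _; rewrite mulr_ge0// expR_ge0.
apply: le_Rintegral => //; try exact: integrable_laplace.
move=> t _; have [t0|t0] := leP t 0; first by rewrite wn// !mul0r.
rewrite ler_wpM2l// mulr0 oppr0 ler_expR oppr_le0 add0r mulr_ge0// ltW//.
Qed.

Lemma EFin_laplace0 (w : R -> R) lam : measurable_fun [set: lineR] w ->
  (forall t, 0 <= w t) -> (forall t, t <= 0 -> w t = 0) ->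
  mu.-integrable [set: lineR] (fun t => (w t)%:E) -> 0 <= lam ->
  ((laplace w 0 lam)%:E = \int[mu]_t (w t * expR (- (t * lam)))%:E)%E.
Proof.
move=> mw w0 wn iw l0; rewrite fineK; last by rewrite integrable_fin_num// integrable_laplace.
by apply: eq_integral => t _; rewrite add0r.
Qed.

Lemma low_weight_eq0 e t : t <= 0 -> low_weight e t = 0 :> R.
Proof. by move=> t0; rewrite /low_weight indicE mem_setE in_itv/= ltNge t0 mul0r. Qed.

Lemma high_weight_eq0 e t : t <= 0 -> high_weight e t = 0 :> R.
Proof.
move=> t0; rewrite /high_weight indicE mem_setE in_itv/= andbT ltNge (le_trans t0)//.
by rewrite mul0r.
Qed.

(** This is [weights_identity] multiplied by e^(-s lam). With e = gamma/2 and lam = |xi|^2 the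
    left-hand side is the symbol |xi|^gamma times the transform of the mixture. *)
Lemma laplace_identity e s lam : 0 < e -> e < 1 -> 0 < s -> 0 <= lam ->
  lam `^ e * laplace (low_weight e) s lam =
  Gam e * expR (- (s * lam)) - (Gam (1 - e))^-1 * laplace (high_weight e) s lam.
Proof.
move=> e0 e1 s0 l0.
have ml := @measurable_low_weight R e; have mh := @measurable_high_weight R e.
have l_ge0 := @low_weight_ge0 R e; have h_ge0 := @high_weight_ge0 R e.
have il := integrable_low_weight e0; have ih := integrable_high_weight e0 e1.
have ln := low_weight_eq0 e; have hn := high_weight_eq0 e.
have := weights_identity e0 e1 l0.
rewrite -(EFin_laplace0 ml l_ge0 ln il l0) -(EFin_laplace0 mh h_ge0 hn ih l0).
rewrite -!EFinM -EFinD => /(congr1 fine) /= E.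
rewrite (laplaceE s ml l_ge0 ln il l0) (laplaceE s mh h_ge0 hn ih l0) -E.
by move: (_ `^ e) (expR _) (laplace _ _ _) (laplace _ _ _) (_^-1) => a b c d f; ring.
Qed.

(* The truncated Riesz potential of a Gaussian; its image under (- Delta)^(gamma/2) is
   the Gaussian itself up to a mixture of Gaussians of variance bounded below. *)
Lemma fraclap_mix gamma s x z : 0 < gamma -> gamma < 2 -> 0 < s ->
  fraclap_schwartz gamma (fun y => real_complex R (mix (low_weight (gamma / 2)) s x y)) z =
  real_complex R (Gam (gamma / 2) * heat s x z -
    (Gam (1 - gamma / 2))^-1 * mix (high_weight (gamma / 2)) s x z).
Proof.
move=> g0 g2 s0; have e0 : 0 < gamma / 2 by rewrite divr_gt0.
have e1 : gamma / 2 < 1 by rewrite ltr_pdivrMr// mul1r.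
set e := gamma / 2 in e0 e1 *.
have ml := @measurable_low_weight R e; have mh := @measurable_high_weight R e.
have l_ge0 := @low_weight_ge0 R e; have h_ge0 := @high_weight_ge0 R e.
have il := integrable_low_weight e0; have ih := integrable_high_weight e0 e1.
have ln := low_weight_eq0 e; have hn := high_weight_eq0 e.
have -> : fraclap_schwartz gamma (fun y => real_complex R (mix (low_weight e) s x y)) =
   inv_fourier (fun xi => cexp_i (- dotp x xi) *
     real_complex R (Gam e * gaussN s 0 xi - (Gam (1 - e))^-1 * laplace (high_weight e) s (sqn xi))).
  rewrite /fraclap_schwartz; congr inv_fourier; apply/funext => xi.
  rewrite (fourier_mix ml l_ge0 ln il s0) enorm_powR// mulrCA -rmorphM/=.
  by rewrite laplace_identity ?sqn_ge0// /gaussN subr0.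
apply: inv_fourier_real => dl.
have ic1 : leb.-integrable setT
    (fun xi => (cos (dotp xi (z - x) + dl) * gaussN s 0 xi)%:E).
  exact: integrable_cosgaussN.
have ic2 : leb.-integrable setT
    (fun xi => (cos (dotp xi (z - x) + dl) * laplace (high_weight e) s (sqn xi))%:E).
  apply: (@integrable_le _ _ _ _ _ (fun xi => laplace (high_weight e) 0 0 * gaussN s 0 xi)).
  - apply: measurable_funM; first exact: measurable_cosN.
    by apply: measurable_laplace_sqn => //; exact: ltW.
  - move=> xi; rewrite normrM -[leRHS]mul1r ler_pM ?cos_max//.
    by rewrite (le_trans (laplace_le s mh h_ge0 hn ih (sqn_ge0 xi)))// /gaussN subr0.
  - exact: (integrableZl measurableT _ (integrable_gaussN 0 s0)).
transitivity (\int[leb]_xi (Gam e * (cos (dotp xi (z - x) + dl) * gaussN s 0 xi) -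
   (Gam (1 - e))^-1 * (cos (dotp xi (z - x) + dl) * laplace (high_weight e) s (sqn xi)))).
  by apply: eq_Rintegral => xi _; rewrite mulrBr !(mulrCA (cos _)).
rewrite RintegralB//; last 2 first.
- exact: (integrableZl measurableT _ ic1).
- exact: (integrableZl measurableT _ ic2).
rewrite !RintegralZl//.
rewrite (cos_laplace mh h_ge0 hn ih s0 (z - x) dl) -mix_shift.
rewrite (Rintegral_cosgaussN 0 (z - x) dl s0).
have -> : dotp 0 (z - x) = 0 by rewrite /dotp big1// => i _; rewrite mxE mul0r.
rewrite add0r sqrt_pi_div// exprMn /heat /gaussN /peak mulrBr.
rewrite (mulrC (4 * s)^-1); move: (mix _ _ _ _) (expR _) => A B.
by move: (Gam _) (Gam _)^-1 (cos _) (_ ^+ n) (_ ^+ n) => a b c d f; ring.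
Qed.

End fraclap.

(** * Mixtures over bounded times are Schwartz functions *)

Section schwartz_mixture.
Context {R : realType} (n : nat).
Local Notation mu := lebesgue_measure.
Local Notation lineR := (measurableTypeR R).
Variables (w : R -> R) (s : R) (x : 'rV[R]_n).
Hypotheses (mw : measurable_fun [set: lineR] w) (w_ge0 : forall t, 0 <= w t)
  (w_supp : forall t, w t != 0 -> 0 < t <= 1)
  (intw : mu.-integrable [set: lineR] (fun t => (w t)%:E)) (s0 : 0 < s).
Implicit Types y : 'rV[R]_n.

Let b t : R := (4 * (s + t))^-1.

(** The k-th derivative of the mixture seen as a function of z = |y - x|^2. *)
Definition radial_profile k (z : R) : R :=
  \int[mu]_t (w t * peak n (s + t) * ((- b t) ^+ k * expR (- (b t * z)))).

Let mb : measurable_fun [set: lineR] b.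
Proof.
apply: (measurableT_comp measurable_inv); apply: measurable_funM => //.
exact: measurable_funD.
Qed.

Let b_gt0 t : 0 < t -> 0 < b t.
Proof. by move=> t0; rewrite invr_gt0 mulr_gt0// addr_gt0. Qed.

Let b_le t : 0 < t -> b t <= (4 * s)^-1.
Proof.
move=> t0; rewrite lef_pV2 ?posrE ?mulr_gt0 ?addr_gt0// ler_pM2l// lerDl ltW//.
Qed.

Let b_ge t : 0 < t -> t <= 1 -> (4 * (s + 1))^-1 <= b t.
Proof.
by move=> t0 t1; rewrite lef_pV2 ?posrE ?mulr_gt0 ?addr_gt0// ler_pM2l// lerD2l.
Qed.

Let dom k r t := peak n s * (4 * s)^-1 ^+ k * expR ((4 * s)^-1 * r) * w t.

Let profile_dom k r t z : `|z| <= r ->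
  `|w t * peak n (s + t) * ((- b t) ^+ k * expR (- (b t * z)))| <= dom k r t.
Proof.
move=> zr; have r0 : 0 <= r by exact: le_trans zr.
have [w0|/w_supp/andP[t0 t1]] := eqVneq (w t) 0; first by rewrite /dom w0 !mul0r mulr0 normr0.
have bt := b_gt0 t0.
have -> : `|w t * peak n (s + t) * ((- b t) ^+ k * expR (- (b t * z)))| =
    w t * (peak n (s + t) * (b t ^+ k * expR (- (b t * z)))).
  rewrite !normrM (normrX k (- b t)) normrN (gtr0_norm bt).
  by rewrite (ger0_norm (w_ge0 t)) (ger0_norm (peak_ge0 _ _)) (ger0_norm (expR_ge0 _)) -mulrA.
have b4 : 0 <= (4 * s)^-1 by rewrite invr_ge0 mulr_ge0// ltW.
rewrite /dom [leRHS]mulrC -!mulrA ler_wpM2l//.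
apply: ler_pM; rewrite ?peak_ge0 ?mulr_ge0 ?exprn_ge0 ?expR_ge0 ?(ltW bt)//.
  by rewrite peak_anti// lerDl ltW.
apply: ler_pM; rewrite ?exprn_ge0 ?expR_ge0 ?(ltW bt)//.
  by rewrite lerXn2r ?nnegrE ?(ltW bt)// b_le.
rewrite ler_expR -mulrN (@le_trans _ _ (b t * r))//.
  by rewrite ler_wpM2l ?(ltW bt)// (le_trans (ler_norm _))// normrN.
by rewrite ler_wpM2r// b_le.
Qed.

Let measurable_profile k z : measurable_fun [set: lineR]
  (fun t => w t * peak n (s + t) * ((- b t) ^+ k * expR (- (b t * z)))).
Proof.
apply: measurable_funM.
  apply: measurable_funM => //; apply: (measurableT_comp (measurable_peak n)).
  exact: measurable_funD.
apply: measurable_funM; first by apply: measurable_funX; exact: measurable_funN.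
by apply: measurableT_comp => //; apply: measurable_funN; exact: measurable_funM.
Qed.

Let integrable_profile k z : mu.-integrable [set: lineR]
  (fun t => (w t * peak n (s + t) * ((- b t) ^+ k * expR (- (b t * z))))%:E).
Proof.
apply: (@integrable_le _ _ _ _ _ (dom k `|z| : lineR -> R)) => //; first by move=> t; exact: profile_dom.
exact: (integrableZl measurableT _ intw).
Qed.

Lemma is_derive_radial_profile k z :
  is_derive z (1 : R) (radial_profile k) (radial_profile k.+1 z).
Proof.
apply: (@is_derive_under_integral _ _ _ mu
  (fun z t => w t * peak n (s + t) * ((- b t) ^+ k * expR (- (b t * z))))
  (fun z t => w t * peak n (s + t) * ((- b t) ^+ k.+1 * expR (- (b t * z))))
  (dom k.+1 (`|z| + 1)) z (z - 1) (z + 1)).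
- by rewrite ltrBlDr ltrDl ltr01.
- by move=> y; exact: integrable_profile.
- move=> y t _; have h : is_derive y (1 : R) (fun z => - (b t * z)) (- b t).
    by compute_derive; ring.
  by compute_derive; rewrite exprS; ring.
- exact: (integrableZl measurableT _ intw).
- move=> y t /andP[y1 y2]; apply: profile_dom.
  have : `|y - z| <= 1 by rewrite ler_distl; apply/andP; split; apply/ltW.
  by move=> h; rewrite -(subrK z y) (le_trans (ler_normD _ _))// addrC lerD2l.
Qed.

(** Times at most 1 keep the rates above 1 / (4 (s + 1)), hence a Gaussian decay common to all
    times. *)
Lemma radial_profile_le k z : 0 <= z ->
  `|radial_profile k z| <= \int[mu]_t dom k 0 t * expR (- ((4 * (s + 1))^-1 * z)).
Proof.
move=> z0.
apply: (le_trans (le_normr_Rintegral measurableT (integrable_profile k z))).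
rewrite -RintegralZr//; last exact: (integrableZl measurableT _ intw).
apply: le_Rintegral => //.
- exact: integrable_norm (integrable_profile k z).
- apply: eq_integrable (integrableZl measurableT (expR (- ((4 * (s + 1))^-1 * z)))
    (integrableZl measurableT (peak n s * (4 * s)^-1 ^+ k * expR ((4 * s)^-1 * 0)) intw)) => //.
  by move=> t _; rewrite /= /dom -!EFinM mulrC.
move=> t _; have [w0|/w_supp/andP[t0 t1]] := eqVneq (w t) 0.
  by rewrite /dom w0 !mul0r mulr0 normr0 mul0r.
have := @profile_dom k 0 t 0; rewrite normr0 lexx mulr0 oppr0 expR0 mulr1 => /(_ isT) h.
rewrite mulrA normrM (ger0_norm (expR_ge0 _)).
rewrite ler_pM// ?expR_ge0// ler_expR lerN2 ler_wpM2r// b_ge//.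
Qed.

Definition gauss_coord i y : R := y ord0 i - x ord0 i.

(** A class closed under partial derivatives, by the chain and product rules, whose members all
    decay faster than any power. Induction over it gives the Schwartz bounds with no formula for
    iterated derivatives. *)
Inductive gauss_class : ('rV[R]_n -> R) -> Prop :=
| Gprofile k : gauss_class (fun y => radial_profile k (sqn (y - x)))
| Gadd u v : gauss_class u -> gauss_class v -> gauss_class (u + v)
| Gcoord i u : gauss_class u -> gauss_class (gauss_coord i * u)
| Gscale c u : gauss_class u -> gauss_class (c *: u).

Lemma differentiable_gauss_coord i y : differentiable (gauss_coord i) y.
Proof. by apply: differentiableB; [exact: differentiable_coord|exact: differentiable_cst]. Qed.

Lemma derive_gauss_coord i j y : 'D_(delta_mx ord0 j) (gauss_coord i) y = (i == j)%:R.
Proof.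
apply: cvg_lim => //; apply: cvg_near_cst; near=> h.
have h0 : h != 0 by near: h; exact: nbhs_dnbhs_neq.
rewrite /gauss_coord /= !mxE eqxx /=.
have -> : h * (i == j)%:R + y ord0 i - x ord0 i - (y ord0 i - x ord0 i) = h * (i == j)%:R by ring.
by rewrite /GRing.scale/= mulKf.
Unshelve. all: by end_near. Qed.

Lemma sqn_gauss_coord : (fun y => sqn (y - x)) = \sum_(i < n) (gauss_coord i * gauss_coord i).
Proof.
apply/funext => y; rewrite fct_sumE /sqn /dotp; apply: eq_bigr => i _.
by rewrite /gauss_coord !mxE.
Qed.

Lemma differentiable_sqn y : differentiable (fun y => sqn (y - x)) y.
Proof.
rewrite sqn_gauss_coord; apply: differentiable_sum => i.
by apply: differentiableM; exact: differentiable_gauss_coord.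
Qed.

Lemma derive_sqn i y : 'D_(delta_mx ord0 i) (fun y => sqn (y - x)) y = 2 * gauss_coord i y.
Proof.
have dc j z : derivable (gauss_coord j) z (delta_mx ord0 i).
  exact/diff_derivable/differentiable_gauss_coord.
rewrite sqn_gauss_coord derive_sum; last by move=> j; apply: derivableM.
rewrite (bigD1 i)//= big1 ?addr0; last first.
  by move=> j ji; rewrite deriveM// derive_gauss_coord (negbTE ji) scaler0 addr0.
by rewrite deriveM// derive_gauss_coord eqxx /GRing.scale/= mulr1 -mulr2n mulr_natl.
Qed.

Lemma differentiable_profile k z : differentiable (radial_profile k) z.
Proof. by apply/derivable1_diffP; have [] := is_derive_radial_profile k z. Qed.

Lemma differentiable_radial k y : differentiable (fun y => radial_profile k (sqn (y - x))) y.
Proof.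
apply: (differentiable_comp (f := fun y => sqn (y - x)) (g := radial_profile k)).
  exact: differentiable_sqn.
exact: differentiable_profile.
Qed.

Lemma derive_radial k i y : 'D_(delta_mx ord0 i) (fun y => radial_profile k (sqn (y - x))) y =
  2 * (gauss_coord i y * radial_profile k.+1 (sqn (y - x))).
Proof.
rewrite deriveE; last exact: differentiable_radial.
rewrite (_ : (fun y => radial_profile k (sqn (y - x))) = radial_profile k \o (fun y => sqn (y - x)))//.
rewrite diff_comp; [|exact: differentiable_sqn|exact: differentiable_profile].
rewrite /= -(deriveE _ (differentiable_sqn y)).
rewrite derive_sqn diff1E; last exact: differentiable_profile.
rewrite derive1E; have [_ ->] := is_derive_radial_profile k (sqn (y - x)).
by rewrite /GRing.scale/= mulrA.
Qed.

Lemma gauss_class_differentiable u : gauss_class u -> forall y, differentiable u y.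
Proof.
elim=> [k|u1 u2 _ IH1 _ IH2|i u1 _ IH1|c u1 _ IH1] y.
- exact: differentiable_radial.
- exact: differentiableD.
- by apply: differentiableM => //; exact: differentiable_gauss_coord.
- exact: differentiableZ.
Qed.

Lemma gauss_class_derive u i : gauss_class u ->
  gauss_class ('D_(delta_mx ord0 i) u).
Proof.
have dv u1 y : gauss_class u1 -> derivable u1 y (delta_mx ord0 i).
  by move=> /gauss_class_differentiable /(_ y); exact: diff_derivable.
elim=> [k|u1 u2 G1 IH1 G2 IH2|j u1 G1 IH1|c u1 G1 IH1].
- have -> : 'D_(delta_mx ord0 i) (fun y => radial_profile k (sqn (y - x))) =
      2 *: (gauss_coord i * (fun y => radial_profile k.+1 (sqn (y - x)))).
    by apply/funext => y; rewrite derive_radial.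
  by apply: Gscale; apply: Gcoord; exact: Gprofile.
- have -> : 'D_(delta_mx ord0 i) (u1 + u2) =
      'D_(delta_mx ord0 i) u1 + 'D_(delta_mx ord0 i) u2.
    by apply/funext => y; rewrite deriveD//; exact: dv.
  exact: Gadd.
- have -> : 'D_(delta_mx ord0 i) (gauss_coord j * u1) =
      gauss_coord j * 'D_(delta_mx ord0 i) u1 + (j == i)%:R *: u1.
    apply/funext => y; rewrite deriveM; last exact: dv.
      by rewrite derive_gauss_coord /GRing.scale/= [u1 y * _]mulrC.
    exact/diff_derivable/differentiable_gauss_coord.
  by apply: Gadd; [exact: Gcoord|exact: Gscale].
- have -> : 'D_(delta_mx ord0 i) (c *: u1) = c *: 'D_(delta_mx ord0 i) u1.
    by apply/funext => y; rewrite deriveZ//; exact: dv.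
  exact: Gscale.
Qed.

Lemma coord_le_norm i y : `|gauss_coord i y| <= `|y - x|.
Proof.
rewrite /gauss_coord; have -> : y ord0 i - x ord0 i = (y - x) ord0 i by rewrite !mxE.
rewrite [leRHS]/Num.norm/= mx_normrE.
exact: (le_bigmax _ (fun ij : 'I_1 * 'I_n => `|(y - x) ij.1 ij.2|) (ord0, i)).
Qed.

Lemma norm_le_sqn y : `|y - x| ^+ 2 <= sqn (y - x).
Proof.
rewrite [X in X ^+ 2]/Num.norm/=.
have [->|/mx_norm_neq0[[i j] ->]] := eqVneq (mx_norm (y - x)) 0.
  by rewrite expr0n/= sqn_ge0.
rewrite (ord1 i)/= real_normK ?num_real// /sqn /dotp (bigD1 j)//= -expr2 lerDl.
by apply: sumr_ge0 => k _; rewrite -expr2 sqr_ge0.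
Qed.

Lemma poly_gauss_bounded k c : 0 < c -> exists M : R, forall r, 0 <= r ->
  (1 + r) ^+ k * expR (- (c * r ^+ 2)) <= M.
Proof.
move=> c0; have k0 : 0 < k.+1%:R :> R by rewrite ltr0n.
(* Chosen so that K (1 + c r^2 / (k+1)) >= 2 + r^2 >= 1 + r. The k-th power then costs only the
   fraction k / (k+1) of the exponent; k+1 instead of k avoids dividing by 0. *)
pose K := 2 + k.+1%:R / c; exists (K ^+ k) => r r0.
have K0 : 0 <= K by rewrite addr_ge0// divr_ge0// ltW.
have h : 1 + r <= K * expR (c / k.+1%:R * r ^+ 2).
  apply: (@le_trans _ _ (K * (1 + c / k.+1%:R * r ^+ 2))); last first.
    by rewrite ler_wpM2l// expR_ge1Dx.
  rewrite /K mulrDl mulrDr.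
  have -> : k.+1%:R / c * (1 + c / k.+1%:R * r ^+ 2) = k.+1%:R / c + r ^+ 2.
    by field; rewrite !gt_eqF.
  have : 0 <= k.+1%:R / c by rewrite divr_ge0// ltW.
  have : 0 <= c / k.+1%:R * r ^+ 2 by rewrite mulr_ge0 ?sqr_ge0// divr_ge0// ltW.
  have : 0 <= (r - 1) ^+ 2 by exact: sqr_ge0.
  move: (_ / c) (_ * r ^+ 2) => A B; nra.
rewrite expRN ler_pdivrMr ?expR_gt0//.
apply: (@le_trans _ _ ((K * expR (c / k.+1%:R * r ^+ 2)) ^+ k)).
  by rewrite lerXn2r ?nnegrE ?addr_ge0// mulr_ge0 ?expR_ge0.
rewrite exprMn ler_wpM2l ?exprn_ge0// -expRM_natl ler_expR.
rewrite mulrA ler_wpM2r ?sqr_ge0// mulrCA ger_pMr// ler_pdivrMr// mul1r ler_nat//.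
Qed.

(** Each coordinate factor costs one power of 1 + |y - x|, so the induction carries all the
    exponents k together. *)
Lemma gauss_class_decay u k : gauss_class u ->
  exists M, forall y, (1 + `|y - x|) ^+ k * `|u y| <= M.
Proof.
move=> Gu; elim: Gu k => [j|u1 u2 G1 IH1 G2 IH2|j u1 G1 IH1|c u1 G1 IH1] k.
- have c0 : 0 < (4 * (s + 1))^-1 by rewrite invr_gt0 mulr_gt0// addr_gt0.
  have [M hM] := poly_gauss_bounded k c0.
  exists (\int[mu]_t dom j 0 t * M) => y.
  have D0 : 0 <= \int[mu]_t dom j 0 t.
    apply: Rintegral_ge0 => t _; rewrite !mulr_ge0 ?peak_ge0 ?expR_ge0 ?exprn_ge0//.
    by rewrite invr_ge0 mulr_ge0// ltW.
  rewrite (@le_trans _ _ ((1 + `|y - x|) ^+ k * (\int[mu]_t dom j 0 t * expR (- ((4 * (s + 1))^-1 * `|y - x| ^+ 2)))))//.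
    rewrite ler_wpM2l ?exprn_ge0 ?addr_ge0//.
    rewrite (le_trans (radial_profile_le _ (sqn_ge0 _)))// ler_wpM2l// ler_expR lerN2.
    by rewrite ler_wpM2l ?norm_le_sqn// ltW.
  by rewrite mulrCA ler_wpM2l// hM.
- have [M1 h1] := IH1 k; have [M2 h2] := IH2 k; exists (M1 + M2) => y.
  rewrite (le_trans _ (lerD (h1 y) (h2 y)))// -mulrDr ler_wpM2l ?exprn_ge0 ?addr_ge0//.
  exact: ler_normD.
- have [M h] := IH1 k.+1; exists M => y; rewrite (le_trans _ (h y))//.
  rewrite exprSr -mulrA ler_wpM2l ?exprn_ge0 ?addr_ge0// normrM ler_wpM2r//.
  by rewrite (le_trans (coord_le_norm j y))// lerDr.
- have [M h] := IH1 k; exists (`|c| * M) => y.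
  by rewrite normrM mulrCA ler_wpM2l.
Qed.

Lemma gauss_class_partials u (l : seq 'I_n) : gauss_class u -> gauss_class (partials l u).
Proof. by move=> Gu; elim: l => //= i l IH; exact: gauss_class_derive. Qed.

Lemma gauss_class_rschwartz u : gauss_class u -> rschwartz u.
Proof.
move=> Gu l; have Gp := gauss_class_partials l Gu.
split=> [|k]; first exact: gauss_class_differentiable.
have [M h] := gauss_class_decay k Gp; exists ((1 + `|x|) ^+ k * M) => y.
(* The weight is moved from the origin to the centre x by |y| <= (1 + |x|) (1 + |y - x|). *)
rewrite (@le_trans _ _ ((1 + `|x|) ^+ k * ((1 + `|y - x|) ^+ k * `|partials l u y|)))//.
  rewrite mulrA ler_wpM2r// -exprMn lerXn2r ?nnegrE ?mulr_ge0 ?addr_ge0//.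
  have : `|y| <= `|y - x| + `|x| by rewrite -{1}(subrK x y) ler_normD.
  have : 0 <= `|x| * `|y - x| by rewrite mulr_ge0.
  by nra.
by rewrite ler_wpM2l// exprn_ge0// addr_ge0.
Qed.

Lemma schwartz_mix : schwartz (fun y => real_complex R (mix w s x y)).
Proof.
split => /=.
  rewrite (_ : (fun y => _) = fun y => radial_profile 0 (sqn (y - x))).
    by apply: gauss_class_rschwartz; exact: Gprofile.
  apply/funext => y; apply: eq_Rintegral => t _.
  by rewrite expr0 mul1r /heat /gaussN mulrA.
(* The imaginary part is 0, which is a member of the class as a multiple of any other. *)
rewrite (_ : (fun y => _) = 0 *: (fun y => radial_profile 0 (sqn (y - x)))).
  by apply: gauss_class_rschwartz; apply: Gscale; exact: Gprofile.
by apply/funext => y; rewrite /= scale0r.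
Qed.

End schwartz_mixture.

(** * The heat regularizations bounded by a Riesz-type potential *)

Section representation.
Context {R : realType} (n : nat).
Local Notation Rn := 'rV[R]_n.
Local Notation mu := lebesgue_measure.
Local Notation lineR := (measurableTypeR R).
Local Notation leb := (lebesgue_rV n).
Implicit Types (x y : Rn) (f h K : Rn -> R).

Lemma low_weight_supp (e t : R) : low_weight e t != 0 -> 0 < t <= 1.
Proof.
by rewrite /low_weight indicE mem_setE in_itv/=; case: (_ && _) => //; rewrite mul0r eqxx.
Qed.

Lemma fraclap_mix_identity (gamma s : R) (phi g : Rn -> R[i]) x :
  0 < gamma -> gamma < 2 -> 0 < s -> is_fraclap gamma phi g ->
  cintegral (fun y => phi y * real_complex R (Gam (gamma / 2) * heat s x y -
    (Gam (1 - gamma / 2))^-1 * mix (high_weight (gamma / 2)) s x y)) =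
  cintegral (fun y => g y * real_complex R (mix (low_weight (gamma / 2)) s x y)).
Proof.
move=> g0 g2 s0 fl; have e0 : 0 < gamma / 2 by rewrite divr_gt0.
have sch := schwartz_mix x (measurable_low_weight (gamma / 2)) (low_weight_ge0 (gamma / 2))
  (@low_weight_supp (gamma / 2)) (integrable_low_weight e0) s0.
rewrite -(fl _ sch); congr cintegral; apply/funext => y.
by rewrite fraclap_mix.
Qed.

Lemma norm_le_powR (a p : R) : 1 <= p -> `|a| <= 1 + `|a| `^ p.
Proof.
move=> p1; have [a1|a1] := leP `|a| 1; first by rewrite (le_trans a1)// lerDl powR_ge0.
rewrite (@le_trans _ _ (`|a| `^ p))//; last by rewrite lerDr.
by rewrite -{1}(powRr1 (normr_ge0 a)) ler_powR// ltW.
Qed.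

(** By |f| <= 1 + |f|^p, a kernel that is both bounded and integrable pairs with the unit ball of
    L^p: the constant 1 is charged to its mass, and |f|^p to its supremum. *)
Lemma integral_mul_kernel_le f K (p M : R) : 1 <= p ->
  measurable_fun setT f -> measurable_fun setT K ->
  (forall y, 0 <= K y <= M) -> (\int[leb]_y (`|f y| `^ p)%:E <= 1)%E ->
  (\int[leb]_y (`|f y| * K y)%:E <= \int[leb]_y (K y)%:E + M%:E)%E.
Proof.
move=> p1 mf mK K0 fp.
have M0 : 0 <= M by have /andP[/le_trans h1 /h1] := K0 0.
have mfp : measurable_fun setT (fun y => `|f y| `^ p).
  by apply: (measurableT_comp (measurable_powR p)); exact: measurableT_comp.
apply: (@le_trans _ _ (\int[leb]_y ((K y)%:E + M%:E * (`|f y| `^ p)%:E))%E).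
  apply: ge0_le_integral => //.
  - by move=> y _; rewrite lee_fin mulr_ge0//; have /andP[] := K0 y.
  - by apply/measurable_EFinP; apply: measurable_funM => //; exact: measurableT_comp.
  - apply: emeasurable_funD; first exact/measurable_EFinP.
    by apply: measurable_funeM; exact/measurable_EFinP.
  move=> y _; rewrite -EFinM -EFinD lee_fin; have /andP[k0 kM] := K0 y.
  have := norm_le_powR (f y) p1; have := powR_ge0 `|f y| p; move: (_ `^ p) => A A0 h.
  by rewrite (@le_trans _ _ ((1 + A) * K y))// ?ler_wpM2r// mulrDl mul1r lerD2l mulrC ler_wpM2r.
rewrite ge0_integralD//; first last.
- by apply: measurable_funeM; exact/measurable_EFinP.
- by move=> y _; rewrite -EFinM lee_fin mulr_ge0// powR_ge0.
- exact/measurable_EFinP.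
- by move=> y _; rewrite lee_fin; have /andP[] := K0 y.
rewrite leeD2l// ge0_integralZl//; last exact/measurable_EFinP.
by rewrite -[leRHS]mule1 lee_pmul// ?lee_fin// integral_ge0// => y _; rewrite lee_fin powR_ge0.
Qed.

Lemma integrable_mul_kernel f K (p M : R) : 1 <= p ->
  measurable_fun setT f -> measurable_fun setT K ->
  (forall y, 0 <= K y <= M) -> (\int[leb]_y (`|f y| `^ p)%:E <= 1)%E ->
  (\int[leb]_y (K y)%:E < +oo)%E ->
  leb.-integrable setT (fun y => (f y * K y)%:E).
Proof.
move=> p1 mf mK K0 fp iK; apply/integrableP; split.
  by apply/measurable_EFinP; exact: measurable_funM.
rewrite (_ : (\int[leb]_y _)%E = \int[leb]_y (`|f y| * K y)%:E)%E; last first.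
  apply: eq_integral => y _; rewrite abse_EFin normrM (ger0_norm (_ : 0 <= K y))//.
  by have /andP[] := K0 y.
by rewrite (le_lt_trans (integral_mul_kernel_le p1 mf mK K0 fp))// lte_add_pinfty// ltry.
Qed.

(** The right-hand side is an extended integral: when it is infinite the bound is trivial, whatever
    value the real integral takes by default. *)
Lemma norm_Rintegral_le h : measurable_fun setT h ->
  ((`|\int[leb]_y h y|)%:E <= \int[leb]_y `|h y|%:E)%E.
Proof.
move=> mh; have [hoo|hoo] := ltP (\int[leb]_y `|h y|%:E)%E +oo%E; last first.
  by rewrite (le_trans (leey _)).
have ih : leb.-integrable setT (fun y => (h y)%:E).
  by apply/integrableP; split=> //; exact/measurable_EFinP.
rewrite (le_trans (_ : _ <= (\int[leb]_y `|h y|)%:E)%E)//.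
  by rewrite lee_fin; exact: le_normr_Rintegral.
by rewrite fineK// integrable_fin_num//; exact: integrable_norm ih.
Qed.

Section mixture_mass.
Variables (w : R -> R) (s : R).
Hypotheses (mw : measurable_fun [set: lineR] w) (w_ge0 : forall t, 0 <= w t)
  (w_eq0 : forall t, t <= 0 -> w t = 0)
  (intw : mu.-integrable [set: lineR] (fun t => (w t)%:E)) (s0 : 0 < s).

Lemma measurable_mix_r x : measurable_fun setT (mix w s x).
Proof.
apply: (measurableT_comp (f := fun z : Rn * Rn => mix w s z.1 z.2) (g := fun y => (x, y))).
  exact: measurable_mix.
exact: measurable_pair1.
Qed.

Lemma integral_mix x : (\int[leb]_y (mix w s x y)%:E = \int[mu]_t (w t)%:E)%E.
Proof.
transitivity (\int[leb]_y \int[mu]_t (w t * heat (s + t) x y)%:E)%E.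
  by apply: eq_integral => y _; rewrite EFin_mix.
rewrite tonelli; first last.
- by move=> y t; rewrite lee_fin mulr_ge0// heat_ge0.
- apply/measurable_EFinP; apply: measurable_funM; first exact: (measurableT_comp mw).
  by apply: measurable_heat_comp => //; exact: measurable_funD.
apply: eq_integral => t _; have [t0|t0] := leP t 0.
  by rewrite w_eq0// integral0_eq// => y _; rewrite mul0r.
under eq_integral do rewrite EFinM.
rewrite -mul_ge0_integral//.
- by rewrite integral_heat ?mule1// addr_gt0.
- by apply/measurable_EFinP; exact: measurable_heat.
- by move=> y; rewrite lee_fin heat_ge0.
Qed.

Lemma mix_le (c : R) x y : 0 < c -> (forall t, w t != 0 -> c <= s + t) ->
  mix w s x y <= peak n c * \int[mu]_t w t.
Proof.
move=> c0 wc; rewrite /mix -RintegralZl//; apply: le_Rintegral => //.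
- exact: integrable_mix.
- exact: (integrableZl measurableT _ intw).
move=> t _; have [->|/wc ct] := eqVneq (w t) 0; first by rewrite mul0r mulr0.
rewrite mulrC ler_wpM2r// (@le_trans _ _ (peak n (s + t)))//.
  by rewrite heat_le// (le_trans (ltW c0)).
exact: peak_anti.
Qed.

End mixture_mass.

(** Contribution of the remainder. Its mass is the mass W of the high weight, and its supremum is at
    most [peak n 1] times W since its times exceed 1; the sum W (1 + [peak n 1]) carries the Gamma
    factors of [fraclap_mix]. *)
Definition low_constant (gamma : R) : R :=
  (Gam (1 - gamma / 2))^-1 * (\int[mu]_t high_weight (gamma / 2) t * (1 + peak n 1)) / Gam (gamma / 2).

(* Real and imaginary parts decouple because the test functions are real. *)
Lemma convolution_bound_real (gamma p s : R) f h x :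
  0 < gamma -> gamma < 2 -> 0 < s -> 1 <= p ->
  measurable_fun setT f -> measurable_fun setT h ->
  (\int[leb]_y (`|f y| `^ p)%:E <= 1)%E ->
  \int[leb]_y (f y * (Gam (gamma / 2) * heat s x y -
    (Gam (1 - gamma / 2))^-1 * mix (high_weight (gamma / 2)) s x y)) =
  \int[leb]_y (h y * mix (low_weight (gamma / 2)) s x y) ->
  ((`|\int[leb]_y (f y * heat s x y)|)%:E <= (low_constant gamma)%:E +
    (Gam (gamma / 2))^-1%:E * \int[leb]_y (`|h y| * mix (low_weight (gamma / 2)) s x y)%:E)%E.
Proof.
move=> g0 g2 s0 p1 mf mh fp.
have e0 : 0 < gamma / 2 by rewrite divr_gt0.
have e1 : gamma / 2 < 1 by rewrite ltr_pdivrMr// mul1r.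
rewrite /low_constant; set e := gamma / 2 in e0 e1 *.
have Ga0 : 0 < Gam e by rewrite Gam_gt0// ltW.
have Gb0 : 0 < Gam (1 - e) by rewrite Gam_gt0 ?subr_gt0// gerBl ltW.
have ml := @measurable_low_weight R e; have mhw := @measurable_high_weight R e.
have l_ge0 := @low_weight_ge0 R e; have h_ge0 := @high_weight_ge0 R e.
have il := integrable_low_weight e0; have ih := integrable_high_weight e0 e1.
have ln := @low_weight_eq0 R e; have hn := @high_weight_eq0 R e.
have W0 : 0 <= \int[mu]_t high_weight e t by apply: Rintegral_ge0.
have WE : (\int[mu]_t (high_weight e t)%:E = (\int[mu]_t high_weight e t)%:E)%E.
  by rewrite fineK// integrable_fin_num.
move: (\int[mu]_t high_weight e t) W0 WE => W W0 WE.
have iK1 : (\int[leb]_y (heat s x y)%:E < +oo)%E by rewrite integral_heat// ltry.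
have iK2 : (\int[leb]_y (mix (high_weight e) s x y)%:E < +oo)%E.
  by rewrite integral_mix// WE ltry.
have K1 y : 0 <= heat s x y <= peak n s by rewrite heat_ge0 heat_le// ltW.
have K2 y : 0 <= mix (high_weight e) s x y <= peak n 1 * W.
  rewrite mix_ge0//=.
  rewrite (_ : W = \int[mu]_t high_weight e t); last by rewrite /Rintegral WE.
  apply: mix_le => // t; rewrite /high_weight indicE mem_setE in_itv/= andbT.
  by case: ltP => [t1 _|_]; [rewrite (le_trans (ltW t1))// lerDr ltW|rewrite mul0r eqxx].
have m1 := @measurable_heat R n s x.
have m2 := measurable_mix_r mhw h_ge0 hn ih s0 x.
have m3 := measurable_mix_r ml l_ge0 ln il s0 x.
have i1 := integrable_mul_kernel p1 mf m1 K1 fp iK1.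
have i2 := integrable_mul_kernel p1 mf m2 K2 fp iK2.
set A := \int[leb]_y (f y * heat s x y).
pose B := \int[leb]_y (f y * mix (high_weight e) s x y).
have -> : \int[leb]_y (f y * (Gam e * heat s x y - (Gam (1 - e))^-1 * mix (high_weight e) s x y)) =
    Gam e * A - (Gam (1 - e))^-1 * B.
  rewrite /A /B -!RintegralZl// -RintegralB//; last 2 first.
  - exact: (integrableZl measurableT _ i1).
  - exact: (integrableZl measurableT _ i2).
  by apply: eq_Rintegral => y _; rewrite mulrBr !(mulrCA (f y)).
set H := \int[leb]_y (h y * mix (low_weight e) s x y) => EH.
have AE : A = (Gam e)^-1 * ((Gam (1 - e))^-1 * B + H) by rewrite -EH addrC subrK mulKf// gt_eqF.
have HB : ((`|H|)%:E <= \int[leb]_y (`|h y| * mix (low_weight e) s x y)%:E)%E.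
  rewrite (le_trans (norm_Rintegral_le (measurable_funM mh m3)))// le_eqVlt.
  apply/orP; left; apply/eqP; apply: eq_integral => y _.
  by rewrite normrM (ger0_norm (mix_ge0 _ _ _ _)).
have BB : `|B| <= W * (1 + peak n 1).
  rewrite -lee_fin (le_trans (norm_Rintegral_le (measurable_funM mf m2)))//.
  rewrite (_ : (\int[leb]_y _)%E = \int[leb]_y (`|f y| * mix (high_weight e) s x y)%:E)%E; last first.
    by apply: eq_integral => y _; rewrite normrM (ger0_norm (mix_ge0 _ _ _ _)).
  rewrite (le_trans (integral_mul_kernel_le p1 mf m2 K2 fp))//.
  by rewrite integral_mix// WE -EFinD lee_fin mulrDr mulr1 (mulrC W (peak _ _)).
apply: (@le_trans _ _ ((Gam (1 - e))^-1 * (W * (1 + peak n 1)) / Gam e + (Gam e)^-1 * `|H|)%:E).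
  rewrite lee_fin AE normrM (gtr0_norm (_ : 0 < (Gam e)^-1)) ?invr_gt0//.
  rewrite (mulrC _ (Gam e)^-1) -mulrDr ler_wpM2l ?invr_ge0 ?(ltW Ga0)//.
  rewrite (le_trans (ler_normD _ _))// lerD2r normrM (gtr0_norm (_ : 0 < (Gam (1 - e))^-1)) ?invr_gt0//.
  by rewrite ler_wpM2l// invr_ge0 ltW.
by rewrite EFinD [X in (_ + X <= _)%E]EFinM leeD2l// lee_wpmul2l// lee_fin invr_ge0 ltW.
Qed.

(** The two terms come from the times t <= |y - x|^2 and t > |y - x|^2 in [mix_le_riesz]. *)
Definition kernel_constant (e : R) : R :=
  (4 * n%:R) `^ (n%:R / 2) * (\int[mu]_t low_weight e t) + (n%:R / 2 - e)^-1.

Lemma peak_le_powR (t : R) : 0 < t -> peak n t <= t `^ (- (n%:R / 2)).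
Proof.
move=> t0; rewrite /peak -powR_mulrn ?invr_ge0 ?sqrtr_ge0//.
rewrite -powR12_sqrt ?mulr_ge0 ?pi_ge0 ?(ltW t0)// -powRN -powRrM mulNr.
rewrite !powRN lef_pV2 ?posrE ?powR_gt0 ?mulr_gt0 ?pi_gt0//.
rewrite [X in _ <= _ `^ X]mulrC ge0_ler_powR ?nnegrE ?divr_ge0 ?mulr_ge0 ?pi_ge0 ?(ltW t0)//.
rewrite ler_peMl ?(ltW t0)//.
have := @pi_ge2 R; lra.
Qed.

(** With v = q / (4 n u), the exponential e^(q / (8 u)) is the power n/2 of e^v, and e^v >= v
    cancels the singularity u^(-n/2). *)
Lemma peak_gauss_le (u q : R) : (0 < n)%N -> 0 < u -> 0 < q ->
  peak n u * expR (- (q / (8 * u))) <= (4 * n%:R) `^ (n%:R / 2) * q `^ (- (n%:R / 2)).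
Proof.
move=> n0 u0 q0; have n0' : 0 < n%:R :> R by rewrite ltr0n.
rewrite (@le_trans _ _ (u `^ (- (n%:R / 2)) * expR (- (q / (8 * u)))))//.
  by rewrite ler_wpM2r ?expR_ge0// peak_le_powR.
rewrite expRN ler_pdivrMr ?expR_gt0//.
have -> : expR (q / (8 * u)) = (expR (q / (4 * n%:R * u))) `^ (n%:R / 2).
  by rewrite -expRM; congr expR; field; rewrite !gt_eqF.
have hN z : 0 < z -> z `^ (- (n%:R / 2)) = z^-1 `^ (n%:R / 2).
  by move=> z0; rewrite -[z^-1]powR_inv1 ?(ltW z0)// -powRrM mulN1r.
have q1 : 0 <= q^-1 by rewrite invr_ge0 ltW.
have u1 : 0 <= u^-1 by rewrite invr_ge0 ltW.
have Kn : 0 <= 4 * n%:R :> R by rewrite mulr_ge0.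
rewrite !hN// -powRM// -powRM ?mulr_ge0 ?expR_ge0//.
rewrite ge0_ler_powR ?nnegrE ?divr_ge0 ?mulr_ge0 ?expR_ge0//.
have h := expR_ge1Dx (q / (4 * n%:R * u)).
rewrite (@le_trans _ _ (4 * n%:R / q * (q / (4 * n%:R * u))))//.
  by rewrite le_eqVlt; apply/orP; left; apply/eqP; field; rewrite !gt_eqF.
by rewrite ler_wpM2l ?mulr_ge0// (le_trans _ h)// lerDr.
Qed.

Lemma sqn_gt0 x y : y != x -> 0 < sqn (y - x).
Proof.
move=> yx; rewrite (lt_le_trans _ (norm_le_sqn x y))// exprn_gt0// normr_gt0 subr_eq0//.
Qed.

(** Half of the Gaussian exponent is kept as the decay e^(-|y - x|^2 / 16), as s + t <= 2. The other
    half compensates the peak for small times, and for large times the peak is integrable by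
    itself. *)
Lemma mix_le_riesz (gamma s : R) x y : (0 < n)%N -> 0 < gamma -> gamma < n%:R -> 0 < s -> s <= 1 ->
  y != x ->
  mix (low_weight (gamma / 2)) s x y <=
  kernel_constant (gamma / 2) * (sqn (y - x) `^ (- ((n%:R - gamma) / 2)) * expR (- (sqn (y - x) / 16))).
Proof.
move=> n0 g0 gn s0 s1 yx; have q0 := sqn_gt0 yx.
have e0 : 0 < gamma / 2 by rewrite divr_gt0.
have d0 : 0 < n%:R / 2 - gamma / 2 by rewrite subr_gt0 ltr_pM2r.
have -> : (n%:R - gamma) / 2 = n%:R / 2 - gamma / 2 by rewrite mulrBl.
rewrite /kernel_constant; set e := gamma / 2 in e0 d0 *; set nu := n%:R / 2 in d0 *.
set C := (4 * n%:R) `^ nu; set E := expR (- (sqn (y - x) / 16)).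
have C0 : 0 <= C by exact: powR_ge0.
have il := integrable_low_weight e0.
have WE : (\int[mu]_t (low_weight e t)%:E = (\int[mu]_t low_weight e t)%:E)%E.
  by rewrite fineK// integrable_fin_num.
rewrite -lee_fin (EFin_mix (measurable_low_weight e) (low_weight_ge0 e) (@low_weight_eq0 R e) il s0).
move: (\int[mu]_t low_weight e t) WE => W WE.
set q := sqn (y - x) in q0 E *.
(* With q = |y - x|^2, [F1] and [F2] carry the majorants for t <= q and t > q. Both integrate to a
   multiple of q^(e - nu), the Riesz singularity. *)
pose F1 (t : lineR) := ((\1_(`]0%R, q]) t)%:E * (t `^ (e - 1))%:E)%E.
pose F2 (t : lineR) := ((\1_(`]q, +oo[) t)%:E * (t `^ (- (nu - e) - 1))%:E)%E.
have m1 : measurable_fun setT F1.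
  by apply: emeasurable_funM; apply/measurable_EFinP; [exact: measurable_indic|exact: measurable_powR].
have m2 : measurable_fun setT F2.
  by apply: emeasurable_funM; apply/measurable_EFinP; [exact: measurable_indic|exact: measurable_powR].
have F10 t : (0 <= F1 t)%E by rewrite mule_ge0 ?lee_fin ?powR_ge0.
have F20 t : (0 <= F2 t)%E by rewrite mule_ge0 ?lee_fin ?powR_ge0.
have I1 : (\int[mu]_t F1 t = (q `^ e * W)%:E)%E.
  transitivity (\int[mu]_(x in `]0%R, q]) (x `^ (e - 1))%:E)%E.
    by rewrite [RHS]integral_mkcond; apply: eq_integral => t _; rewrite epatch_indic/= muleC.
  by rewrite integral_powR0c// WE -EFinM.
have I2 : (\int[mu]_t F2 t = (q `^ (- (nu - e)) / (nu - e))%:E)%E.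
  rewrite -integral_powRcy// [RHS]integral_mkcond.
  by apply: eq_integral => t _; rewrite epatch_indic/= muleC.
have Cq0 : 0 <= C * q `^ (- nu) by rewrite mulr_ge0// powR_ge0.
apply: (@le_trans _ _ (E%:E * ((C * q `^ (- nu))%:E * \int[mu]_t F1 t + \int[mu]_t F2 t))%E); last first.
  rewrite I1 I2 (_ : (E%:E * _)%E =
    (E * (C * q `^ (- nu) * (q `^ e * W) + q `^ (- (nu - e)) / (nu - e)))%:E)%E//.
  rewrite lee_fin le_eqVlt; apply/orP; left; apply/eqP.
  have -> : q `^ (- (nu - e)) = q `^ (- nu) * q `^ e.
    by rewrite opprB addrC powRD// (gt_eqF q0) implybT.
  by move: (q `^ _) (q `^ _) (_^-1) => a b c; ring.
rewrite mul_ge0_integral// -ge0_integralD//; first last.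
- exact: measurable_funeM.
- by move=> t _; rewrite mule_ge0.
rewrite mul_ge0_integral; first last.
- exact: expR_ge0.
- by move=> t; rewrite adde_ge0// mule_ge0.
- by apply: emeasurable_funD => //; exact: measurable_funeM.
apply: ge0_le_integral => //.
- by move=> t _; rewrite lee_fin mulr_ge0 ?heat_ge0 ?low_weight_ge0.
- apply/measurable_EFinP; apply: measurable_funM; first exact: measurable_low_weight.
  by apply: measurable_heat_comp => //; exact: measurable_funD.
- by apply: measurable_funeM; apply: emeasurable_funD => //; exact: measurable_funeM.
move=> t _; have [w0|/low_weight_supp/andP[t0 t1]] := eqVneq (low_weight e t) 0.
  rewrite w0 mul0r; apply: mule_ge0; first by rewrite lee_fin expR_ge0.
  by apply: adde_ge0 => //; apply: mule_ge0.
have wE : low_weight e t = t `^ (e - 1).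
  by rewrite /low_weight indicE mem_setE in_itv/= t0 t1 mul1r.
have u0 : 0 < s + t by rewrite addr_gt0.
have u2 : s + t <= 2 by rewrite (_ : 2 = 1 + 1)// lerD.
(* The exponent q / (4 (s + t)) is twice q / (8 (s + t)), and one of the two copies is at least q /
   16. *)
have hE : heat (s + t) x y <= E * (peak n (s + t) * expR (- (q / (8 * (s + t))))).
  rewrite /heat mulrCA ler_wpM2l ?peak_ge0// /gaussN -expRD ler_expR -/q.
  have -> : - ((4 * (s + t))^-1 * q) = - (q / (8 * (s + t))) - (q / (8 * (s + t))).
    by field; rewrite gt_eqF.
  rewrite lerD2r lerN2 ler_wpM2l ?(ltW q0)// lef_pV2 ?posrE ?mulr_gt0//.
  by have := ler_wpM2l (ler0n R 8) u2; rewrite -natrM.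
rewrite wE /F1 /F2 !indicE !mem_setE !in_itv/= t0/= andbT.
apply: (@le_trans _ _ (E * (t `^ (e - 1) * (peak n (s + t) * expR (- (q / (8 * (s + t)))))))%:E).
  by rewrite lee_fin [leRHS]mulrCA ler_wpM2l ?powR_ge0.
rewrite EFinM lee_wpmul2l ?lee_fin ?expR_ge0//.
have [tq|tq] := leP t q.
  rewrite mul0r addr0 mul1r mulrC ler_wpM2r ?powR_ge0//.
  exact: peak_gauss_le.
rewrite mul0r mulr0 add0r mul1r (_ : - (nu - e) - 1 = (e - 1) + - nu); last by ring.
rewrite [leRHS]powRD ?(gt_eqF t0) ?implybT// ler_wpM2l ?powR_ge0//.
rewrite (@le_trans _ _ (peak n t))//; last exact: peak_le_powR.
rewrite (@le_trans _ _ (peak n (s + t)))//.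
  by rewrite ler_piMr ?peak_ge0// -expR0 ler_expR oppr_le0 divr_ge0 ?(ltW q0)// mulr_ge0// ltW.
by rewrite peak_anti// lerDr ltW.
Qed.

End representation.

(** * Almost everywhere bounds from bounds on the heat regularizations *)

Section heat_pairing.
Context {R : realType} (n : nat).
Local Notation Rn := 'rV[R]_n.
Local Notation mu := lebesgue_measure.
Local Notation leb := (lebesgue_rV n).
Implicit Types (x y : Rn) (A B F f : Rn -> R) (E U Q : set Rn).

Lemma cvg0_near_le (u : (\bar R)^nat) (eps : R) : u @ \oo --> 0%E -> 0 < eps ->
  \forall k \near \oo, (u k <= eps%:E)%E.
Proof.
move=> /fine_cvgP[fu /cvgrPdist_le cu] e0; have {}cu := cu _ e0.
near=> k; have fk : u k \is a fin_num by near: k.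
have h : `|0 - fine (u k)| <= eps by near: k.
by rewrite -(fineK fk) lee_fin (le_trans _ h)// sub0r normrN ler_norm.
Unshelve. all: by end_near. Qed.

Definition nonneg_mfun A : Prop := measurable_fun setT A /\ (forall x, 0 <= A x).

Lemma nonneg_mfun_indic E : measurable E -> nonneg_mfun \1_E.
Proof. by move=> mE; split=> // x; exact: measurable_indic. Qed.

(** The amount of heat that goes from A to B in time s. It is symmetric, and pairing with the
    constant 1 gives the integral. *)
Definition heat_pair s A B : \bar R := (\int[leb]_x \int[leb]_y (A x * B y * heat s x y)%:E)%E.

Lemma measurable_heat_pair s A B : nonneg_mfun A -> nonneg_mfun B ->
  measurable_fun setT (fun z : Rn * Rn => (A z.1 * B z.2 * heat s z.1 z.2)%:E).
Proof.
move=> [mA _] [mB _]; apply/measurable_EFinP; apply: measurable_funM.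
  by apply: measurable_funM; [exact: (measurableT_comp mA)|exact: (measurableT_comp mB)].
exact: measurable_heat_comp.
Qed.

Lemma heat_pair_ge0 s A B x y : nonneg_mfun A -> nonneg_mfun B ->
  (0 <= (A x * B y * heat s x y)%:E)%E.
Proof. by move=> [_ A0] [_ B0]; rewrite lee_fin; apply: mulr_ge0; [exact: mulr_ge0|exact: heat_ge0]. Qed.

Lemma measurable_heat_pair_inner s A B : nonneg_mfun A -> nonneg_mfun B ->
  measurable_fun setT (fun x => \int[leb]_y (A x * B y * heat s x y)%:E)%E.
Proof.
move=> hA hB.
apply: (measurable_integral_r (T1 := Rn) (T2 := Rn) leb
  (f := fun x y => (A x * B y * heat s x y)%:E)).
  exact: measurable_heat_pair.
by move=> x y; exact: heat_pair_ge0.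
Qed.

Lemma measurable_heat_section s A B x : nonneg_mfun A -> nonneg_mfun B ->
  measurable_fun setT (fun y => (A x * B y * heat s x y)%:E).
Proof.
move=> hA hB; apply: (measurableT_comp (f := fun z : Rn * Rn =>
  (A z.1 * B z.2 * heat s z.1 z.2)%:E) (g := fun y => (x, y))).
  exact: measurable_heat_pair.
exact: measurable_pair1.
Qed.

Lemma heat_pairC s A B : nonneg_mfun A -> nonneg_mfun B -> heat_pair s A B = heat_pair s B A.
Proof.
move=> hA hB; rewrite /heat_pair tonelli.
- by apply: eq_integral => x _; apply: eq_integral => y _; rewrite heatC (mulrC (A y)).
- exact: measurable_heat_pair.
- by move=> x y; exact: heat_pair_ge0.
Qed.

Lemma heat_pair1 s A : 0 < s -> nonneg_mfun A -> heat_pair s A (cst 1) = (\int[leb]_x (A x)%:E)%E.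
Proof.
move=> s0 [mA A0]; apply: eq_integral => x _.
transitivity (\int[leb]_y ((A x)%:E * (heat s x y)%:E))%E.
  by apply: eq_integral => y _; rewrite mulr1 EFinM.
rewrite -mul_ge0_integral//.
- by rewrite integral_heat// mule1.
- by apply/measurable_EFinP; exact: measurable_heat.
- by move=> y; rewrite lee_fin heat_ge0.
Qed.

Lemma heat_pair_leD s (c1 c2 : R) A B A1 B1 A2 B2 :
  nonneg_mfun A -> nonneg_mfun B -> nonneg_mfun A1 -> nonneg_mfun B1 ->
  nonneg_mfun A2 -> nonneg_mfun B2 -> 0 <= c1 -> 0 <= c2 ->
  (forall x y, A x * B y <= c1 * (A1 x * B1 y) + c2 * (A2 x * B2 y)) ->
  (heat_pair s A B <= c1%:E * heat_pair s A1 B1 + c2%:E * heat_pair s A2 B2)%E.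
Proof.
move=> hA hB hA1 hB1 hA2 hB2 c10 c20 le.
have m0 := measurable_heat_pair_inner s hA hB.
have m1 := measurable_heat_pair_inner s hA1 hB1.
have m2 := measurable_heat_pair_inner s hA2 hB2.
have p0 x : (0 <= \int[leb]_y (A x * B y * heat s x y)%:E)%E.
  by apply: integral_ge0 => y _; exact: heat_pair_ge0.
have p1 x : (0 <= \int[leb]_y (A1 x * B1 y * heat s x y)%:E)%E.
  by apply: integral_ge0 => y _; exact: heat_pair_ge0.
have p2 x : (0 <= \int[leb]_y (A2 x * B2 y * heat s x y)%:E)%E.
  by apply: integral_ge0 => y _; exact: heat_pair_ge0.
rewrite /heat_pair mul_ge0_integral//.
rewrite [X in (_ <= _ + X)%E]mul_ge0_integral// -ge0_integralD//; first last.
- exact: measurable_funeM.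
- by move=> x _; apply: mule_ge0.
- exact: measurable_funeM.
- by move=> x _; apply: mule_ge0.
apply: ge0_le_integral => //.
  by apply: emeasurable_funD; exact: measurable_funeM.
move=> x _; rewrite mul_ge0_integral//; first last.
- by move=> y; exact: heat_pair_ge0.
- exact: measurable_heat_section.
rewrite [X in (_ <= _ + X)%E]mul_ge0_integral//; first last.
- by move=> y; exact: heat_pair_ge0.
- exact: measurable_heat_section.
rewrite -ge0_integralD//; first last.
- by apply: measurable_funeM; exact: measurable_heat_section.
- by move=> y _; apply: mule_ge0 => //; exact: heat_pair_ge0.
- by apply: measurable_funeM; exact: measurable_heat_section.
- by move=> y _; apply: mule_ge0 => //; exact: heat_pair_ge0.
apply: ge0_le_integral => //.
- by move=> y _; exact: heat_pair_ge0.
- exact: measurable_heat_section.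
- by apply: emeasurable_funD; apply: measurable_funeM; exact: measurable_heat_section.
move=> y _; rewrite -!EFinM -EFinD lee_fin.
have := ler_wpM2r (heat_ge0 s x y) (le x y); rewrite mulrDl !mulrA //.
Qed.

(** Half of the exponent gives a factor 8 s / d, by e^(-v) <= 1/v; the other half is a Gaussian with
    variance doubled, hence the mass 2^(n/2). Here d bounds the squared distance. *)
Lemma heat_off_ball (s d : R) x E : 0 < s -> 0 < d -> measurable E ->
  (forall y, E y -> d <= sqn (y - x)) ->
  (\int[leb]_y (\1_E y * heat s x y)%:E <= (8 * Num.sqrt 2 ^+ n / d * s)%:E)%E.
Proof.
move=> s0 d0 mE Ed; pose c := (8 * s)^-1.
have c0 : 0 < c by rewrite invr_gt0 mulr_gt0.
have pi0 := pi_gt0 R.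
have -> : 8 * Num.sqrt 2 ^+ n / d * s = (8 * s / d * peak n s) * Num.sqrt (pi / c) ^+ n.
  rewrite /peak /c invrK (_ : pi * (8 * s) = 2 * (4 * pi * s)); last by ring.
  rewrite (sqrtrM (4 * pi * s) (ler0n R 2)) exprMn exprVn.
  have : Num.sqrt (4 * pi * s) ^+ n != 0 by rewrite expf_neq0// gt_eqF// sqrt_4pi_gt0.
  move: (Num.sqrt (4 * pi * s) ^+ n) (Num.sqrt 2 ^+ n) => u v u0.
  by field; rewrite u0 gt_eqF.
rewrite EFinM -(integral_gaussN x c0) mul_ge0_integral; first last.
- by rewrite mulr_ge0 ?peak_ge0// divr_ge0 ?mulr_ge0 ?(ltW s0) ?(ltW d0).
- by move=> y; rewrite lee_fin gaussN_ge0.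
- exact: emeasurable_gaussN.
apply: ge0_le_integral => //.
- by move=> y _; rewrite lee_fin mulr_ge0 ?heat_ge0.
- apply/measurable_EFinP; apply: measurable_funM; first exact: measurable_indic.
  exact: measurable_heat.
- by apply: measurable_funeM; exact: emeasurable_gaussN.
move=> y _; rewrite -EFinM lee_fin indicE; have [yE|yE] := boolP (y \in E); last first.
  by rewrite mul0r !mulr_ge0 ?peak_ge0 ?gaussN_ge0 ?invr_ge0 ?(ltW s0) ?(ltW d0).
rewrite mul1r /heat mulrAC [leRHS]mulrC ler_wpM2l ?peak_ge0//.
have {Ed}dq := Ed y (set_mem yE).
have -> : gaussN (4 * s)^-1 x y = expR (- (c * sqn (y - x))) * gaussN c x y.
  by rewrite /gaussN -expRD; congr expR; rewrite /c; field; rewrite gt_eqF.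
rewrite ler_wpM2r ?gaussN_ge0// expRN -[leRHS]invrK lef_pV2 ?posrE ?expR_gt0 ?invr_gt0//; last first.
  by rewrite divr_gt0// mulr_gt0.
rewrite (@le_trans _ _ (c * sqn (y - x)))//.
  by rewrite invf_div /c mulrC ler_wpM2l// ltW.
by rewrite (le_trans _ (expR_ge1Dx _))// lerDr.
Qed.

(** The heat leaking out of E in time 1 / (k + 1) tends to 0. *)
Definition thin E : Prop := forall eps : R, 0 < eps ->
  \forall k \near \oo, (heat_pair (harmonic k) \1_E \1_(~` E) <= eps%:E)%E.

(** A point of U has a ball around it inside U, so that the heat it sends outside is O(s); the total
    heat bounds this by the indicator of U, and dominated convergence applies. *)
Lemma thin_open U : open U -> measurable U -> (leb U < +oo)%E -> thin U.
Proof.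
move=> oU mU Uoo eps e0.
apply: cvg0_near_le e0.
have mUC : measurable (~` U) by exact: measurableC.
have hU := nonneg_mfun_indic mU; have hC := nonneg_mfun_indic mUC.
rewrite -(@integral0 _ _ _ leb setT).
apply: (@dominated_cvg _ _ _ leb setT _ _ _ (fun x => (\1_U x)%:E)) => //.
- by move=> k; exact: measurable_heat_pair_inner.
- move=> x _; rewrite (_ : (fun k => _) = (fun k => (\1_U x)%:E *
      \int[leb]_y (\1_(~` U) y * heat (harmonic k) x y)%:E)%E); last first.
    apply/funext => k; rewrite mul_ge0_integral//.
    + by apply: eq_integral => y _; rewrite -EFinM -mulrA.
    + apply/measurable_EFinP; apply: measurable_funM; first exact: measurable_indic.
      exact: measurable_heat.
    + by move=> y; rewrite lee_fin mulr_ge0// heat_ge0.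
  rewrite indicE; have [xU|xU] := boolP (x \in U); last first.
    by rewrite (_ : (fun k => _) = cst 0%E); [exact: cvg_cst|apply/funext => k; rewrite mul0e].
  have /nbhs_ballP[d /= d0 dU] : nbhs x U by apply: open_nbhs_nbhs; split=> //; exact: set_mem.
  have far y : (~` U) y -> d ^+ 2 <= sqn (y - x).
    move=> yU; rewrite (le_trans _ (norm_le_sqn x y))// lerXn2r ?nnegrE ?(ltW d0)//.
    rewrite leNgt; apply/negP => h; apply: yU; apply: dU.
    by rewrite -ball_normE /= distrC.
  apply: (@squeeze_cvge _ _ _ _ (cst 0%E) _ (fun k => (8 * Num.sqrt 2 ^+ n / d ^+ 2 * harmonic k)%:E)).
  + apply: nearW => k; rewrite mul1e; apply/andP; split.
      by apply: integral_ge0 => y _; rewrite lee_fin mulr_ge0// heat_ge0.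
    by apply: heat_off_ball => //; rewrite ?invr_gt0 ?exprn_gt0.
  + exact: cvg_cst.
  + apply: cvg_EFin; first exact: nearW.
    have := @cvgMl_tmp _ _ _ _ _ (8 * Num.sqrt 2 ^+ n / d ^+ 2) _ (@cvg_harmonic R).
    by rewrite mulr0; apply.
- apply/integrableP; split; first by apply/measurable_EFinP; exact: measurable_indic.
  rewrite (_ : (\int[leb]_x _)%E = leb U)//.
  by rewrite -(setIT U) -integral_indic// setIT; apply: eq_integral => x _; rewrite gee0_abs.
- move=> k x _; rewrite gee0_abs; last by apply: integral_ge0 => y _; exact: heat_pair_ge0.
  apply: (@le_trans _ _ (\int[leb]_y ((\1_U x)%:E * (heat (harmonic k) x y)%:E))%E).
    apply: ge0_le_integral => //.
    + by move=> y _; exact: heat_pair_ge0.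
    + exact: measurable_heat_section.
    + by apply: measurable_funeM; apply/measurable_EFinP; exact: measurable_heat.
    move=> y _; rewrite -EFinM lee_fin ler_wpM2r ?heat_ge0// ler_piMr//.
  rewrite -mul_ge0_integral//.
  + by rewrite integral_heat ?mule1// harmonic_gt0.
  + by apply/measurable_EFinP; exact: measurable_heat.
  + by move=> y; rewrite lee_fin heat_ge0.
Qed.

Lemma measure_indic E : measurable E -> (\int[leb]_x (\1_E x)%:E = leb E)%E.
Proof. by move=> mE; rewrite integral_indic// setIT. Qed.

(** Heat that leaves B minus A either leaves B or enters A from outside, and the latter equals the
    leakage of A by symmetry. *)
Lemma thin_setD (A B : set Rn) : measurable A -> measurable B -> A `<=` B -> thin A -> thin B -> thin (B `\` A).
Proof.
move=> mA mB AB tA tB eps e0; have e2 : 0 < eps / 2 by rewrite divr_gt0.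
have {}tA := tA _ e2; have {}tB := tB _ e2.
apply: filterS2 tA tB => k hA hB.
have mC E : measurable E -> nonneg_mfun \1_(~` E).
  by move=> mE; apply: nonneg_mfun_indic; exact: measurableC.
rewrite heat_pairC in hA; [|exact: nonneg_mfun_indic|exact: mC].
have mBA : measurable (B `\` A) by exact: measurableD.
apply: (@le_trans _ _ (1%:E * heat_pair (harmonic k) \1_B \1_(~` B) +
    1%:E * heat_pair (harmonic k) \1_(~` A) \1_A)%E); last first.
  by rewrite (splitr eps) EFinD; apply: leeD; rewrite mul1e; [exact: hB|exact: hA].
apply: heat_pair_leD => //; try exact: nonneg_mfun_indic; try exact: mC.
move=> x y; rewrite !mul1r !indicE !in_setC !in_setD.
have : (x \in A) -> (x \in B) by move=> /set_mem/AB/mem_set.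
have : (y \in A) -> (y \in B) by move=> /set_mem/AB/mem_set.
case: (x \in A); case: (y \in A); case: (x \in B); case: (y \in B) => /= h1 h2;
  by [lra|have := h1 isT|have := h2 isT].
Qed.

(** For m large, the part of the union outside A m has small measure and sends out at most that much
    heat; the rest leaks no more than A m does. *)
Lemma thin_bigcup (A : (set Rn)^nat) : (forall m, measurable (A m)) -> nondecreasing_seq A ->
  (leb (\bigcup_m A m) < +oo)%E -> (forall m, thin (A m)) -> thin (\bigcup_m A m).
Proof.
move=> mA ndA Aoo tA eps e0; have e2 : 0 < eps / 2 by rewrite divr_gt0.
have mU : measurable (\bigcup_m A m) by exact: bigcupT_measurable.
have [m hm] : exists m, (leb ((\bigcup_m A m) `\` A m) <= (eps / 2)%:E)%E.
  have := @nonincreasing_cvg_mu _ _ _ leb (fun m => (\bigcup_m A m) `\` A m).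
  rewrite (_ : \bigcap_m _ = set0) ?measure0; last first.
    apply/seteqP; split=> // x h; have [[m _ Amx] _] := h 0%N I.
    by have [_ /(_ Amx)] := h m I.
  move=> /(_ _ _ _ _)/cvg0_near_le h.
  have : \forall m \near \oo, (leb ((\bigcup_m A m) `\` A m) <= (eps / 2)%:E)%E.
    apply: h => //.
    - by rewrite (le_lt_trans _ Aoo)// le_measure ?inE//; exact: measurableD.
    - by move=> m; exact: measurableD.
    - by move=> i j ij; apply/subsetPset; apply: setDS; apply/subsetPset; exact: ndA.
  by move=> [m _ /(_ m (leqnn m))]; exists m.
have {tA}tA := tA m _ e2.
apply: filterS tA => k hA.
set U := \bigcup_m A m in mU Aoo hm *.
have mUA : measurable (U `\` A m) by exact: measurableD.
have n1 : nonneg_mfun (cst 1 : Rn -> R) by split.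
rewrite -(measure_indic mUA) -(heat_pair1 (harmonic_gt0 k) (nonneg_mfun_indic mUA)) in hm.
apply: (@le_trans _ _ (1%:E * heat_pair (harmonic k) \1_(A m) \1_(~` A m) +
    1%:E * heat_pair (harmonic k) \1_(U `\` A m) (cst 1%R))%E); last first.
  by rewrite (splitr eps) EFinD; apply: leeD; rewrite mul1e; [exact: hA|exact: hm].
apply: heat_pair_leD => //; try by apply: nonneg_mfun_indic => //; exact: measurableC.
move=> x y; rewrite !mul1r !indicE !in_setC in_setD.
have : (y \in A m) -> (y \in U) by move=> /set_mem h; apply: mem_set; exists m.
case: (x \in A m); case: (y \in A m); case: (x \in U); case: (y \in U) => /= h;
  by [lra|have := h isT].
Qed.

(** The sigma-algebra is generated by the coordinates, so openness and measurability are recorded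
    side by side. *)
Definition open_borel : set (set Rn) := [set U : set Rn | open U /\ measurable U].

Lemma continuous_rV_coord (i : 'I_n) : continuous (fun x : Rn => x ord0 i).
Proof. exact: coord_continuous. Qed.

(** The preimages of open rays by coordinates are open and generate the sigma-algebra. *)
Lemma measurable_rV_sub_open : (measurable : set (set Rn)) `<=` <<s open_borel >>.
Proof.
apply: smallest_sub; first exact: smallest_sigma_algebra.
move=> A; rewrite -bigcup_seq/= => -[i _ [B mB <-]].
pose T := g_sigma_algebraType open_borel.
have mi : measurable_fun [set: T] (fun x : T => (x : Rn) ord0 i : measurableTypeR R).
  apply: (measurability _ (RGenOInfty.measurableE R)).
  move=> _ [_ [a ->] <-]; rewrite setTI; apply: sub_sigma_algebra; split.
    apply: open_comp; last exact: rray_open.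
    by move=> x _; exact: continuous_rV_coord.
  by rewrite -[X in measurable X]setTI; apply: (@measurable_rV_coord R n i) => //; exact: measurable_itv.
exact: mi.
Qed.

(** Dynkin's theorem for the sets whose trace on Q is thin. Taking traces on Q keeps all measures
    finite, as required for increasing unions. *)
Lemma thin_sub Q E : open Q -> measurable Q -> (leb Q < +oo)%E -> measurable E -> E `<=` Q -> thin E.
Proof.
move=> oQ mQ Qoo mE EQ.
pose H : set (set Rn) := [set E | measurable E /\ thin (E `&` Q)].
suff : H E by move=> [_]; rewrite setIidl.
have fin (F : set Rn) : measurable F -> (leb (F `&` Q) < +oo)%E.
  by move=> mF; rewrite (le_lt_trans _ Qoo)// le_measure ?inE//; exact: measurableI.
have opG : open_borel `<=` H.
  move=> U [oU mU]; split=> //; apply: thin_open; [exact: openI|exact: measurableI|exact: fin].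
have := measurable_rV_sub_open mE; apply: (@lambda_system_subset _ open_borel) => //.
- by move=> A B [oA mA] [oB mB]; split; [exact: openI|exact: measurableI].
- split; first by move=> A _ x _.
  + by apply: opG; split; [exact: openT|exact: measurableT].
  + move=> B A AB [mB tB] [mA tA]; split; first exact: measurableD.
    rewrite (_ : _ `&` _ = (B `&` Q) `\` (A `&` Q)); last by apply/seteqP; split => x /=; tauto.
    have AQ : A `&` Q `<=` B `&` Q by move=> x [/AB].
    exact: (thin_setD (measurableI _ _ mA mQ) (measurableI _ _ mB mQ) AQ tA tB).
  + move=> F ndF HF; split; first by apply: bigcupT_measurable => m; have [] := HF m.
    have mF m : measurable (F m) by have [] := HF m.
    rewrite setI_bigcupl; apply: thin_bigcup.
    * by move=> m; exact: measurableI.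
    * by move=> i j ij; apply/subsetPset; apply: setSI; apply/subsetPset; exact: ndF.
    * by rewrite -setI_bigcupl; apply: fin; exact: bigcupT_measurable.
    * by move=> m; have [] := HF m.
Qed.

Definition tail_above F (M : R) y : R := `|F y| * \1_[set y | M < `|F y|] y.

Lemma measurable_tail F (M : R) : measurable_fun setT F -> measurable_fun setT (tail_above F M).
Proof.
move=> mF; have mn : measurable_fun setT (fun y => `|F y|) by exact: measurableT_comp.
apply: measurable_funM => //; apply: measurable_indic.
rewrite -[X in measurable X]setTI.
rewrite (_ : [set y | _] = (fun y => `|F y|) @^-1` `]M, +oo[).
  by apply: mn => //; exact: measurable_itv.
by apply/seteqP; split => y /=; rewrite in_itv/= andbT.
Qed.

Lemma integral_tail_le (p : R) F (eps : R) : 1 <= p -> measurable_fun setT F ->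
  (\int[leb]_y (`|F y| `^ p)%:E < +oo)%E -> 0 < eps ->
  exists2 M : R, 0 <= M & (\int[leb]_y (tail_above F M y)%:E <= eps%:E)%E.
Proof.
move=> p1 mF Fp e0.
(* The threshold k + 1 is at least 1, so |F| <= |F|^p on the tail and |F|^p dominates. *)
have : \forall k \near \oo, (\int[leb]_y (tail_above F k.+1%:R y)%:E <= eps%:E)%E.
  apply: cvg0_near_le e0; rewrite -(@integral0 _ _ _ leb setT).
  apply: (@dominated_cvg _ _ _ leb setT _ _ _ (fun y => (`|F y| `^ p)%:E)) => //.
  - by move=> k; apply/measurable_EFinP; exact: measurable_tail.
  - move=> y _; apply: cvg_near_cst.
    have [m _ hm] : exists2 m : nat, True & `|F y| <= m%:R.
      by exists (Num.truncn `|F y|).+1 => //; rewrite ltW// truncnS_gt.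
    near=> k.
    rewrite /tail_above indicE memNset ?mulr0//=; apply/negP; rewrite -leNgt.
    rewrite (le_trans hm)// ler_nat ltnW// ltnS.
    by near: k; exact: nbhs_infty_ge.
  - apply/integrableP; split.
      apply/measurable_EFinP.
      by apply: (measurableT_comp (measurable_powR p)); exact: measurableT_comp.
    rewrite (eq_integral (fun y => (`|F y| `^ p)%:E))// => y _.
    by rewrite gee0_abs// lee_fin powR_ge0.
  - move=> k y _; rewrite /tail_above gee0_abs ?lee_fin ?mulr_ge0// indicE.
    have [/set_mem/= h|_] := boolP (y \in _); last by rewrite mulr0 powR_ge0.
    rewrite mulr1 -{1}(powRr1 (normr_ge0 (F y))) ler_powR//.
    by rewrite (le_trans _ (ltW h))// ler1n.
move=> [k _ /(_ k (leqnn k)) hk]; exists k.+1%:R => //.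
Unshelve. all: by end_near. Qed.

(** On E the function f exceeds its heat regularization by d. Integrating over E bounds d |E| by the
    heat exchanged between E and its complement, where f is cut at a level M' and its tail has small
    integral; thinness of E then forces |E| = 0. *)
Lemma bad_set_null f (p M d : R) E : 1 <= p -> measurable_fun setT f ->
  (\int[leb]_y (`|f y| `^ p)%:E <= 1)%E -> 0 < d -> 0 <= M ->
  measurable E -> thin E -> (leb E < +oo)%E -> (forall x, E x -> f x <= M) ->
  (forall s x, 0 < s -> s <= 1 -> E x -> d + `|\int[leb]_y (f y * heat s x y)| <= f x) ->
  leb E = 0%E.
Proof.
move=> p1 mf fp d0 M0 mE tE Eoo fM bad.
pose F y := \1_E y * f y; pose G y := \1_(~` E) y * `|f y|.
have mEC : measurable (~` E) by exact: measurableC.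
have hE := nonneg_mfun_indic mE; have hC := nonneg_mfun_indic mEC.
have h1 : nonneg_mfun (cst 1 : Rn -> R) by split.
have f0 x : E x -> 0 <= f x.
  by move=> /(bad 1 _ ltr01 (lexx 1))/(le_trans _)-> //; rewrite addr_ge0// ltW.
have hF : nonneg_mfun F.
  split; first by apply: measurable_funM => //; exact: measurable_indic.
  by move=> y; rewrite /F indicE; have [/set_mem/f0 ?|_] := boolP (y \in E); rewrite ?mul1r ?mul0r.
have hG : nonneg_mfun G.
  split; last by move=> y; rewrite /G mulr_ge0.
  by apply: measurable_funM; [exact: measurable_indic|exact: measurableT_comp].
(* Integrated form of the gap, with f split into its part [F] on E and the absolute value [G] of its
   part outside E. *)
have main (s : R) : 0 < s -> s <= 1 ->
    (d%:E * leb E + heat_pair s \1_E F <= \int[leb]_x (F x)%:E + heat_pair s \1_E G)%E.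
  move=> s0 s1; rewrite /heat_pair -(measure_indic mE) mul_ge0_integral; first last.
  - exact: ltW.
  - by move=> x; rewrite lee_fin.
  - by apply/measurable_EFinP; exact: measurable_indic.
  rewrite -!ge0_integralD; first last.
  all: try exact: measurableT.
  all: try by move=> x _; apply: integral_ge0 => y _; exact: heat_pair_ge0.
  all: try exact: measurable_heat_pair_inner.
  all: try by apply: measurable_funeM; apply/measurable_EFinP; exact: measurable_indic.
  all: try by apply/measurable_EFinP; case: hF.
  all: try by move=> x _; rewrite ?lee_fin; case: hF.
  all: try by move=> x _; apply: mule_ge0; rewrite lee_fin// ltW.
  apply: ge0_le_integral => //.
  - move=> x _; apply: adde_ge0; first by apply: mule_ge0; rewrite lee_fin// ltW.
    by apply: integral_ge0 => y _; exact: heat_pair_ge0.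
  - apply: emeasurable_funD; last exact: measurable_heat_pair_inner.
    by apply: measurable_funeM; apply/measurable_EFinP; exact: measurable_indic.
  - apply: emeasurable_funD; last exact: measurable_heat_pair_inner.
    by apply/measurable_EFinP; case: hF.
  move=> x _; rewrite /F indicE; have [/set_mem Ex|xE] := boolP (x \in E); last first.
    by rewrite mule0 mul0r !integral0_eq// => y _; rewrite !mul0r.
  rewrite mule1 mul1r.
  have iK : leb.-integrable setT (fun y => (f y * heat s x y)%:E).
    apply: (integrable_mul_kernel p1 mf (measurable_heat s x) (M := peak n s)) => //.
      by move=> y; rewrite heat_ge0 heat_le// ltW.
    by rewrite integral_heat// ltry.
  have iC (C : set Rn) : measurable C ->
      leb.-integrable setT (fun y => (\1_C y * (f y * heat s x y))%:E).
    move=> mC; apply: le_integrable iK => //.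
      apply/measurable_EFinP; apply: measurable_funM; first exact: measurable_indic.
      by apply: measurable_funM => //; exact: measurable_heat.
    move=> y _; rewrite !abse_EFin lee_fin normrM ler_piMl// indicE.
    by case: (_ \in _); rewrite ?normr1 ?normr0.
  have := bad s x s0 s1 Ex.
  have -> : \int[leb]_y (f y * heat s x y) = \int[leb]_y (\1_E y * (f y * heat s x y)) +
      \int[leb]_y (\1_(~` E) y * (f y * heat s x y)).
    rewrite -RintegralD//; [|exact: iC|exact: iC]; apply: eq_Rintegral => y _.
    by rewrite -mulrDl !indicE in_setC; case: (y \in E); rewrite ?addr0 ?add0r mul1r.
  have -> : (\int[leb]_y (1 * (\1_E y * f y) * heat s x y)%:E =
      (\int[leb]_y (\1_E y * (f y * heat s x y)))%:E)%E.
    rewrite fineK; last by apply: integrable_fin_num => //; exact: iC.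
    by apply: eq_integral => y _; rewrite mul1r -mulrA.
  have := norm_Rintegral_le (h := fun y => \1_(~` E) y * (f y * heat s x y)) _.
  have -> : (\int[leb]_y `|\1_(~` E) y * (f y * heat s x y)|%:E =
      \int[leb]_y (1 * G y * heat s x y)%:E)%E.
    apply: eq_integral => y _.
    by rewrite normrM (normrM (f y)) (ger0_norm (heat_ge0 _ _ _)) mul1r /G -mulrA (ger0_norm (_ : 0 <= \1_(~` E) y)).
  move=> /(_ _)/le_trans nb; move: (\int[leb]_y _) (\int[leb]_y _) nb => a b nb ab.
  rewrite (@le_trans _ _ ((f x)%:E + `|b|%:E)%E)//; last first.
    rewrite leeD2l//; apply: nb => //; apply: measurable_funM; first exact: measurable_indic.
    by apply: measurable_funM => //; exact: measurable_heat.
  rewrite -!EFinD lee_fin; have := ler_norm (a + b); have := ler_norm (- b); rewrite normrN.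
  by move: ab; lra.
have Ffin : (\int[leb]_x (F x)%:E < +oo)%E.
  apply: (@le_lt_trans _ _ (M%:E * leb E)%E).
    rewrite -measure_indic// mul_ge0_integral//.
    + apply: ge0_le_integral => //.
      * by move=> x _; rewrite lee_fin; case: hF.
      * by apply/measurable_EFinP; case: hF.
      * by apply: measurable_funeM; apply/measurable_EFinP; exact: measurable_indic.
      move=> x _; rewrite -EFinM lee_fin /F indicE; have [/set_mem/fM|_] := boolP (x \in E).
        by rewrite mul1r mulr1.
      by rewrite mul0r mulr0.
    + by apply/measurable_EFinP; exact: measurable_indic.
  by rewrite lte_mul_pinfty.
(* The integral of [F] exceeds its heat returning to E by at most M times the leakage, since f <= M
   on E; outside E, f is at most M' up to its tail. *)
have split_main (M' s : R) : 0 <= M' -> 0 < s -> s <= 1 ->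
    (d%:E * leb E <= (M + M')%:E * heat_pair s \1_E \1_(~` E) + \int[leb]_y (tail_above f M' y)%:E)%E.
  move=> M'0 s0 s1; have {main} := main s s0 s1.
  have hT : nonneg_mfun (tail_above f M').
    by split; [exact: measurable_tail|move=> y; rewrite /tail_above mulr_ge0].
  have F1 : (\int[leb]_x (F x)%:E <= 1%:E * heat_pair s \1_E F +
      M%:E * heat_pair s \1_(~` E) \1_E)%E.
    rewrite -(heat_pair1 s0 hF) (heat_pairC s hF h1); apply: heat_pair_leD => //.
    move=> x y; rewrite mul1r mul1r /F !indicE in_setC.
    have [/set_mem/fM|_] := boolP (y \in E); last by rewrite !(mul0r, mulr0) addr0.
    by case: (x \in E) => /=; rewrite !(mul0r, mulr0, mul1r, mulr1) ?addr0 ?add0r.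
  have F2 : (1%:E * heat_pair s \1_E F <= \int[leb]_x (F x)%:E)%E.
    rewrite mul1e -(heat_pair1 s0 hF) (heat_pairC s hF h1).
    apply: (le_trans (@heat_pair_leD s 1 0 _ _ (cst 1) F (cst 1) F _ _ _ _ _ _ _ _ _)) => //.
      move=> x y; rewrite mul0r addr0 !mul1r ler_piMl//; first by case: hF.
    by rewrite mul0e adde0 mul1e.
  have G1 : (heat_pair s \1_E G <= M'%:E * heat_pair s \1_E \1_(~` E) +
      1%:E * heat_pair s (tail_above f M') (cst 1%R))%E.
    rewrite (heat_pairC s hT h1); apply: heat_pair_leD => //.
    move=> x y; rewrite mul1r mul1r /G /tail_above !indicE in_setC.
    have f0' := normr_ge0 (f y); have [h|h] := ltP M' `|f y|.
      have -> : (y \in [set z | M' < `|f z|]) by exact: mem_set.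
      move: `|f y| f0' h => a a0 ha.
      by case: (x \in E); case: (y \in E) => /=; lra.
    have -> : (y \in [set z | M' < `|f z|]) = false.
      by apply: memNset => /=; apply/negP; rewrite -leNgt.
    move: `|f y| f0' h => a a0 ha.
    by case: (x \in E); case: (y \in E) => /=; lra.
  rewrite (heat_pair1 s0 hT) in G1.
  rewrite (heat_pairC s hC hE) in F1.
  have a0 : (0 <= heat_pair s \1_E F)%E.
    by do 2!(apply: integral_ge0 => ? _); exact: heat_pair_ge0.
  have J0 : (0 <= heat_pair s \1_E \1_(~` E))%E.
    by do 2!(apply: integral_ge0 => ? _); exact: heat_pair_ge0.
  move: (heat_pair s \1_E G) (heat_pair s \1_E \1_(~` E)) J0 F1 F2 G1 => g J J0.
  rewrite !mul1e; move: (heat_pair s \1_E F) a0 => a a0 F1 F2 G1 main.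
  (* The returning heat appears on both sides and can be cancelled because it is finite. *)
  have afin : a \is a fin_num by rewrite ge0_fin_numE// (le_lt_trans F2).
  rewrite -(leeD2rE _ _ afin) (le_trans main)//.
  rewrite (_ : (_ + a)%E = (a + M%:E * J) + (M'%:E * J + \int[leb]_y (tail_above f M' y)%:E))%E.
    exact: leeD.
  by rewrite EFinD ge0_muleDl ?lee_fin// [LHS]addeC !addeA.
have ddE : (d%:E * leb E <= 0)%E.
  apply/lee_addgt0Pr => eps e0; rewrite add0e.
  have e2 : 0 < eps / 2 by rewrite divr_gt0.
  have [M' M'0 hM'] := integral_tail_le p1 mf (le_lt_trans fp (ltry 1)) e2.
  have MM : 0 < M + M' + 1 by rewrite ltr_wpDl// addr_ge0.
  have [k _ /(_ k (leqnn k)) hk] := tE _ (divr_gt0 e2 MM).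
  rewrite (le_trans (split_main M' _ M'0 (harmonic_gt0 k) _))//.
    by rewrite invf_le1// ler1n.
  rewrite (splitr eps) (EFinD (eps / 2)); apply: leeD; last exact: hM'.
  apply: (le_trans (lee_wpmul2l _ hk)); first by rewrite lee_fin addr_ge0.
  rewrite -EFinM lee_fin mulrA ler_pdivrMr// mulrC ler_wpM2l// ?(ltW e2)// lerDl//.
by apply/eqP; rewrite eq_le measure_ge0 andbT; move: ddE; rewrite pmule_rle0.
Qed.

Definition sqn_ball (m : nat) : set Rn := [set x | sqn x < m%:R].

Lemma open_sqn_ball m : open (sqn_ball m).
Proof.
apply: (@open_comp _ _ (@sqn R n) [set r | r < m%:R]); last exact: open_lt.
move=> x _; rewrite (_ : @sqn R n = (fun y => sqn (y - 0))).
  by apply: differentiable_continuous; exact: differentiable_sqn.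
by apply/funext => y; rewrite subr0.
Qed.

Lemma measurable_sqn_ball m : measurable (sqn_ball m).
Proof.
rewrite -[X in measurable X]setTI.
rewrite (_ : sqn_ball m = @sqn R n @^-1` `]-oo, m%:R[).
  by apply: (@measurable_sqn R n) => //; exact: measurable_itv.
by apply/seteqP; split => y /=; rewrite in_itv.
Qed.

Lemma sqn_ball_lty m : (leb (sqn_ball m) < +oo)%E.
Proof.
rewrite -measure_indic; last exact: measurable_sqn_ball.
(* On the ball |x|^2 < m, the function e^m e^(-|x|^2) is at least 1. *)
apply: (@le_lt_trans _ _ ((expR m%:R)%:E * \int[leb]_x (gaussN 1 0 x)%:E)%E); last first.
  by rewrite integral_gaussN// -EFinM ltry.
rewrite mul_ge0_integral; first last.
- exact: expR_ge0.
- by move=> x; rewrite lee_fin gaussN_ge0.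
- exact: emeasurable_gaussN.
apply: ge0_le_integral => //.
- apply/measurable_EFinP; apply: measurable_indic; exact: measurable_sqn_ball.
- by apply: measurable_funeM; exact: emeasurable_gaussN.
move=> x _; rewrite -EFinM lee_fin /gaussN -expRD indicE mul1r subr0.
have [/set_mem/= h|_] := boolP (x \in _); last exact: expR_ge0.
by rewrite -[leLHS]expR0 ler_expR subr_ge0; exact: ltW h.
Qed.

Lemma ae_le_of_heat_bound_pos f (p : R) (Bd : Rn -> \bar R) : 1 <= p ->
  measurable_fun setT f -> (\int[leb]_y (`|f y| `^ p)%:E <= 1)%E ->
  measurable_fun setT Bd -> (forall x, 0 <= Bd x)%E ->
  (forall s x, 0 < s -> s <= 1 -> ((`|\int[leb]_y (f y * heat s x y)|)%:E <= Bd x)%E) ->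
  {ae leb, forall x, ((f x)%:E <= Bd x)%E}.
Proof.
move=> p1 mf fp mB B0 bd.
(* A point where f > Bd lies in E k for large k: the gap exceeds 1 / (k + 1), while f and |x|^2 stay
   below k. Each E k is bounded with f bounded above on it, as [bad_set_null] requires. *)
pose E (k : nat) : set Rn := sqn_ball k `&`
  ([set x | (Bd x + (k.+1%:R^-1)%:E <= (f x)%:E)%E] `&` [set x | ((f x)%:E <= k%:R%:E)%E]).
have mE k : measurable (E k).
  apply: measurableI; first exact: measurable_sqn_ball.
  rewrite -[X in measurable X]setTI setIA; apply: measurableI.
    by apply: measurable_lee => //; [exact: emeasurable_funD|exact/measurable_EFinP].
  rewrite -[X in measurable X]setTI.
  by apply: measurable_lee => //; exact/measurable_EFinP.
have E0 k : leb (E k) = 0%E.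
  have EQ : E k `<=` sqn_ball k by move=> x [].
  apply: (bad_set_null (M := k%:R) (d := k.+1%:R^-1) p1 mf fp) => //.
  - exact: (thin_sub (@open_sqn_ball k) (@measurable_sqn_ball k) (sqn_ball_lty k) (mE k) EQ).
  - by rewrite (le_lt_trans _ (sqn_ball_lty k))// le_measure ?inE//; exact: measurable_sqn_ball.
  - by move=> x [_ [_]]; rewrite /= lee_fin.
  move=> s x s0 s1 [_ [/= h _]]; rewrite -lee_fin EFinD addeC (le_trans _ h)// leeD2r//.
  exact: bd.
apply: (negligibleS (A := \bigcup_k E k)); last first.
  by apply: negligible_bigcup => k; apply/negligibleP; [exact: mE|exact: E0].
move=> x /= /negP; rewrite -ltNge => bf.
have := B0 x; case Bx : (Bd x) bf => [b| |]// bf; rewrite lee_fin => b0; move: bf; rewrite lte_fin => bf.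
have [k hk] : exists k : nat, (f x - b)^-1 + f x + sqn x < k%:R.
  by exists (Num.truncn ((f x - b)^-1 + f x + sqn x)).+1; exact: truncnS_gt.
have fb : 0 < f x - b by rewrite subr_gt0.
have i0 : 0 < (f x - b)^-1 by rewrite invr_gt0.
have q0 := sqn_ge0 x.
exists k => //; split; first by rewrite /sqn_ball/=; lra.
split=> /=; last by rewrite lee_fin; lra.
rewrite Bx -EFinD lee_fin -lerBrDl invf_ple ?posrE//.
by rewrite (@le_trans _ _ k%:R)// ?ler_nat//; lra.
Qed.

Lemma ae_le_of_heat_bound f (p : R) (Bd : Rn -> \bar R) : 1 <= p ->
  measurable_fun setT f -> (\int[leb]_y (`|f y| `^ p)%:E <= 1)%E ->
  measurable_fun setT Bd -> (forall x, 0 <= Bd x)%E ->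
  (forall s x, 0 < s -> s <= 1 -> ((`|\int[leb]_y (f y * heat s x y)|)%:E <= Bd x)%E) ->
  {ae leb, forall x, ((`|f x|)%:E <= Bd x)%E}.
Proof.
move=> p1 mf fp mB B0 bd.
have hp := ae_le_of_heat_bound_pos p1 mf fp mB B0 bd.
have hn : {ae leb, forall x, ((- f x)%:E <= Bd x)%E}.
  apply: (@ae_le_of_heat_bound_pos (fun y => - f y) p Bd p1 _ _ mB B0).
  - exact: measurableT_comp.
  - by rewrite (eq_integral (fun y => (`|f y| `^ p)%:E))// => y _; rewrite normrN.
  - move=> s x s0 s1; rewrite (_ : \int[leb]_y _ = - \int[leb]_y (f y * heat s x y)).
      by rewrite normrN; exact: bd.
    rewrite -mulN1r -RintegralZl//.
      by apply: eq_Rintegral => y _; rewrite mulN1r mulNr.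
    apply: (integrable_mul_kernel p1 mf (measurable_heat s x) (M := peak n s)) => //.
      by move=> y; rewrite heat_ge0 heat_le// ltW.
    by rewrite integral_heat// ltry.
by apply: filterS2 hp hn => x; case: ger0P.
Qed.

End heat_pairing.

(** * Power moments of the Riesz-type potential *)

Section power_bound.
Context {R : realType} (n : nat).
Local Notation Rn := 'rV[R]_n.
Local Notation mu := lebesgue_measure.
Local Notation lineR := (measurableTypeR R).
Local Notation leb := (lebesgue_rV n).
Implicit Types (x y : Rn) (g U : Rn -> R).

(** The tangent line of the exponential at the barycentre lies below its graph. *)
Lemma expR_convex3 (a b c u v w : R) : 0 <= a -> 0 <= b -> 0 <= c -> a + b + c = 1 ->
  expR (a * u + b * v + c * w) <= a * expR u + b * expR v + c * expR w.
Proof.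
move=> a0 b0 c0 abc; set t := a * u + b * v + c * w.
have h z : expR t * (1 + (z - t)) <= expR z.
  by rewrite (le_trans (ler_wpM2l (expR_ge0 t) (expR_ge1Dx (z - t))))// -expRD subrKC.
rewrite (@le_trans _ _ (a * (expR t * (1 + (u - t))) + b * (expR t * (1 + (v - t))) +
    c * (expR t * (1 + (w - t)))))//; last by rewrite !lerD// ler_wpM2l.
rewrite (_ : a * _ + _ + _ = expR t * ((a + b + c) * (1 - t) + t)).
  by rewrite abc mul1r subrK mulr1.
by rewrite /t; move: (expR _) => e; ring.
Qed.

(* Three-factor Hoelder, in the form of weighted AM-GM; with m / l + m / q' = 1 the
   right-hand side integrates to at most w^(1/l) D^(1/q'). *)
Lemma amgm_factors (a b w D l m q q' : R) : 0 <= a -> 0 <= b -> 0 < w -> 0 < D ->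
  0 < q -> 0 < l -> q <= l -> 0 < q' -> q^-1 + q'^-1 = 1 -> m / l + m / q' = 1 ->
  a * b <= w `^ l^-1 * D `^ q'^-1 *
    (l^-1 * (w^-1 * (a `^ q * b `^ m)) + (q^-1 - l^-1) * a `^ q + q'^-1 * (D^-1 * b `^ m)).
Proof.
move=> a0 b0 w0 D0 q0 l0 ql q'0 qq' ml.
have lq : 0 <= q^-1 - l^-1 by rewrite subr_ge0 lef_pV2.
have [->|an] := eqVneq a 0.
  by rewrite mul0r !mulr_ge0 ?powR_ge0// !addr_ge0// !mulr_ge0 ?invr_ge0 ?powR_ge0 ?(ltW l0) ?(ltW w0) ?(ltW q'0) ?(ltW D0).
have [->|bn] := eqVneq b 0.
  by rewrite mulr0 !mulr_ge0 ?powR_ge0// !addr_ge0// !mulr_ge0 ?invr_ge0 ?powR_ge0 ?(ltW l0) ?(ltW w0) ?(ltW q'0) ?(ltW D0).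
have {an}a0 : 0 < a by rewrite lt_neqAle eq_sym an.
have {bn}b0 : 0 < b by rewrite lt_neqAle eq_sym bn.
rewrite -(lnK a0) -(lnK b0) -(lnK w0) -(lnK D0).
move: (ln a) (ln b) (ln w) (ln D) => A B W V.
rewrite -!expRM -!expRN -!expRD.
(* In logarithms the claim is convexity of exp with the weights 1/l, 1/q - 1/l and 1/q', whose sum
   is 1; the normalizations w and D enter as shifts of the exponents. *)
have := @expR_convex3 l^-1 (q^-1 - l^-1) q'^-1 (- W + (A * q + B * m)) (A * q) (- V + B * m).
move=> /(_ _ lq _ _).
have -> : A + B = W * l^-1 + V * q'^-1 + (l^-1 * (- W + (A * q + B * m)) + (q^-1 - l^-1) * (A * q) +
    q'^-1 * (- V + B * m)).
  transitivity (A * (q * q^-1) + B * (m / l + m / q')); last by ring.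
  by rewrite ml divff ?gt_eqF// !mulr1.
move=> h; rewrite [leLHS]expRD ler_wpM2l ?expR_ge0// h// ?invr_ge0 ?(ltW l0) ?(ltW q'0)//.
by rewrite subrKC.
Qed.

(** The Riesz kernel |y - x|^(gamma - n) with a Gaussian cutoff, written with squared norms. By the
    convention for powers of 0 its value at y = x is 0 when gamma < n. *)
Definition riesz (gamma : R) x y : R :=
  sqn (y - x) `^ (- ((n%:R - gamma) / 2)) * expR (- (sqn (y - x) / 16)).

Lemma riesz_ge0 gamma x y : 0 <= riesz gamma x y.
Proof. by rewrite mulr_ge0 ?powR_ge0 ?expR_ge0. Qed.

Lemma rieszC gamma x y : riesz gamma x y = riesz gamma y x.
Proof. by rewrite /riesz sqnB. Qed.

Lemma measurable_riesz_pair gamma :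
  measurable_fun setT (fun z : Rn * Rn => riesz gamma z.1 z.2).
Proof.
have ms : measurable_fun setT (fun z : Rn * Rn => sqn (z.2 - z.1)).
  by apply: (measurableT_comp (@measurable_sqn R n)); exact: measurable_rV_sub.
apply: measurable_funM; first exact: (measurableT_comp (measurable_powR _)).
apply: measurableT_comp => //; apply: measurableT_comp => //.
exact: measurable_funM.
Qed.

Lemma measurable_riesz gamma x : measurable_fun setT (riesz gamma x).
Proof.
apply: (measurableT_comp (f := fun z : Rn * Rn => riesz gamma z.1 z.2) (g := fun y => (x, y))).
  exact: measurable_riesz_pair.
exact: measurable_pair1.
Qed.

(* Over [t] in [1/lam, 2/lam] the integrand is comparable to lam^(1-b). *)
Lemma powRN_le_laplace (b lam : R) : 0 < b -> 0 < lam ->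
  ((lam `^ (- b))%:E <= (2 * expR 2)%:E * \int[mu]_t (\1_(`]0%R, +oo[) t * (t `^ (b - 1) * expR (- (t * lam))))%:E)%E.
Proof.
move=> b0 l0; pose I : set (lineR) := [set` `]lam^-1, 2 / lam]].
have mI : measurable I by exact: measurable_itv.
have i0 : 0 < lam^-1 by rewrite invr_gt0.
have mf : measurable_fun setT (fun t : lineR => (\1_(`]0%R, +oo[) t * (t `^ (b - 1) * expR (- (t * lam))))%:E).
  apply/measurable_EFinP; apply: measurable_funM; first by apply: measurable_indic; exact: measurable_itv.
  apply: measurable_funM; first exact: measurable_powR.
  by apply: measurableT_comp => //; apply: measurableT_comp => //; exact: measurable_funM.
have f0 t : (0 <= (\1_(`]0%R, +oo[) t * (t `^ (b - 1) * expR (- (t * lam))))%:E)%E.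
  by rewrite lee_fin !mulr_ge0 ?powR_ge0 ?expR_ge0.
(* Here t^b is bounded below at the left endpoint and 1/t at the right one, which makes the constant
   2 e^2 independent of b. *)
pose c := lam `^ (1 - b) / 2 * expR (- 2).
have c0 : 0 <= c by rewrite mulr_ge0 ?expR_ge0// divr_ge0 ?powR_ge0.
have II : (\int[mu]_t (\1_I t)%:E = (lam^-1)%:E)%E.
  rewrite integral_indic// setIT.
  rewrite [LHS](lebesgue_measure_itv `]lam^-1, 2 / lam]) /= lte_fin.
  have -> : lam^-1 < 2 / lam by rewrite ltr_pMl// ltr1n.
  by rewrite -EFinD; congr EFin; field; rewrite gt_eqF.
apply: (@le_trans _ _ ((2 * expR 2)%:E * (c%:E * \int[mu]_t (\1_I t)%:E))%E).
  rewrite II -!EFinM lee_fin /c powRD ?(gt_eqF l0) ?implybT// powRr1 ?(ltW l0)//.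
  rewrite le_eqVlt; apply/orP; left; apply/eqP; rewrite expRN; field.
  by rewrite !gt_eqF ?expR_gt0.
rewrite lee_wpmul2l// ?lee_fin ?mulr_ge0 ?expR_ge0// mul_ge0_integral//; last first.
  by apply/measurable_EFinP; exact: measurable_indic.
apply: ge0_le_integral => //.
- by move=> t _; rewrite mule_ge0 ?lee_fin.
- by apply: measurable_funeM; apply/measurable_EFinP; exact: measurable_indic.
move=> t _; rewrite -EFinM lee_fin [in leLHS]indicE.
have [/set_mem|_] := boolP (t \in I); last by rewrite mulr0 -lee_fin; exact: f0.
rewrite /I/= in_itv/= => /andP[h1 h2]; have t0 : 0 < t by rewrite (lt_trans i0).
rewrite indicE mem_set/=; last by rewrite in_itv/= t0.
rewrite mul1r mulr1 /c ler_pM ?divr_ge0 ?powR_ge0 ?expR_ge0//; last first.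
  by rewrite ler_expR lerN2 -ler_pdivlMr.
rewrite [leRHS]powRD ?(gt_eqF t0) ?implybT// powR_inv1 ?(ltW t0)//.
rewrite (_ : lam `^ (1 - b) / 2 = lam^-1 `^ b * (lam / 2)); last first.
  rewrite powRD ?(gt_eqF l0) ?implybT// powRr1 ?(ltW l0)// -[in RHS]powR_inv1 ?(ltW l0)// -powRrM mulN1r.
  by ring.
rewrite ler_pM ?powR_ge0 ?divr_ge0 ?(ltW l0)//.
  by rewrite ge0_ler_powR ?nnegrE ?(ltW i0) ?(ltW b0) ?(ltW t0) ?(ltW h1).
by rewrite -[leLHS]invrK lef_pV2 ?posrE ?invr_gt0 ?divr_gt0// invf_div.
Qed.

(** Independent of j. The two terms come from t <= 1, where the exponent b/2 is at least n/4, and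
    from t > 1, where the integral of t^(-d-1) is 1/d = (2/n) (j + 1). *)
Definition riesz_mass : R := 2 * expR 2 *
  (Num.sqrt (32 * pi) ^+ n * (\int[mu]_t low_weight (n%:R / 4) t) + Num.sqrt pi ^+ n * (2 / n%:R)).

Lemma riesz_mass_gt0 : (0 < n)%N -> 0 < riesz_mass.
Proof.
move=> n0; have pi0 := pi_gt0 R; rewrite mulr_gt0 ?mulr_gt0 ?expR_gt0// ltr_wpDl//.
  rewrite mulr_ge0 ?exprn_ge0 ?sqrtr_ge0//; apply: Rintegral_ge0 => t _; exact: low_weight_ge0.
by rewrite mulr_gt0 ?divr_gt0 ?ltr0n// exprn_gt0// sqrtr_gt0.
Qed.

(* The singularity |z|^(-b) with n - b = n/(j+1) accounts for the linear growth in j. *)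
Lemma integral_power_gauss (b : R) (j : nat) x : (0 < n)%N -> (0 < j)%N ->
  b = n%:R * j%:R / j.+1%:R ->
  (\int[leb]_y (sqn (y - x) `^ (- (b / 2)) * expR (- (sqn (y - x) / 32)))%:E <=
   (riesz_mass * j.+1%:R)%:E)%E.
Proof.
move=> n0 j0 bE; have n0' : 0 < n%:R :> R by rewrite ltr0n.
have j0' : 1 <= j%:R :> R by rewrite ler1n.
have jS : j.+1%:R = j%:R + 1 :> R by rewrite -natr1.
have b0 : 0 < b / 2 by rewrite bE !divr_gt0// ?mulr_gt0 ?ltr0n.
pose F (y : Rn) (t : lineR) : R :=
  \1_(`]0%R, +oo[) t * t `^ (b / 2 - 1) * gaussN (t + 32^-1) x y.
have F0 y t : 0 <= F y t by rewrite !mulr_ge0 ?powR_ge0 ?gaussN_ge0.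
have mF : measurable_fun setT (fun z : Rn * lineR => (F z.1 z.2)%:E).
  apply/measurable_EFinP; apply: measurable_funM; last first.
    by apply: measurable_gaussN_comp => //; exact: measurable_funD.
  apply: measurable_funM.
    by apply: (measurableT_comp (f := \1_(`]0%R, +oo[) : lineR -> R)).
  exact: (measurableT_comp (measurable_powR _)).
have mFy y : measurable_fun setT (fun t : lineR => (F y t)%:E).
  apply: (measurableT_comp (f := fun z : Rn * lineR => (F z.1 z.2)%:E)
    (g := fun t => (y, t))) => //.
  exact: measurable_pair1.
apply: (@le_trans _ _ ((2 * expR 2)%:E * \int[leb]_y \int[mu]_t (F y t)%:E)%E).
  rewrite mul_ge0_integral; first last.
  - by rewrite mulr_ge0// expR_ge0.
  - by move=> y; apply: integral_ge0 => t _; rewrite lee_fin.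
  - by apply: (measurable_integral_r (T1 := Rn) (T2 := lineR) mu) => // y t; rewrite lee_fin.
  apply: ge0_le_integral => //.
  - by move=> y _; rewrite lee_fin mulr_ge0 ?powR_ge0 ?expR_ge0.
  - have ms : measurable_fun setT (fun y => sqn (y - x)).
      by apply: (measurableT_comp (@measurable_sqn R n)); exact: measurable_rV_sub.
    apply/measurable_EFinP; apply: measurable_funM; first exact: (measurableT_comp (measurable_powR _)).
    by apply: measurableT_comp => //; apply: measurableT_comp => //; exact: measurable_funM.
  - apply: measurable_funeM.
    by apply: (measurable_integral_r (T1 := Rn) (T2 := lineR) mu) => // y t; rewrite lee_fin.
  move=> y _; have := sqn_ge0 (y - x); rewrite le_eqVlt => /orP[/eqP <-|q0].
    rewrite powR0; last by rewrite oppr_eq0 gt_eqF.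
    by rewrite mul0r mule_ge0 ?lee_fin ?mulr_ge0 ?expR_ge0// integral_ge0// => t _; rewrite lee_fin.
  have := powRN_le_laplace b0 q0; set E := expR (- (sqn (y - x) / 32)) => h.
  have E0 : (0 <= E%:E)%E by rewrite lee_fin expR_ge0.
  rewrite mulrC EFinM (le_trans (lee_wpmul2l E0 h))// muleCA mul_ge0_integral.
  - rewrite le_eqVlt; apply/orP; left; apply/eqP; congr (_ * _)%E; apply: eq_integral => t _.
    rewrite -EFinM /F /gaussN /E (_ : - ((t + 32^-1) * sqn (y - x)) =
      - (sqn (y - x) / 32) + - (t * sqn (y - x))); last by ring.
    by rewrite expRD; congr EFin; ring.
  - apply/measurable_EFinP; apply: measurable_funM; first by apply: measurable_indic; exact: measurable_itv.
    apply: measurable_funM; first exact: measurable_powR.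
    by apply: measurableT_comp => //; apply: measurableT_comp => //; exact: measurable_funM.
  - by move=> t; rewrite lee_fin !mulr_ge0 ?powR_ge0 ?expR_ge0.
  - exact: expR_ge0.
rewrite /riesz_mass -mulrA [leRHS]EFinM lee_wpmul2l// ?lee_fin ?mulr_ge0 ?expR_ge0//.
rewrite tonelli//.
have e0 : 0 < n%:R / 4 :> R by rewrite divr_gt0.
have il := integrable_low_weight e0.
have WE : (\int[mu]_t (low_weight (n%:R / 4 : R) t)%:E = (\int[mu]_t low_weight (n%:R / 4 : R) t)%:E)%E.
  by rewrite fineK// integrable_fin_num.
move: (\int[mu]_t low_weight (n%:R / 4 : R) t) WE => W WE.
(* Distance to the critical exponent, n / (2 (j + 1)); its inverse is the only source of the factor
   j + 1. *)
pose d := (n%:R - b) / 2.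
have dE : d = n%:R / (2 * j.+1%:R) by rewrite /d bE jS; field; lra.
have d0 : 0 < d by rewrite dE divr_gt0// mulr_gt0.
(* Majorants in t after integration in y: [G1] where t <= 1, with the rate at least 1/32, and [G2]
   where t > 1, with the rate at least t. *)
pose G1 (t : lineR) := ((Num.sqrt (32 * pi) ^+ n)%:E * (low_weight (n%:R / 4) t)%:E)%E.
pose G2 (t : lineR) := ((Num.sqrt pi ^+ n)%:E * ((\1_(`]1%R, +oo[) t)%:E * (t `^ (- d - 1))%:E))%E.
have G10 t : (0 <= G1 t)%E by rewrite mule_ge0 ?lee_fin ?low_weight_ge0// exprn_ge0// sqrtr_ge0.
have G20 t : (0 <= G2 t)%E.
  apply: mule_ge0; first by rewrite lee_fin exprn_ge0// sqrtr_ge0.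
  by apply: mule_ge0; rewrite lee_fin// powR_ge0.
have mG1 : measurable_fun setT G1.
  by apply: measurable_funeM; apply/measurable_EFinP; exact: measurable_low_weight.
have mp : measurable_fun setT (fun t : lineR => ((\1_(`]1%R, +oo[) t)%:E * (t `^ (- d - 1))%:E)%E).
  by apply: emeasurable_funM; apply/measurable_EFinP; [apply: measurable_indic; exact: measurable_itv|exact: measurable_powR].
have mG2 : measurable_fun setT G2 by exact: measurable_funeM.
have I1 : (\int[mu]_t G1 t = (Num.sqrt (32 * pi) ^+ n * W)%:E)%E.
  rewrite -mul_ge0_integral ?WE ?exprn_ge0 ?sqrtr_ge0//.
  - by apply/measurable_EFinP; exact: measurable_low_weight.
  - by move=> t; rewrite lee_fin low_weight_ge0.
have I2 : (\int[mu]_t G2 t = (Num.sqrt pi ^+ n * d^-1)%:E)%E.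
  rewrite -mul_ge0_integral ?exprn_ge0 ?sqrtr_ge0//.
    rewrite EFinM; congr (_ * _)%E; rewrite -(integral_powR1y d0) [RHS]integral_mkcond.
    by apply: eq_integral => t _; rewrite epatch_indic/= muleC.
  by move=> t; rewrite mule_ge0 ?lee_fin ?powR_ge0.
apply: (@le_trans _ _ (\int[mu]_t (G1 t + G2 t))%E); last first.
  rewrite ge0_integralD// I1 I2 -EFinD lee_fin [leRHS]mulrDl lerD//.
    rewrite ler_peMr// ?ler1n//.
    rewrite mulr_ge0 ?exprn_ge0 ?sqrtr_ge0//.
    by rewrite -lee_fin -WE; apply: integral_ge0 => t _; rewrite lee_fin low_weight_ge0.
  by rewrite -mulrA ler_wpM2l ?exprn_ge0 ?sqrtr_ge0// dE invf_div mulrAC.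
apply: ge0_le_integral => //.
- by move=> t _; apply: integral_ge0 => y _; rewrite lee_fin.
- apply: (@measurable_integral_l _ _ _ _ _ leb (fun y t => (F y t)%:E)) => // y t; rewrite lee_fin //.
- exact: emeasurable_funD.
move=> t _; rewrite /F indicE; have [/set_mem/=|_] := boolP (t \in _); last first.
  rewrite integral0_eq; first exact: adde_ge0.
  by move=> y _; rewrite mul0r mul0r.
rewrite in_itv/= andbT => t0; have t1 : 0 < t + 32^-1 by rewrite addr_gt0.
have pi0 := pi_gt0 R.
rewrite (_ : (\int[leb]_y _)%E = (t `^ (b / 2 - 1) * Num.sqrt (pi / (t + 32^-1)) ^+ n)%:E); last first.
  rewrite EFinM -(integral_gaussN x t1) mul_ge0_integral ?powR_ge0//.
  - by apply: eq_integral => y _; rewrite mul1r EFinM.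
  - exact: emeasurable_gaussN.
  - by move=> y; rewrite lee_fin gaussN_ge0.
have [tle|tgt] := leP t 1.
  rewrite -[leLHS]adde0 leeD// /G1 -EFinM lee_fin mulrC ler_pM ?powR_ge0 ?exprn_ge0 ?sqrtr_ge0//.
    rewrite lerXn2r ?nnegrE ?sqrtr_ge0// ler_sqrt ?mulr_ge0 ?(ltW pi0)//.
    rewrite mulrC ler_wpM2r ?(ltW pi0)// -[leRHS]invrK lef_pV2 ?posrE ?invr_gt0//.
    by rewrite lerDr ltW.
  rewrite /low_weight indicE mem_set/= ?in_itv/= ?t0 ?tle// mul1r.
  rewrite ger_powR ?t0// lerD2r bE mulrAC ler_pdivlMr// -!mulrA ler_pM2l//.
  rewrite ler_pdivrMl// jS; lra.
rewrite -[leLHS]add0e leeD// /G2 indicE mem_set/= ?in_itv/= ?tgt// mul1e -EFinM lee_fin.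
rewrite (@le_trans _ _ (t `^ (b / 2 - 1) * (Num.sqrt pi ^+ n * t `^ (- (n%:R / 2)))))//.
  rewrite ler_wpM2l ?powR_ge0// sqrtrM ?(ltW pi0)// exprMn ler_wpM2l ?exprn_ge0 ?sqrtr_ge0//.
  rewrite (@le_trans _ _ (Num.sqrt t^-1 ^+ n))//.
    rewrite lerXn2r ?nnegrE ?sqrtr_ge0// ler_sqrt ?invr_ge0 ?(ltW t0)//.
    by rewrite lef_pV2 ?posrE// lerDl.
  rewrite -powR_mulrn ?sqrtr_ge0// -powR12_sqrt ?invr_ge0 ?(ltW t0)//.
  rewrite -powR_inv1 ?(ltW t0)// -!powRrM le_eqVlt; apply/orP; left; apply/eqP; congr powR; ring.
rewrite mulrCA -powRD ?(gt_eqF t0) ?implybT// (_ : b / 2 - 1 - n%:R / 2 = - d - 1)//.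
by rewrite /d; ring.
Qed.

Section riesz_potential.
Variables (gamma : R) (j : nat).
Hypotheses (n0 : (0 < n)%N) (j0 : (0 < j)%N) (g0 : 0 < gamma) (gn : gamma < n%:R).
Let q := n%:R / gamma.
Let q' := n%:R / (n%:R - gamma).
(** The Young exponent that sends L^q into L^l for l = q' j: 1 + 1/l = 1/q + 1/m. It stays below q',
    for which the singularity of the kernel is no longer integrable. *)
Let m := q' * j%:R / j.+1%:R.

Let n0R : 0 < n%:R :> R. Proof. by rewrite ltr0n. Qed.
Let j0R : 1 <= j%:R :> R. Proof. by rewrite ler1n. Qed.
Let jS : j.+1%:R = j%:R + 1 :> R. Proof. by rewrite -natr1. Qed.
Let ng0 : 0 < n%:R - gamma. Proof. by rewrite subr_gt0. Qed.
Let q0 : 0 < q. Proof. by rewrite divr_gt0. Qed.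
Let q'0 : 0 < q'. Proof. by rewrite divr_gt0. Qed.
Let m0 : 0 < m. Proof. by apply: divr_gt0; [apply: mulr_gt0 => //; exact: lt_le_trans ltr01 j0R|exact: ltr0Sn]. Qed.

(** The m-th power of the kernel has singularity |z|^(-n j / (j + 1)), and Gaussian rate m/16 >=
    1/32 because q' >= 1 and j >= 1. *)
Lemma integral_riesz_powR x :
  (\int[leb]_y (riesz gamma x y `^ m)%:E <= (riesz_mass * j.+1%:R)%:E)%E.
Proof.
apply: le_trans (@integral_power_gauss (n%:R * j%:R / j.+1%:R) j x n0 j0 erefl).
have ms : measurable_fun setT (fun y => sqn (y - x)).
  by apply: (measurableT_comp (@measurable_sqn R n)); exact: measurable_rV_sub.
apply: ge0_le_integral => //.
- by move=> y _; rewrite lee_fin powR_ge0.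
- apply/measurable_EFinP; apply: (measurableT_comp (measurable_powR _)); exact: measurable_riesz.
- apply/measurable_EFinP; apply: measurable_funM; first exact: (measurableT_comp (measurable_powR _)).
  by apply: measurableT_comp => //; apply: measurableT_comp => //; exact: measurable_funM.
move=> y _; rewrite lee_fin /riesz powRM ?powR_ge0 ?expR_ge0// -powRrM -expRM.
rewrite (_ : - ((n%:R - gamma) / 2) * m = - (n%:R * j%:R / j.+1%:R / 2)); last first.
  by rewrite /m /q' jS; field; rewrite !gt_eqF//; lra.
rewrite ler_wpM2l ?powR_ge0// ler_expR mulNr lerN2 -mulrA ler_wpM2l ?sqn_ge0//.
have : 1 <= q' by rewrite ler_pdivlMr// mul1r gerBl ltW.
have : 2^-1 <= j%:R / j.+1%:R :> R by rewrite ler_pdivlMr ?ltr0n// jS; have h : 1 <= j%:R :> R by []; lra.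
move=> h1 h2; have : 1 * 2^-1 <= q' * (j%:R / j.+1%:R) by rewrite ler_pM.
by rewrite mulrA -/m; lra.
Qed.

(** Pointwise Hoelder step of Young's inequality: [amgm_factors] is integrated in y, normalized by
    the integral W on the right and by the bound D on the integral of the m-th power of the
    kernel. *)
Lemma potential_powR_le g x (c : R) : measurable_fun setT g ->
  (\int[leb]_y (`|g y| `^ q)%:E <= 1)%E -> q <= q' * j%:R -> 0 <= c ->
  (c%:E <= \int[leb]_y (`|g y| * riesz gamma x y)%:E)%E ->
  ((c `^ (q' * j%:R))%:E <= ((riesz_mass * j.+1%:R) ^+ j)%:E *
    \int[leb]_y (`|g y| `^ q * riesz gamma x y `^ m)%:E)%E.
Proof.
move=> mg gq ql c0 cV; set D := riesz_mass * j.+1%:R; set l := q' * j%:R in ql *.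
have D0 : 0 < D by rewrite mulr_gt0 ?riesz_mass_gt0// ltr0n.
have l0 : 0 < l by rewrite mulr_gt0// (lt_le_trans ltr01).
have mgq : measurable_fun setT (fun y => `|g y| `^ q).
  by apply: (measurableT_comp (measurable_powR q)); exact: measurableT_comp.
have mr := measurable_riesz gamma x.
have mrm : measurable_fun setT (fun y => riesz gamma x y `^ m) by exact: (measurableT_comp (measurable_powR m)).
set W := (\int[leb]_y _)%E.
have : (0 <= W)%E by apply: integral_ge0 => y _; rewrite lee_fin mulr_ge0 ?powR_ge0.
have DI := integral_riesz_powR x.
case WE : W => [w| |]//; last by rewrite gt0_muley ?leey// lte_fin exprn_gt0.
rewrite lee_fin => w0; rewrite -EFinM lee_fin; apply/ler_addgt0Pr => eps e0.
(* The normalization must be positive while w may be 0; this shift changes the final bound by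
   exactly eps. *)
pose d := eps / D ^+ j; have d0 : 0 < d by rewrite divr_gt0// exprn_gt0.
have wd : 0 < w + d by rewrite ltr_wpDl.
suff h : c <= (w + d) `^ l^-1 * D `^ q'^-1.
  rewrite (@le_trans _ _ (((w + d) `^ l^-1 * D `^ q'^-1) `^ l))//.
    by rewrite ge0_ler_powR ?nnegrE ?(ltW l0)// mulr_ge0 ?powR_ge0.
  rewrite powRM ?powR_ge0// -!powRrM mulVf ?gt_eqF// powRr1 ?(ltW wd)//.
  rewrite /l mulKf ?gt_eqF// powR_mulrn ?(ltW D0)// mulrDl (mulrC w) lerD2l.
  by rewrite /d divfK// gt_eqF// exprn_gt0.
have qq' : q^-1 + q'^-1 = 1 by rewrite !invf_div -mulrDl subrKC divff// gt_eqF.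
have ml : m / l + m / q' = 1.
  have j1 : j%:R != 0 :> R by rewrite pnatr_eq0 -lt0n.
  have j2 : j.+1%:R != 0 :> R by rewrite pnatr_eq0.
  have q1 : q' != 0 by rewrite gt_eqF.
  by rewrite /m /l; move: j2; rewrite jS => j2; field; rewrite q1 j1 j2.
set P := _ * _.
have P0 : 0 <= P by rewrite mulr_ge0 ?powR_ge0.
have lq : 0 <= q^-1 - l^-1 by rewrite subr_ge0 lef_pV2.
have li : 0 <= l^-1 by rewrite invr_ge0 ltW.
have wi : 0 <= (w + d)^-1 by rewrite invr_ge0 ltW.
have Di : 0 <= D^-1 by rewrite invr_ge0 ltW.
have q'i : 0 <= q'^-1 by rewrite invr_ge0 ltW.
pose c1 := l^-1 / (w + d); pose c2 := q^-1 - l^-1; pose c3 := q'^-1 / D.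
have c10 : 0 <= c1 by rewrite mulr_ge0.
have c30 : 0 <= c3 by rewrite mulr_ge0.
pose F1 y := ((`|g y| `^ q * riesz gamma x y `^ m)%:E)%E.
pose F2 y := ((`|g y| `^ q)%:E)%E.
pose F3 y := ((riesz gamma x y `^ m)%:E)%E.
have mF1 : measurable_fun setT F1 by apply/measurable_EFinP; exact: measurable_funM.
have mF2 : measurable_fun setT F2 by exact/measurable_EFinP.
have mF3 : measurable_fun setT F3 by exact/measurable_EFinP.
have F10 y : (0 <= F1 y)%E by rewrite lee_fin mulr_ge0 ?powR_ge0.
have F20 y : (0 <= F2 y)%E by rewrite lee_fin powR_ge0.
have F30 y : (0 <= F3 y)%E by rewrite lee_fin powR_ge0.
rewrite -lee_fin (le_trans cV)//.
apply: (@le_trans _ _ (P%:E * (c1%:E * \int[leb]_y F1 y + c2%:E * \int[leb]_y F2 y + c3%:E * \int[leb]_y F3 y))%E).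
  rewrite (mul_ge0_integral leb mF1 F10 c10) (mul_ge0_integral leb mF2 F20 lq) (mul_ge0_integral leb mF3 F30 c30).
  have z1 y : (0 <= c1%:E * F1 y)%E by rewrite mule_ge0.
  have z2 y : (0 <= c2%:E * F2 y)%E by rewrite mule_ge0.
  have z3 y : (0 <= c3%:E * F3 y)%E by rewrite mule_ge0.
  have y1 : measurable_fun setT (fun y => c1%:E * F1 y)%E by exact: measurable_funeM.
  have y2 : measurable_fun setT (fun y => c2%:E * F2 y)%E by exact: measurable_funeM.
  have y3 : measurable_fun setT (fun y => c3%:E * F3 y)%E by exact: measurable_funeM.
  rewrite -ge0_integralD// -ge0_integralD//; first last.
  - exact: emeasurable_funD.
  - by move=> y _; rewrite adde_ge0.
  rewrite mul_ge0_integral//; first last.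
  - by move=> y; rewrite !adde_ge0.
  - by apply: emeasurable_funD => //; exact: emeasurable_funD.
  apply: ge0_le_integral => //.
  - by move=> y _; rewrite lee_fin mulr_ge0// riesz_ge0.
  - by apply/measurable_EFinP; apply: measurable_funM => //; exact: measurableT_comp.
  - by apply: measurable_funeM; apply: emeasurable_funD => //; exact: emeasurable_funD.
  move=> y _; rewrite [leRHS](_ : _ = (P * (c1 * (`|g y| `^ q * riesz gamma x y `^ m) +
    c2 * `|g y| `^ q + c3 * riesz gamma x y `^ m))%:E)//.
  rewrite lee_fin.
  have := amgm_factors (normr_ge0 (g y)) (riesz_ge0 gamma x y) wd D0 q0 l0 ql q'0 qq' ml.
  by rewrite -/P !mulrA.
rewrite -[leRHS]mule1 lee_wpmul2l ?lee_fin//.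
apply: (@le_trans _ _ (c1%:E * w%:E + c2%:E * 1%:E + c3%:E * D%:E)%E).
  rewrite leeD ?leeD// ?lee_wpmul2l ?lee_fin//; by rewrite -/W WE.
rewrite -!EFinM -!EFinD lee_fin mulr1.
(* Each of the three normalized integrals is at most 1, and the weights add up to 1. *)
rewrite (_ : 1 = l^-1 + c2 + q'^-1); last by rewrite /c2 subrKC.
rewrite lerD ?lerD//.
  by rewrite /c1 -mulrA ler_piMr// mulrC ler_pdivrMr// mul1r lerDl ltW.
by rewrite /c3 divfK// gt_eqF.
Qed.

(** Integrating the pointwise bound in x and exchanging integrals, the symmetry of the kernel gives
    one more factor D. *)
Lemma integral_potential_powR g U : measurable_fun setT g -> measurable_fun setT U ->
  (forall x, 0 <= U x) -> (\int[leb]_y (`|g y| `^ q)%:E <= 1)%E -> q <= q' * j%:R ->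
  {ae leb, forall x, ((U x)%:E <= \int[leb]_y (`|g y| * riesz gamma x y)%:E)%E} ->
  (\int[leb]_x (U x `^ (q' * j%:R))%:E <= ((riesz_mass * j.+1%:R) ^+ j.+1)%:E)%E.
Proof.
move=> mg mU U0 gq ql UV; set D := riesz_mass * j.+1%:R.
have D0 : 0 < D by rewrite mulr_gt0 ?riesz_mass_gt0// ltr0n.
have mgq : measurable_fun setT (fun y => `|g y| `^ q).
  by apply: (measurableT_comp (measurable_powR q)); exact: measurableT_comp.
pose F x y : \bar R := (`|g y| `^ q * riesz gamma x y `^ m)%:E.
have F0 x y : (0 <= F x y)%E by rewrite lee_fin mulr_ge0 ?powR_ge0.
have mF : measurable_fun setT (fun z : Rn * Rn => F z.1 z.2).
  apply/measurable_EFinP; apply: measurable_funM.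
    by apply: (measurableT_comp (f := fun y => `|g y| `^ q)).
  by apply: (measurableT_comp (measurable_powR m)); exact: measurable_riesz_pair.
have mW := measurable_integral_r leb mF F0.
apply: (@le_trans _ _ (\int[leb]_x ((D ^+ j)%:E * \int[leb]_y F x y))%E).
  apply: ae_ge0_le_integral => //.
  - by move=> x _; rewrite lee_fin powR_ge0.
  - by apply/measurable_EFinP; exact: (measurableT_comp (measurable_powR _)).
  - move=> x _; rewrite mule_ge0 ?lee_fin ?exprn_ge0 ?(ltW D0)//.
    by apply: integral_ge0.
  - exact: measurable_funeM.
  by apply: filterS UV => x h _; exact: potential_powR_le.
rewrite -mul_ge0_integral ?exprn_ge0 ?(ltW D0)//; last by move=> x; exact: integral_ge0.
rewrite exprSr EFinM lee_wpmul2l ?lee_fin ?exprn_ge0 ?(ltW D0)// tonelli//.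
apply: (@le_trans _ _ (\int[leb]_y (D%:E * (`|g y| `^ q)%:E))%E).
  apply: ge0_le_integral; first exact: measurableT.
  - by move=> y _; exact: integral_ge0.
  - exact: (@measurable_integral_l _ _ _ _ _ leb F mF F0).
  - by apply: measurable_funeM; exact/measurable_EFinP.
  move=> y _; rewrite (_ : (\int[leb]_x F x y)%E =
      ((`|g y| `^ q)%:E * \int[leb]_x (riesz gamma y x `^ m)%:E)%E).
    by rewrite muleC lee_wpmul2r ?lee_fin ?powR_ge0//; exact: integral_riesz_powR.
  have mr : measurable_fun setT (fun x => (riesz gamma y x `^ m)%:E).
    by apply/measurable_EFinP; apply: (measurableT_comp (measurable_powR m)); exact: measurable_riesz.
  rewrite (mul_ge0_integral leb mr); [|by move=> x; rewrite lee_fin powR_ge0|exact: powR_ge0].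
  by apply: eq_integral => x _; rewrite -EFinM rieszC.
rewrite -mul_ge0_integral ?(ltW D0)//.
  by rewrite -[leRHS]mule1 lee_wpmul2l// lee_fin ltW.
exact/measurable_EFinP.
Qed.

End riesz_potential.

End power_bound.

(** * From power moments to exponential integrals *)

Section exponential_moments.
Context {R : realType}.
Implicit Types z : R.

Lemma cvg_exp_series z : series (exp_coeff z) @ \oo --> expR z.
Proof. exact: is_cvg_series_exp_coeff. Qed.

Lemma exp_coeff_ge0 z j : 0 <= z -> 0 <= exp_coeff z j.
Proof. by move=> z0; rewrite /exp_coeff/= divr_ge0// exprn_ge0. Qed.

Lemma exp_series_ndecr z : 0 <= z -> nondecreasing_seq (series (exp_coeff z)).
Proof. by move=> z0; apply: nondecreasing_series => j _ _; exact: exp_coeff_ge0. Qed.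

Lemma exp_series_le z m : 0 <= z -> series (exp_coeff z) m <= expR z.
Proof.
move=> z0; apply: nondecreasing_cvgn_le; first exact: exp_series_ndecr.
exact: is_cvg_series_exp_coeff.
Qed.

(** Termwise comparison, from (i + k)! >= i!. *)
Lemma exp_tail_le z (k : nat) : 0 <= z ->
  expR z - series (exp_coeff z) k <= z ^+ k * expR z.
Proof.
move=> z0; rewrite lerBlDr; apply: (cvgr_to_le (@cvg_exp_series z)); near=> m.
have km : (k <= m)%N by near: m; exact: nbhs_infty_ge.
rewrite -lerBlDr sub_series_geq// -{1}(add0n k) big_addn.
rewrite (@le_trans _ _ (\sum_(0 <= i < m - k) z ^+ k * exp_coeff z i))//.
  apply: ler_sum => i _; rewrite /exp_coeff/= exprD (mulrC (z ^+ i)).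
  rewrite -mulrA ler_wpM2l ?exprn_ge0// ler_wpM2l ?exprn_ge0//.
  by rewrite lef_pV2 ?posrE ?ltr0n ?fact_gt0// ler_nat leq_fact// leq_addr.
rewrite -mulr_sumr ler_wpM2l ?exprn_ge0//; exact: exp_series_le.
Unshelve. all: by end_near. Qed.

(** The term m^m / m! of the series of e^m is at most its sum. *)
Lemma exprn_le_fact (m : nat) : m%:R ^+ m <= expR 1 ^+ m * m`!%:R :> R.
Proof.
rewrite -expRM_natl mulr1 -ler_pdivrMr ?ltr0n ?fact_gt0//.
have := @exp_series_le m%:R m.+1 (ler0n R m); apply: le_trans.
by rewrite /series/= big_nat_recr//= lerDr sumr_ge0// => i _; exact: exp_coeff_ge0.
Qed.

(** A binomial coefficient of order L + i is at most 2^(L + i). *)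
Lemma fact_add_le (L i : nat) : ((L + i)`! <= 2 ^ (L + i) * (L`! * i`!))%N.
Proof.
have <- : ('C(L + i, L) * (L`! * i`!))%N = (L + i)`!.
  by have := bin_fact (leq_addr i L); rewrite addKn.
rewrite leq_mul2r; apply/orP; right; move: (L + i)%N => m {i}.
elim: m L => [|m IH] [|k]; rewrite ?bin0 ?expn_gt0// ?bin0n// binS expnS mul2n -addnn.
exact: leq_add.
Qed.

(** Expanding the exponential, the factorials cancel and the geometric factors sum to at most 2. The
    power Y^L is there because the moments are only controlled from order L on. *)
Lemma integral_expR_moments d (T : measurableType d) (m : {measure set T -> \bar R})
    (Y : T -> R) (L : nat) (c : R) : measurable_fun setT Y -> (forall x, 0 <= Y x) -> 0 <= c ->
  (forall i, (\int[m]_x (Y x ^+ (L + i))%:E <= (c * i`!%:R / 2 ^+ i)%:E)%E) ->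
  (\int[m]_x (Y x ^+ L * expR (Y x))%:E <= (2 * c)%:E)%E.
Proof.
move=> mY Y0 c0 hi.
pose g j x := (Y x ^+ L * series (exp_coeff (Y x)) j)%:E.
have mterm i : measurable_fun setT (fun x => (Y x ^+ L * exp_coeff (Y x) i)%:E).
  apply/measurable_EFinP; rewrite /exp_coeff/=.
  by do ?[exact: measurable_funX|apply: measurable_funM].
have termE i x : (Y x ^+ L * exp_coeff (Y x) i)%:E = ((i`!%:R^-1)%:E * (Y x ^+ (L + i))%:E)%E.
  by rewrite -EFinM /exp_coeff/= exprD; congr EFin; ring.
have gE j x : g j x = (\sum_(0 <= i < j) (Y x ^+ L * exp_coeff (Y x) i)%:E)%E.
  by rewrite /g /series/= mulr_sumr sumEFin.
have mg j : measurable_fun setT (g j).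
  rewrite (_ : g j = fun x => (\sum_(0 <= i < j) (Y x ^+ L * exp_coeff (Y x) i)%:E)%E); last first.
    by apply/funext => x; exact: gE.
  by apply: emeasurable_sum => i.
have g0 j x : (0 <= g j x)%E.
  by rewrite gE sume_ge0// => i _; rewrite lee_fin mulr_ge0 ?exprn_ge0 ?exp_coeff_ge0.
have gnd x : nondecreasing_seq (g ^~ x).
  by move=> i j ij; rewrite lee_fin ler_wpM2l ?exprn_ge0//; exact: exp_series_ndecr.
have gl x : g ^~ x @ \oo --> (Y x ^+ L * expR (Y x))%:E.
  apply: cvg_EFin; first exact: nearW.
  by have := @cvgMl_tmp _ _ _ _ _ (Y x ^+ L) _ (@cvg_exp_series (Y x)); apply.
have -> : (\int[m]_x (Y x ^+ L * expR (Y x))%:E = limn (fun j => \int[m]_x g j x))%E.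
  rewrite -monotone_convergence//.
  by apply: eq_integral => x _; apply/esym/cvg_lim.
apply: lime_le.
  apply: ereal_nondecreasing_is_cvgn => i j ij; apply: ge0_le_integral => //.
  by move=> x _; exact: gnd.
apply: nearW => j.
rewrite (eq_integral (fun x => \sum_(0 <= i < j) (Y x ^+ L * exp_coeff (Y x) i)%:E)%E); last first.
  by move=> x _; exact: gE.
rewrite ge0_integral_sum//; last by move=> i x _; rewrite lee_fin mulr_ge0 ?exprn_ge0 ?exp_coeff_ge0.
apply: (@le_trans _ _ (\sum_(0 <= i < j) (c / 2 ^+ i)%:E)%E).
  apply: lee_sum => i _; under eq_integral do rewrite termE.
  rewrite ge0_integralZl ?lee_fin//.
  - rewrite (le_trans (lee_wpmul2l _ (hi i))) ?lee_fin// le_eqVlt; apply/orP; left; apply/eqP.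
    by field; rewrite expf_neq0//= pnatr_eq0 -lt0n fact_gt0.
  - by apply/measurable_EFinP; exact: measurable_funX.
  - by move=> x _; rewrite lee_fin exprn_ge0.
rewrite sumEFin lee_fin -mulr_sumr mulrC ler_wpM2r//.
have -> : \sum_(0 <= i < j) (2 ^+ i)^-1 = 2 - 2 * (2 ^+ j)^-1 :> R.
  elim: j => [|j IH]; first by rewrite big_geq// expr0 invr1; ring.
  by rewrite big_nat_recr//= IH exprS; field; rewrite expf_neq0.
by rewrite gerBl mulr_ge0// invr_ge0 exprn_ge0.
Qed.

End exponential_moments.

(** * The exponential integral of a function dominated by the potential *)

Section exponential_integral.
Context {R : realType} (n : nat).
Local Notation mu := lebesgue_measure.
Local Notation leb := (lebesgue_rV n).
Implicit Types (x y : 'rV[R]_n) (g v : 'rV[R]_n -> R).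

(** With j = L + i, (j+1)^(j+1) <= e^(j+1) (j+1)! and (j+1)! <= 2^(j+1) (L+1)! i!; what remains is
    (2 e M b)^j <= 2^(-j) <= 2^(-i). *)
Lemma moment_bound (M b : R) (L i : nat) : 0 < M -> 0 <= b -> 2 * expR 1 * M * b <= 2^-1 ->
  b ^+ (L + i) * (M * (L + i).+1%:R) ^+ (L + i).+1 <=
  2 * expR 1 * M * L.+1`!%:R * i`!%:R / 2 ^+ i.
Proof.
move=> M0 b0 Mb; have e0 : 0 < expR 1 :> R := expR_gt0 1.
set a := 2 * expR 1 * M in Mb *; have a0 : 0 < a by rewrite !mulr_gt0.
set j := (L + i)%N.
have h1 : j.+1%:R ^+ j.+1 <= expR 1 ^+ j.+1 * j.+1`!%:R :> R := exprn_le_fact j.+1.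
have h2 : j.+1`!%:R <= 2 ^+ j.+1 * (L.+1`!%:R * i`!%:R) :> R.
  by have := fact_add_le L.+1 i; rewrite addSn -/j -(ler_nat R) !natrM natrX.
rewrite (@le_trans _ _ (b ^+ j * (a ^+ j.+1 * (L.+1`!%:R * i`!%:R))))//.
  rewrite ler_wpM2l ?exprn_ge0// exprMn (_ : a = M * (expR 1 * 2)); last by rewrite /a; ring.
  rewrite exprMn -mulrA ler_wpM2l ?exprn_ge0 ?(ltW M0)// (le_trans h1)// exprMn -mulrA.
  by rewrite ler_wpM2l// exprn_ge0// ltW.
have E (u w F G : R) (m : nat) : u ^+ m * (w ^+ m.+1 * (F * G)) = w * F * G * (w * u) ^+ m.
  by rewrite exprS exprMn; ring.
rewrite E.
rewrite ler_wpM2l//; first by rewrite mulr_ge0// mulr_ge0// ltW.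
rewrite -exprVn (@le_trans _ _ (2^-1 ^+ j))//.
  by rewrite lerXn2r ?nnegrE ?invr_ge0// mulr_ge0// ltW.
by rewrite ler_wiXn2l ?invr_ge0 ?invf_le1 ?ler1n ?leq_addl.
Qed.

(** At a level K the two regimes separate: below it v^p controls the integrand because p <= r' k,
    and above it v is comparable to the potential and r' <= q' allows its exponential moments to be
    used. *)
Lemma exp_integral_bound (gamma p A B : R) : (0 < n)%N -> 0 < gamma -> gamma < n%:R -> 1 <= p ->
  0 <= A -> 0 < B ->
  let q := n%:R / gamma in let q' := n%:R / (n%:R - gamma) in
  forall (r' : R) (k : nat), 0 < r' -> r' <= q' -> (0 < k)%N -> p <= r' * k%:R ->
  exists alpha : R, 0 < alpha /\ forall v g : 'rV[R]_n -> R,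
    measurable_fun setT v -> (forall x, 0 <= v x) -> (\int[leb]_x (v x `^ p)%:E <= 1)%E ->
    measurable_fun setT g -> (\int[leb]_x (`|g x| `^ q)%:E <= 1)%E ->
    {ae leb, forall x, ((v x)%:E <= A%:E + B%:E * \int[leb]_y (`|g y| * riesz gamma x y)%:E)%E} ->
    (\int[leb]_x (expR (alpha * v x `^ r') -
        \sum_(0 <= j < k) (alpha * v x `^ r') ^+ j / j`!%:R)%:E <= 1)%E.
Proof.
move=> n0 g0 gn p1 A0 B0 q q' r' k r0 rq k0 pk.
have n0R : 0 < n%:R :> R by rewrite ltr0n.
have ng : 0 < n%:R - gamma by rewrite subr_gt0.
have q0 : 0 < q by rewrite divr_gt0.
have q'1 : 1 <= q' by rewrite ler_pdivlMr// mul1r gerBl ltW.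
have q'0 : 0 < q' by rewrite (lt_le_trans ltr01).
pose M := riesz_mass n : R; have M0 : 0 < M by exact: riesz_mass_gt0.
(* Above 2 A the constant is absorbed: v <= A + B V implies v / (2 B) <= V. Above 1, v^r' <=
   v^q'. *)
pose K := Num.max 1 (2 * A).
have K1 : 1 <= K by rewrite le_max lexx.
have KA : 2 * A <= K by rewrite le_max lexx orbT.
(* J >= q makes every exponent q' (L + i) at least q, as the moment bound requires. *)
pose J := (Num.truncn q).+1; pose L := (k + J)%N.
have qJ : q <= J%:R by rewrite ltW// truncnS_gt.
(* The factor b0 undoes the normalization of v by 2 B, so that Y = a0 v^q' above K; a0 is small
   enough for [moment_bound]. *)
pose b0 := (2 * B) `^ q'; have b00 : 0 < b0 by rewrite powR_gt0// mulr_gt0.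
pose a0 := Num.min 1 (4 * expR 1 * M * b0)^-1.
have d0 : 0 < 4 * expR 1 * M * b0.
  by do 3?[apply: mulr_gt0 => //]; exact: expR_gt0.
have a00 : 0 < a0 by rewrite lt_min ltr01 invr_gt0.
have a01 : a0 <= 1 by rewrite ge_min lexx.
pose b := a0 * b0; have bp : 0 < b by rewrite mulr_gt0.
have bM : 2 * expR 1 * M * b <= 2^-1.
  have : a0 <= (4 * expR 1 * M * b0)^-1 by rewrite ge_min lexx orbT.
  rewrite -[X in _ <= X]mul1r ler_pdivlMr//.
  by rewrite /b; move: (expR 1) => ex; lra.
pose c := 2 * expR 1 * M * L.+1`!%:R; have M0' := ltW M0.
have c0 : 0 <= c by rewrite mulr_ge0// mulr_ge0// mulr_ge0// expR_ge0.
(* Below K: v^(r' k) <= K^(r' k - p) v^p, and the exponential is bounded. *)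
pose C1 := a0 ^+ k * expR (a0 * K `^ r') * K `^ (r' * k%:R - p).
have C10 : 0 <= C1 by rewrite !mulr_ge0 ?exprn_ge0 ?expR_ge0 ?powR_ge0 ?(ltW a00).
(* Above K: Y >= a0, so replacing Y^k by Y^L costs a0^(-J). *)
pose C2 := a0^-1 ^+ J.
have C20 : 0 <= C2 by rewrite exprn_ge0// invr_ge0 ltW.
(* The integral with a0 in the exponent is bounded, but not by 1. Since k >= 1, shrinking the
   exponent by eps shrinks the truncated exponential by at least eps. *)
pose eps := (1 + C1 + C2 * (2 * c))^-1.
have D0 : 0 <= C2 * (2 * c) by apply: mulr_ge0 => //; exact: mulr_ge0.
have den1 : 1 <= 1 + C1 + C2 * (2 * c) by rewrite -addrA lerDl addr_ge0.
have den := lt_le_trans ltr01 den1.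
have e0 : 0 < eps by rewrite invr_gt0.
have e1 : eps <= 1 by rewrite invf_le1.
exists (eps * a0); split; first exact: mulr_gt0.
move=> v g mv v0 vp mg gq vae.
pose U x := (2 * B)^-1 * tail_above v K x.
have BB : 0 < 2 * B by rewrite mulr_gt0.
have U0 x : 0 <= U x by rewrite !mulr_ge0// invr_ge0 ltW.
have mU : measurable_fun setT U by apply: measurable_funM => //; exact: measurable_tail.
have UV : {ae leb, forall x, ((U x)%:E <= \int[leb]_y (`|g y| * riesz gamma x y)%:E)%E}.
  apply: filterS vae => x; have : (0 <= \int[leb]_y (`|g y| * riesz gamma x y)%:E)%E.
    by apply: integral_ge0 => y _; rewrite lee_fin mulr_ge0// riesz_ge0.
  rewrite /U /tail_above indicE (ger0_norm (v0 x)).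
  case: (\int[leb]_y _)%E => [w| |]// w0; last by rewrite leey.
  have [/set_mem/=|_] := boolP (x \in _); last by rewrite mulr0 mulr0.
  rewrite (ger0_norm (v0 x)) mulr1 -EFinM -EFinD !lee_fin => Kv h.
  by rewrite mulrC ler_pdivrMr//; lra.
pose Y x := b * U x `^ q'.
have Y0 x : 0 <= Y x by rewrite mulr_ge0 ?powR_ge0 ?(ltW bp).
have mY : measurable_fun setT Y.
  by apply: measurable_funM => //; exact: (measurableT_comp (measurable_powR q')).
have Ymom i : (\int[leb]_x (Y x ^+ (L + i))%:E <= (c * i`!%:R / 2 ^+ i)%:E)%E.
  have Li : (0 < L + i)%N by rewrite addn_gt0 addn_gt0 k0.
  have ql : q <= q' * (L + i)%:R.
    rewrite (le_trans qJ)// -[leLHS]mul1r ler_pM// ler_nat.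
    by rewrite /L -addnA addnCA leq_addr.
  have YE x : (Y x ^+ (L + i))%:E = ((b ^+ (L + i))%:E * (U x `^ (q' * (L + i)%:R))%:E)%E.
    by rewrite /Y exprMn EFinM (powRrM _ q' (L + i)%:R) powR_mulrn ?powR_ge0.
  have h := integral_potential_powR n0 Li g0 gn mg mU U0 gq ql UV.
  rewrite (eq_integral (fun x => ((b ^+ (L + i))%:E * (U x `^ (q' * (L + i)%:R))%:E)%E))//.
  rewrite -mul_ge0_integral ?exprn_ge0 ?(ltW bp)//; first last.
  - by move=> x; rewrite lee_fin powR_ge0.
  - by apply/measurable_EFinP; exact: (measurableT_comp (measurable_powR _)).
  rewrite (le_trans (lee_wpmul2l _ h)) ?lee_fin ?exprn_ge0 ?(ltW bp)//.
  exact: moment_bound (ltW bp) bM.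
have Yexp := integral_expR_moments mY Y0 c0 Ymom.
have mvr : measurable_fun setT (fun x => eps * a0 * v x `^ r').
  by apply: measurable_funM => //; exact: (measurableT_comp (measurable_powR r')).
have mvp : measurable_fun setT (fun x => v x `^ p) by exact: (measurableT_comp (measurable_powR p)).
have mYe : measurable_fun setT (fun x => Y x ^+ L * expR (Y x)).
  by apply: measurable_funM; [exact: measurable_funX|exact: measurableT_comp].
apply: (@le_trans _ _ (\int[leb]_x (eps%:E * (C1%:E * (v x `^ p)%:E + C2%:E * (Y x ^+ L * expR (Y x))%:E)))%E); last first.
  have f1 x : (0 <= (v x `^ p)%:E)%E by rewrite lee_fin powR_ge0.
  have f2 x : (0 <= (Y x ^+ L * expR (Y x))%:E)%E by rewrite lee_fin mulr_ge0 ?exprn_ge0 ?expR_ge0.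
  have g1 x : (0 <= C1%:E * (v x `^ p)%:E)%E by apply: mule_ge0.
  have g2 x : (0 <= C2%:E * (Y x ^+ L * expR (Y x))%:E)%E by apply: mule_ge0.
  have mg1 : measurable_fun setT (fun x => C1%:E * (v x `^ p)%:E)%E.
    by apply: measurable_funeM; exact/measurable_EFinP.
  have mg2 : measurable_fun setT (fun x => C2%:E * (Y x ^+ L * expR (Y x))%:E)%E.
    by apply: measurable_funeM; exact/measurable_EFinP.
  rewrite -(mul_ge0_integral leb (emeasurable_funD mg1 mg2)); first last.
  - exact: ltW.
  - by move=> x; apply: adde_ge0.
  rewrite ge0_integralD//.
  rewrite -(mul_ge0_integral leb _ f1 C10); last exact/measurable_EFinP.
  rewrite -(mul_ge0_integral leb _ f2 C20); last exact/measurable_EFinP.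
  apply: (@le_trans _ _ (eps%:E * (C1%:E * 1%:E + C2%:E * (2 * c)%:E))%E).
    apply: lee_wpmul2l; first by rewrite lee_fin ltW.
    by apply: leeD; apply: lee_wpmul2l; rewrite ?lee_fin; [exact: C10|exact: vp|exact: C20|exact: Yexp].
  rewrite mule1 [leLHS](_ : _ = (eps * (C1 + C2 * (2 * c)))%:E)// lee_fin (mulrC eps).
  by rewrite ler_pdivrMr// mul1r -addrA lerDr.
apply: ge0_le_integral => //.
- move=> x _; rewrite lee_fin subr_ge0; apply: exp_series_le.
  by rewrite mulr_ge0 ?powR_ge0 ?mulr_ge0 ?ltW.
- apply/measurable_EFinP; apply: measurable_funB; first exact: measurableT_comp.
  apply: measurable_sum => j; apply: measurable_funM => //; exact: measurable_funX.
- apply: measurable_funeM; apply: emeasurable_funD; apply: measurable_funeM; exact/measurable_EFinP.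
move=> x _.
rewrite [leRHS](_ : _ = (eps * (C1 * v x `^ p + C2 * (Y x ^+ L * expR (Y x))))%:E)// lee_fin.
have v0x := v0 x; set t := v x in v0x *; set y := t `^ r'.
have y0 : 0 <= y by exact: powR_ge0.
have ay : 0 <= a0 * y by rewrite mulr_ge0// ltW.
have z0 : 0 <= eps * a0 * y by rewrite -mulrA mulr_ge0// ltW.
rewrite (le_trans (exp_tail_le k z0))//.
(* Here eps^k <= eps, as k > 0 and eps <= 1. *)
rewrite (@le_trans _ _ (eps * ((a0 * y) ^+ k * expR (a0 * y))))//.
  rewrite -mulrA exprMn -mulrA; apply: ler_pM => //.
  - by rewrite exprn_ge0// ltW.
  - by rewrite mulr_ge0 ?exprn_ge0 ?expR_ge0.
  - by rewrite -(prednK k0) exprS ler_piMr ?(ltW e0)// exprn_ile1// ltW.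
  - by rewrite ler_wpM2l ?exprn_ge0// ler_expR ler_piMl.
rewrite ler_wpM2l ?(ltW e0)//.
have [tK|Kt] := leP t K.
  rewrite (@le_trans _ _ (C1 * t `^ p))//; last first.
    by rewrite lerDl; apply: mulr_ge0 => //; apply: mulr_ge0; [exact: exprn_ge0|exact: expR_ge0].
  have yk : y ^+ k <= K `^ (r' * k%:R - p) * t `^ p.
    have [tE|tn0] := eqVneq t 0.
      by rewrite /y tE (powR0 (negbT (gt_eqF r0))) expr0n gtn_eqF// mulr_ge0 ?powR_ge0.
    rewrite -powR_mulrn// -powRrM -{1}(subrK p (r' * k%:R)) powRD ?(negbTE tn0) ?implybT//.
    by rewrite ler_wpM2r ?powR_ge0// ge0_ler_powR ?nnegrE ?subr_ge0// (le_trans ler01).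
  rewrite /C1 exprMn -!mulrA ler_wpM2l ?exprn_ge0 ?(ltW a00)// mulrC ler_pM ?expR_ge0 ?exprn_ge0//.
  by rewrite ler_expR ler_wpM2l ?(ltW a00)// ge0_ler_powR ?nnegrE ?(ltW r0)// (le_trans ler01).
rewrite (@le_trans _ _ (C2 * (Y x ^+ L * expR (Y x))))//; last by rewrite lerDr mulr_ge0 ?powR_ge0.
have t1 : 1 <= t by rewrite (le_trans K1)// ltW.
have YE : Y x = a0 * t `^ q'.
  rewrite /Y /b /b0 /U /tail_above (ger0_norm (v0 x)) -/t indicE mem_set/=; last by rewrite ger0_norm.
  rewrite mulr1 -mulrA -powRM; [|exact: ltW|by apply: mulr_ge0; rewrite ?invr_ge0 ?(ltW BB)].
  by rewrite mulVKf ?gt_eqF.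
have Yy : a0 * y <= Y x by rewrite YE ler_wpM2l ?(ltW a00)// ler_powR.
have Ya : 1 <= Y x / a0.
  by rewrite YE mulrAC divff ?gt_eqF// mul1r -[leLHS](powRr0 t) ler_powR// ltW.
move: (Y x) (Y0 x) Yy Ya {YE} => w w0 Yy Ya.
apply: (@le_trans _ _ (w ^+ k * expR w)).
  by apply: ler_pM; [exact: exprn_ge0|exact: expR_ge0|rewrite lerXn2r ?nnegrE|rewrite ler_expR].
rewrite mulrA ler_wpM2r ?expR_ge0// /L exprD mulrCA ler_peMr ?exprn_ge0//.
by rewrite /C2 -exprMn mulrC exprn_ege1.
Qed.

End exponential_integral.

(** * Complex-valued functions and the final assembly *)

Section conclusion.
Context {R : realType} (n : nat).
Local Notation leb := (lebesgue_rV n).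
Implicit Types (x y : 'rV[R]_n) (phi g : 'rV[R]_n -> R[i]).

Lemma Re_le_modulus (z : R[i]) : `|complex.Re z| <= modulus z.
Proof.
case: z => a b /=; rewrite /modulus /Normc.normc -sqrtr_sqr ler_sqrt ?addr_ge0 ?sqr_ge0//.
by rewrite lerDl sqr_ge0.
Qed.

Lemma Im_le_modulus (z : R[i]) : `|complex.Im z| <= modulus z.
Proof.
case: z => a b /=; rewrite /modulus /Normc.normc -sqrtr_sqr ler_sqrt ?addr_ge0 ?sqr_ge0//.
by rewrite lerDr sqr_ge0.
Qed.

Lemma modulus_le (z : R[i]) : modulus z <= `|complex.Re z| + `|complex.Im z|.
Proof.
case: z => a b /=; rewrite /modulus /Normc.normc.
rewrite -[leRHS]ger0_norm ?addr_ge0// -sqrtr_sqr ler_sqrt ?sqr_ge0// sqrrD !real_normK ?num_real//.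
by rewrite addrAC lerDl mulrn_wge0// mulr_ge0.
Qed.

Lemma modulus_ge0 (z : R[i]) : 0 <= modulus z.
Proof. exact: le_trans (Re_le_modulus z). Qed.

Lemma measurable_modulus phi : cmeasurable phi -> measurable_fun setT (fun x => modulus (phi x)).
Proof.
move=> [mr mi].
rewrite (_ : (fun x => _) = (fun x => Num.sqrt (complex.Re (phi x) ^+ 2 + complex.Im (phi x) ^+ 2))).
  apply: (measurableT_comp (@measurable_sqrtr R)).
  by apply: measurable_funD; exact: measurable_funX.
by apply/funext => x; rewrite /modulus; case: (phi x).
Qed.

Lemma integral_modulus_le1 (p : R) phi : 1 <= p -> (cLnorm p phi <= 1)%E ->
  (\int[leb]_x (modulus (phi x) `^ p)%:E <= 1)%E.
Proof.
move=> p1 h; have p0 : 0 < p by rewrite (lt_le_trans ltr01).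
have E := @poweR_Lnorm _ _ _ leb (fun x => (modulus (phi x))%:E) p (negbT (gt_eqF p0)).
rewrite (_ : (\int[leb]_x _)%E = (cLnorm p phi `^ p)%E); last first.
  rewrite /cLnorm E; apply: eq_integral => x _.
  by rewrite abse_EFin poweR_EFin ger0_norm// modulus_ge0.
rewrite -(poweR1r p) gt0_ler_poweR ?(ltW p0)// ?in_itv/= ?leey ?lexx ?andbT//.
exact: Lnorm_ge0.
Qed.

(** Points are null, by comparison with Gaussians of arbitrarily small mass. This removes the
    diagonal, where [riesz] vanishes by convention and does not bound the mixture. *)
Lemma ae_neq x : (0 < n)%N -> {ae leb, forall y, y != x}.
Proof.
move=> n0; apply: (negligibleS (A := [set y | sqn (y - x) = 0])).
  move=> y /= /negP; rewrite negbK => /eqP ->; rewrite subrr /sqn /dotp.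
  by rewrite big1// => i _; rewrite mxE mul0r.
have mA : measurable [set y : 'rV[R]_n | sqn (y - x) = 0].
  rewrite -[X in measurable X]setTI (_ : [set y | _] = (fun y => sqn (y - x)) @^-1` [set 0])//.
  apply: (measurableT_comp (@measurable_sqn R n)) => //; exact: measurable_rV_sub.
apply/negligibleP => //.
apply/eqP; rewrite eq_le measure_ge0 andbT; apply/lee_addgt0Pr => eps e0; rewrite add0e.
(* The Gaussian of rate pi / d^2 equals 1 at x and has mass d^n <= d <= eps, as n > 0 and d <= 1. *)
pose d := Num.min 1 eps; have d0 : 0 < d by rewrite lt_min ltr01 e0.
have c0 : 0 < pi / d ^+ 2 :> R by rewrite divr_gt0 ?pi_gt0// exprn_gt0.
apply: (@le_trans _ _ (\int[leb]_y (\1_[set y | sqn (y - x) = 0] y)%:E)%E).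
  by rewrite (measure_indic mA).
apply: (@le_trans _ _ (\int[leb]_y (gaussN (pi / d ^+ 2) x y)%:E)%E).
  apply: ge0_le_integral => //.
  - by apply/measurable_EFinP; exact: measurable_indic.
  - exact: emeasurable_gaussN.
  move=> y _; rewrite lee_fin indicE; have [/set_mem/= h|_] := boolP (y \in _).
    by rewrite /gaussN h mulr0 oppr0 expR0.
  exact: gaussN_ge0.
rewrite integral_gaussN// lee_fin invf_div mulrC divfK ?gt_eqF ?pi_gt0//.
rewrite sqrtr_sqr gtr0_norm// (@le_trans _ _ d)//; last by rewrite ge_min lexx orbT.
by rewrite -(prednK n0) exprS ler_piMr ?(ltW d0)// exprn_ile1 ?(ltW d0)// ge_min lexx.
Qed.

Lemma kernel_constant_gt0 (gamma : R) : gamma < n%:R -> 0 < kernel_constant n (gamma / 2).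
Proof.
move=> gn; rewrite /kernel_constant ltr_wpDl//; last by rewrite invr_gt0 subr_gt0 ltr_pM2r.
rewrite mulr_ge0 ?powR_ge0//; apply: Rintegral_ge0 => t _; exact: low_weight_ge0.
Qed.

(** The real and imaginary parts obey the same bound, with |g| in the potential; adding them gives
    the factors 2. *)
Lemma ae_modulus_le_potential (gamma p : R) phi g : (0 < n)%N -> 0 < gamma -> gamma < 2 ->
  gamma < n%:R -> 1 <= p -> cmeasurable phi -> cmeasurable g -> is_fraclap gamma phi g ->
  (\int[leb]_x (modulus (phi x) `^ p)%:E <= 1)%E ->
  {ae leb, forall x, ((modulus (phi x))%:E <= (2 * Num.max 0 (low_constant n gamma))%:E +
    (2 * ((Gam (gamma / 2))^-1 * kernel_constant n (gamma / 2)))%:E *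
      \int[leb]_y (`|modulus (g y)| * riesz gamma x y)%:E)%E}.
Proof.
move=> n0 g0 g2 gn p1 [mphr mphi] [mgr mgi] fl php.
have e0 : 0 < gamma / 2 by rewrite divr_gt0.
have e1 : gamma / 2 <= 1 by rewrite ler_pdivrMr// mul1r ltW.
have Ga0 := Gam_gt0 e0 e1.
have n0R : 0 < n%:R :> R by rewrite ltr0n.
have two (u : R) : 2 * u = u + u by rewrite mulr_natl mulr2n.
set A := Num.max 0 _; set B := _ * kernel_constant n _.
have A0 : 0 <= A by rewrite le_max lexx.
have kc0 := kernel_constant_gt0 gn.
have B0 : 0 < B by rewrite mulr_gt0 ?invr_gt0.
pose V x := (\int[leb]_y (`|modulus (g y)| * riesz gamma x y)%:E)%E.
have V0 x : (0 <= V x)%E.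
  by apply: integral_ge0 => y _; rewrite lee_fin mulr_ge0// riesz_ge0.
have mmg : measurable_fun setT (fun y => modulus (g y)) by exact: measurable_modulus.
have mV : measurable_fun setT V.
  apply: (measurable_integral_r (T1 := 'rV[R]_n) (T2 := 'rV[R]_n) leb
    (f := fun x y => (`|modulus (g y)| * riesz gamma x y)%:E)).
    apply/measurable_EFinP; apply: measurable_funM; last exact: measurable_riesz_pair.
    by apply: measurableT_comp => //; apply: (measurableT_comp mmg).
  by move=> x y; rewrite lee_fin mulr_ge0// riesz_ge0.
pose Bd x := (A%:E + B%:E * V x)%E.
have mB : measurable_fun setT Bd.
  by apply: emeasurable_funD => //; exact: measurable_funeM.
have BV0 x : (0 <= B%:E * V x)%E by rewrite mule_ge0// lee_fin ltW.
have Bd0 x : (0 <= Bd x)%E by rewrite adde_ge0.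
have l0 := @low_weight_ge0 R (gamma / 2).
have ml := @measurable_low_weight R (gamma / 2).
have il := integrable_low_weight e0.
have ln := @low_weight_eq0 R (gamma / 2).
have one (f h : 'rV[R]_n -> R) : measurable_fun setT f -> measurable_fun setT h ->
    (forall x, `|f x| <= modulus (phi x)) -> (forall x, `|h x| <= modulus (g x)) ->
    (forall s x, 0 < s ->
      \int[leb]_y (f y * (Gam (gamma / 2) * heat s x y -
        (Gam (1 - gamma / 2))^-1 * mix (high_weight (gamma / 2)) s x y)) =
      \int[leb]_y (h y * mix (low_weight (gamma / 2)) s x y)) ->
    {ae leb, forall x, ((`|f x|)%:E <= Bd x)%E}.
  move=> mf mh fle hle id.
  have fp : (\int[leb]_y (`|f y| `^ p)%:E <= 1)%E.
    apply: le_trans php; apply: ge0_le_integral; first exact: measurableT.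
    - by move=> y _; rewrite lee_fin powR_ge0.
    - by apply/measurable_EFinP; apply: (measurableT_comp (measurable_powR p)); exact: measurableT_comp.
    - by apply/measurable_EFinP; apply: (measurableT_comp (measurable_powR p)); exact: measurable_modulus.
    - by move=> y _; rewrite lee_fin ge0_ler_powR ?nnegrE ?modulus_ge0// (le_trans ler01).
  apply: (ae_le_of_heat_bound p1 mf fp mB Bd0) => s x s0 s1.
  rewrite (le_trans (convolution_bound_real g0 g2 s0 p1 mf mh fp (id s x s0)))//.
  apply: leeD; first by rewrite lee_fin le_max lexx orbT.
  rewrite /B EFinM -muleA; apply: lee_wpmul2l; first by rewrite lee_fin invr_ge0 ltW.
  have mr := measurable_riesz gamma x.
  have m1 : measurable_fun setT (fun y => (`|modulus (g y)| * riesz gamma x y)%:E).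
    by apply/measurable_EFinP; apply: measurable_funM => //; exact: measurableT_comp.
  rewrite /V mul_ge0_integral; [|exact: m1| |exact: ltW]; last first.
    by move=> y; rewrite lee_fin mulr_ge0// riesz_ge0.
  apply: ae_ge0_le_integral; first exact: measurableT.
  - by move=> y _; rewrite lee_fin; apply: mulr_ge0; [exact: normr_ge0|exact: mix_ge0].
  - apply/measurable_EFinP; apply: measurable_funM; first exact: measurableT_comp.
    exact: measurable_mix_r.
  - by move=> y _; rewrite mule_ge0 ?lee_fin ?(ltW kc0)// mulr_ge0// riesz_ge0.
  - exact: measurable_funeM.
  apply: filterS (ae_neq x n0) => y yx _.
  rewrite -EFinM lee_fin mulrCA; apply: ler_pM; [exact: normr_ge0|exact: mix_ge0| |].
    by rewrite (ger0_norm (modulus_ge0 _)).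
  exact: (mix_le_riesz n0 g0 gn s0 s1 yx).
(* Here c is the real or the imaginary part: both commute with the integral and with multiplication
   by the real kernels. *)
have id (c : R[i] -> R) : (forall f, c (cintegral f) = \int[leb]_y c (f y)) ->
    (forall z a, c (z * real_complex R a) = c z * a) -> forall s x, 0 < s ->
    \int[leb]_y (c (phi y) * (Gam (gamma / 2) * heat s x y -
      (Gam (1 - gamma / 2))^-1 * mix (high_weight (gamma / 2)) s x y)) =
    \int[leb]_y (c (g y) * mix (low_weight (gamma / 2)) s x y).
  move=> ci cM s x s0; have := congr1 c (fraclap_mix_identity x g0 g2 s0 fl).
  by rewrite !ci; under eq_Rintegral do rewrite cM; under [RHS]eq_Rintegral do rewrite cM.
have hr := one _ _ mphr mgr (fun x => Re_le_modulus _) (fun x => Re_le_modulus _)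
  (id _ (fun=> erefl) (@Re_mul_real R)).
have hi := one _ _ mphi mgi (fun x => Im_le_modulus _) (fun x => Im_le_modulus _)
  (id _ (fun=> erefl) (@Im_mul_real R)).
apply: filterS2 hr hi => x hr hi.
apply: (@le_trans _ _ (`|complex.Re (phi x)| + `|complex.Im (phi x)|)%:E).
  by rewrite lee_fin modulus_le.
rewrite EFinD (le_trans (leeD hr hi))// /Bd -/(V x) addeACA -EFinD.
rewrite -ge0_muleDl ?lee_fin ?(ltW B0)// -EFinD.
by rewrite -!two.
Qed.

End conclusion.

Theorem theoremA1 (R : realType) (N : nat) (gamma p : R) :
  (1 <= N)%N -> 0 < gamma -> gamma < 1 -> 1 <= p ->
  let q := N%:R / gamma in
  let r := Num.max p q in
  let r' := r / (r - 1) in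
  let k := `|Num.ceil (p / r')|%N in
  exists alpha : R, 0 < alpha /\
    forall phi g : 'rV[R]_N -> R[i],
      inLp p phi -> is_fraclap gamma phi g -> inLp q g ->
      (cLnorm p phi + cLnorm q g <= 1)%E ->
      (\int[lebesgue_rV N]_x
         (expR (alpha * modulus (phi x) `^ r') -
          \sum_(0 <= j < k) (alpha * modulus (phi x) `^ r') ^+ j / j`!%:R)%:E
       <= 1)%E.
Proof.
move=> n0 g0 g1 p1 q r r' k.
have n1 : 1 <= N%:R :> R by rewrite ler1n.
have gn : gamma < N%:R by rewrite (lt_le_trans g1).
have q1 : 1 < q by rewrite ltr_pdivlMr// mul1r.
have qr : q <= r by rewrite le_max lexx orbT.
have r1 : 1 < r by rewrite (lt_le_trans q1).
have r'0 : 0 < r' by rewrite divr_gt0 ?subr_gt0// (lt_trans ltr01).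
(* The conjugate exponent x / (x - 1) decreases in x and r >= q; for q = N / gamma it equals N / (N
   - gamma). *)
have rq : r' <= N%:R / (N%:R - gamma).
  have -> : N%:R / (N%:R - gamma) = q / (q - 1).
    by rewrite /q; field; rewrite !gt_eqF ?subr_gt0//; lra.
  by rewrite ler_pdivrMr ?subr_gt0// mulrAC ler_pdivlMr ?subr_gt0//; lra.
have pr0 : 0 < p / r' by rewrite divr_gt0// (lt_le_trans ltr01).
(* The ceiling is nonnegative, so the absolute value in [k] changes nothing. *)
have ck : (Num.ceil (p / r') = k%:Z)%R by rewrite /k gez0_abs// ceil_ge0 (lt_trans _ pr0)// ltrN10.
have k0 : (0 < k)%N by have := pr0; rewrite -ceil_gt0 ck ltz_nat.
(* The choice of k as a ceiling enters the proof here: it makes the first surviving power of the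
   series at least p. *)
have pk : p <= r' * k%:R.
  rewrite mulrC -ler_pdivrMr//; have := ceil_ge (p / r'); rewrite ck; exact.
have e0 : 0 < gamma / 2 by rewrite divr_gt0.
have e1 : gamma / 2 <= 1 by lra.
have A0 : 0 <= 2 * Num.max 0 (low_constant N gamma) by rewrite mulr_ge0// le_max lexx.
have B0 : 0 < 2 * ((Gam (gamma / 2))^-1 * kernel_constant N (gamma / 2)).
  by rewrite mulr_gt0// mulr_gt0 ?invr_gt0 ?kernel_constant_gt0// Gam_gt0.
have [alpha [a0 h]] := exp_integral_bound n0 g0 gn p1 A0 B0 r'0 rq k0 pk.
exists alpha; split=> // phi g [mphi _] fl [mg _] norms.
have Lphi : (cLnorm p phi <= 1)%E by rewrite (le_trans _ norms)// leeDl// Lnorm_ge0.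
have Lg : (cLnorm q g <= 1)%E by rewrite (le_trans _ norms)// leeDr// Lnorm_ge0.
have php := integral_modulus_le1 p1 Lphi.
have gq := integral_modulus_le1 (ltW q1) Lg.
apply: (h _ _ (measurable_modulus mphi) (fun x => modulus_ge0 _) php (measurable_modulus mg)).
  rewrite (eq_integral (fun x => (modulus (g x) `^ q)%:E)); first exact: gq.
  by move=> x _; rewrite ger0_norm// modulus_ge0.
by apply: (ae_modulus_le_potential n0 g0 _ gn p1 mphi mg fl php); lra.
Qed.
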